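(* Let $K$ be a number field with class number $h_K$ and fix $\mathcal C\in\mathrm{Cl}(K)$. Then $$\lim_{X\to\infty}\frac{\#\{L/K:[L:K]=2,\ N(\Delta_{L/K})\le X,\ \mathrm{St}(\mathcal O_L)=\mathcal C\}}{\#\{L/K:[L:K]=2,\ N(\Delta_{L/K})\le X\}}=\frac{1}{h_K}.$$
   Context: Extensions are counted inside a fixed algebraic closure of $K$; $\Delta_{L/K}$ is the relative discriminant and $N$ the absolute norm. The Steinitz class $\mathrm{St}(\mathcal O_L)$ is the class of a fractional ideal $\mathfrak a$ of $K$ with $\mathcal O_L\cong\mathcal O_K\oplus\mathfrak a$ as $\mathcal O_K$-modules. *)

(* Defs.v *)
(* Everything lives inside the fixed algebraic closure algC of Q. *)
From mathcomp Require Import all_boot all_order all_algebra all_field.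
Set Implicit Arguments. Unset Strict Implicit. Unset Printing Implicit Defensive.
Import Order.TTheory GRing.Theory Num.Theory.
Local Open Scope ring_scope.

Definition cset := algC -> Prop.

Definition is_subfield (F : cset) : Prop :=
  [/\ F 0, F 1,
      (forall x y, F x -> F y -> F (x - y)),
      (forall x y, F x -> F y -> F (x * y)) &
      (forall x, F x -> x != 0 -> F x^-1)].

Definition number_field (K : cset) : Prop :=
  is_subfield K /\
  exists n (e : 'I_n -> algC), (forall i, K (e i)) /\
    forall x, K x -> exists c : 'I_n -> rat, x = \sum_(i < n) ratr (c i) * e i.

Definition ring_of_int (K : cset) : cset := fun x => K x /\ x \in Aint.

(* Fractional ideals of O_K (nonzero finitely-generated O_K-submodules of K,
   i.e. O_K-submodules I <> 0 with d I ⊆ O_K for some d <> 0). *)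
Definition frac_ideal (K : cset) (I : cset) : Prop :=
  [/\ (forall x, I x -> K x), I 0 /\
      (forall x y, I x -> I y -> I (x + y)),
      (forall r x, ring_of_int K r -> I x -> I (r * x)),
      (exists x, I x /\ x != 0) &
      (exists d, ring_of_int K d /\ d != 0 /\
                 forall x, I x -> ring_of_int K (d * x))].

Definition ideal_equiv (K : cset) (I J : cset) : Prop :=
  exists x, [/\ K x, x != 0 &
    forall y, J y <-> exists i, I i /\ y = x * i].

Definition class_number (K : cset) (h : nat) : Prop :=
  exists rep : 'I_h -> cset,
    [/\ (forall i, frac_ideal K (rep i)),
        (forall i j, ideal_equiv K (rep i) (rep j) -> i = j) &
        (forall I, frac_ideal K I -> exists i, ideal_equiv K I (rep i))].

Definition quad_ext (K L : cset) : Prop :=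
  [/\ is_subfield L, (forall x, K x -> L x) &
      exists a b, [/\ L a, L b &
        forall x, L x -> exists k1 k2, [/\ K k1, K k2, x = k1 * a + k2 * b &
          forall l1 l2, K l1 -> K l2 -> x = l1 * a + l2 * b -> l1 = k1 /\ l2 = k2]]].

(* The nontrivial K-embeddings of L into algC (tau only matters on L). *)
Definition nontriv_K_emb (K L : cset) (tau : algC -> algC) : Prop :=
  [/\ (forall x y, L x -> L y -> tau (x + y) = tau x + tau y),
      (forall x y, L x -> L y -> tau (x * y) = tau x * tau y),
      (forall k, K k -> tau k = k) &
      (exists x, L x /\ tau x != x)].

(* Discriminant of the pair (b1, b2): det (sigma_i b_j)^2. *)
Definition disc_elt (K L : cset) : cset := fun d =>
  exists b1 b2 tau, [/\ ring_of_int L b1, ring_of_int L b2, nontriv_K_emb K L tau &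
    d = (b1 * tau b2 - tau b1 * b2) ^+ 2].

Definition rel_disc (K L : cset) : cset := fun y =>
  exists n (c d : 'I_n -> algC),
    [/\ (forall i, ring_of_int K (c i)), (forall i, disc_elt K L (d i)) &
        y = \sum_(i < n) c i * d i].

Definition ideal_norm_is (K : cset) (I : cset) (n : nat) : Prop :=
  exists r : 'I_n -> algC, (forall i, ring_of_int K (r i)) /\
    forall x, ring_of_int K x -> exists! i, I (x - r i).

Definition disc_norm_le (K L : cset) (X : nat) : Prop :=
  exists n, ideal_norm_is K (rel_disc K L) n /\ (n <= X)%N.

Definition steinitz_is (K L : cset) (C : cset) : Prop :=
  exists a, [/\ frac_ideal K a, ideal_equiv K a C &
    exists phi : algC -> algC * algC,
      [/\ (forall x, ring_of_int L x -> ring_of_int K (phi x).1 /\ a (phi x).2),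
          (forall x y, ring_of_int L x -> ring_of_int L y ->
              phi (x + y) = ((phi x).1 + (phi y).1, (phi x).2 + (phi y).2)),
          (forall k x, ring_of_int K k -> ring_of_int L x ->
              phi (k * x) = (k * (phi x).1, k * (phi x).2)),
          (forall x y, ring_of_int L x -> ring_of_int L y -> phi x = phi y -> x = y) &
          (forall u v, ring_of_int K u -> a v ->
              exists x, ring_of_int L x /\ phi x = (u, v))]].

Definition count_is (P : cset -> Prop) (n : nat) : Prop :=
  exists f : 'I_n -> cset,
    [/\ (forall i, P (f i)),
        (forall i j, (forall x, f i x <-> f j x) -> i = j) &
        (forall L, P L -> exists i, forall x, L x <-> f i x)].

(* Main.v *)
Require Import Defs.
From HB Require Import structures.
From mathcomp Require Import all_boot all_order all_algebra all_field.
From mathcomp Require Import boolp classical_sets.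
From mathcomp Require Import zify ring lra.
Set Implicit Arguments. Unset Strict Implicit. Unset Printing Implicit Defensive.
Import Order.TTheory GRing.Theory Num.Theory.
Local Open Scope ring_scope.

(** A quadratic extension is $L=K(\sqrt D)$ with $D$ a nonsquare, unique modulo squares. The $r$ for
    which some $(t+r\sqrt D)/2$ with $t\in O_K$ is integral form a fractional ideal [al D].
    Projection to this coordinate splits, so $O_L\cong O_K\oplus$ [al D] ([steinitz_al],
    [steinitzP]), and $\Delta_{L/K}=D\cdot(\mathrm{al}\,D)^2$ ([rel_discE]). As
    $\mathrm{al}(k^2D)=k^{-1}\mathrm{al}(D)$, fixing an ideal $I$ in a class turns the fields with
    that Steinitz class into orbits of nonsquares $D$ with $\mathrm{al}\,D=I$, under the group $V$
    of squares of units, ordered by $N(DI^2)$. Two facts about the number [Mc I X] of such orbits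
    then suffice, squares giving at most one orbit: asymptotically it does not depend on $I$
    ([Mc_compare]), and its sum over the classes grows at least linearly ([total_lower]).

    For the comparison, the condition $\mathrm{al}\,D=I$ is sieved. [sieve_set z I] requires
    $I\subseteq\mathrm{al}\,D$ and forbids only the enlargements $B$ of $I$ with $kB\subseteq I$ for
    some $k\le z$; it depends on $D$ modulo $mI^{-2}$ only, $m=4(z!)^2$. If $I$ is integral and
    prime to $m$, it is a disjoint union of $N(I^2)$ translates of [sieve_set z O]
    ([sieve_translates]). Translation does not change the asymptotic count ([Bsum_translates]), and
    the smoothed count of a periodic set of integers is asymptotically homogeneous ([Bsum_regular]);
    hence the factor $N(I^2)$ cancels against the normalisation $N(DI^2)\le X$. Elements wrongly let
    through satisfy $DI^2=\mathfrak k\mathfrak m^2$ with $N(\mathfrak m)>z$ and fill only $O(X/z)$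
    orbits ([tail_count]).

    All counts are first made with the Riesz means $\sum(X-N(D))$. The sum over orbits is unfolded
    to a sum over lattice points with a weight that varies slowly under translation
    ([hX_translate]); monotonicity removes the smoothing at the end ([Mc_asymp]). Units enter only
    through reduction theory: each $V$-orbit contains an element with comparable absolute values
    ([V_balance]), and few elements of $V$ preserve that property ([V_proper]). Invertibility of
    ideals is drawn from the finiteness of the class number ([imulV]). *)

Local Notation pQtoC := (map_poly (ratr : rat -> algC)).
                                     

(** * Algebraic integers: clearing denominators, and integer multiples *)

Lemma Aint_scale (x : algC) : exists2 k : int, k != 0 & k%:~R * x \in Aint.
Proof.
have [q [Dq mq] rq] := minCpolyP x.
have q0 : root (pQtoC q) x by rewrite rq.
have [p [a a0 Dp]] := rat_poly_scale q.
have sq : size q = size p.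
  by rewrite Dp size_scale ?invr_eq0 ?intr_eq0 // size_map_poly_id0 // intr_eq0 lead_coef_eq0;
     apply: contraTneq mq => p0; rewrite Dp p0 rmorph0 scaler0 monicE lead_coef0 eq_sym oner_eq0.
have qn0 : q != 0 by exact: monic_neq0.
have [n sn] : exists n, size p = n.+1 by exists (size p).-1; rewrite prednK // -sq lt0n size_poly_eq0.
have la : p`_n = a.
  have : lead_coef q = 1 by exact/eqP.
  rewrite lead_coefE sq sn /= Dp coefZ coef_map /= => /(congr1 (fun t => a%:~R * t)).
  by rewrite mulVKf ?intr_eq0 // mulr1 => /intr_inj.
(* [P] is built so that $P(aX)=a^{n-1}p(X)$, with $p$ the integral multiple of the minimal
   polynomial and $a$ its leading coefficient; hence $ax$ is a root of a monic integral
   polynomial. *)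
exists a => //; pose P : {poly algC} := 'X^n + \poly_(i < n) (p`_i * a ^+ (n.-1 - i))%:~R.
have sP : (size (\poly_(i < n) (p`_i * a ^+ (n.-1 - i))%:~R : {poly algC}) < size ('X^n : {poly algC}))%N.
  by rewrite size_polyXn ltnS size_poly.
apply: (@root_monic_Aint P).
- have : \sum_(i < n.+1) (p`_i)%:~R * x ^+ i = 0.
    move: q0; rewrite /root horner_coef size_map_poly sq sn => /eqP.
    move=> /(congr1 (fun t => a%:~R * t)); rewrite mulr0 mulr_sumr => E.
    rewrite -[RHS]E; apply: eq_bigr => i _.
    rewrite coef_map /= Dp coefZ coef_map /= rmorphM fmorphV /= !rmorph_int.
    by rewrite !mulrA divff ?mul1r // intr_eq0.
  rewrite big_ord_recr /= la => E.
  apply/eqP; rewrite /P hornerD hornerXn horner_poly.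
  case: n sn la sP E @P => [|n] sn la sP E _; first by move: E; rewrite !big_ord0 add0r expr0 mulr1 => /eqP; rewrite intr_eq0 (negPf a0).
  transitivity (a%:~R ^+ n * (\sum_(i < n.+1) (p`_i)%:~R * x ^+ i + a%:~R * x ^+ n.+1)); last by rewrite E mulr0.
  rewrite mulrDr addrC; congr (_ + _); last by rewrite mulrA -exprSr exprMn.
  rewrite mulr_sumr; apply: eq_bigr => i _; rewrite /= exprMn rmorphM rmorphXn /=.
  have -> : a%:~R ^+ n = a%:~R ^+ (n - i) * a%:~R ^+ i :> algC.
    by rewrite -exprD subnK // -ltnS.
  by ring.
- by rewrite monicE lead_coefDl // lead_coefXn.
- apply/polyOverP => i; rewrite coefD coefXn coef_poly rpredD ?rpred_nat //.
  by case: ifP => _; rewrite ?rpred0 ?intr_int.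
Qed.

(** Up to sign, the integer is the constant term of the minimal polynomial. It is nonzero, for
    otherwise division by $X$ would leave a smaller polynomial vanishing at [x]. *)
Lemma Aint_dvd_int (x : algC) : x \in Aint -> x != 0 ->
  exists2 k : int, k != 0 & exists2 y, y \in Aint & k%:~R = x * y.
Proof.
move=> xA x0.
have [q [Dq mq] rq] := minCpolyP x.
have iq : forall i, (pQtoC q)`_i \in Num.int by rewrite -Dq; exact/polyOverP.
have q0 : root (pQtoC q) x by rewrite rq.
case/intrP: (iq 0%N) => k Dk; exists (- k); last first.
  exists (\sum_(i < (size q).-1) (pQtoC q)`_i.+1 * x ^+ i).
    by apply: rpred_sum => i _; rewrite rpredM ?rpredX // Aint_Cint.
  have sq : (size q = (size q).-1.+1)%N by rewrite prednK // lt0n size_poly_eq0 monic_neq0.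
  move: q0; rewrite /root horner_coef size_map_poly sq big_ord_recl /= expr0 mulr1 Dk => /eqP E.
  apply/eqP; rewrite rmorphN /= eq_sym -addr_eq0 addrC -{}[X in _ == X]E mulr_sumr.
  by apply/eqP; congr (_ + _); apply: eq_bigr => i _; rewrite exprSr; ring.
rewrite oppr_eq0 -(intr_eq0 algC) -Dk coef_map fmorph_eq0; apply/negP => /eqP q00.
have : root q 0 by rewrite /root horner_coef0 q00.
rewrite root_factor_theorem subr0 => /dvdpP[g Dg].
have g0 : g != 0 by apply: contraTneq mq => g0; rewrite Dg g0 mul0r monicE lead_coef0 eq_sym oner_eq0.
have : root (pQtoC g) x.
  by move: q0; rewrite Dg rmorphM /= rootM map_polyX /root hornerX (negPf x0) orbF.
rewrite rq => /dvdp_leq => /(_ g0); rewrite Dg size_mulX //; lia.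
Qed.

(** * Complex embeddings of a number field and a lattice of finite index in its integers *)

Section Embeddings.
Variables (F : fieldExtType rat) (iota : {rmorphism F -> algC}) (z : F).
Hypothesis gen_z : forall x, exists p : {poly rat}, iota x = (pQtoC p).[iota z].

Lemma embedding_of_root (q : {poly rat}) (w : algC) :
  (forall p, root (pQtoC p) (iota z) = (q %| p)) -> root (pQtoC q) w ->
  exists f : {rmorphism F -> algC},
    forall x p, iota x = (pQtoC p).[iota z] -> f x = (pQtoC p).[w].
Proof.
move=> rq qw; pose pol x := sval (cid (gen_z x)).
have polP x : iota x = (pQtoC (pol x)).[iota z] by rewrite /pol; case: cid.
pose f x := (pQtoC (pol x)).[w].
have fP x p : iota x = (pQtoC p).[iota z] -> f x = (pQtoC p).[w].
  move=> E; apply/eqP; rewrite -subr_eq0 -hornerN -hornerD -rmorphB /=.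
  have : root (pQtoC (pol x - p)) (iota z).
    by rewrite /root rmorphB /= hornerD hornerN -polP -E subrr.
  rewrite rq => /dvdpP[g ->]; rewrite rmorphM /= hornerM.
  by rewrite (eqP qw) mulr0.
have fB : zmod_morphism f.
  move=> x y; rewrite (fP _ (pol x - pol y)); first by rewrite rmorphB /= hornerD hornerN.
  by rewrite !rmorphB /= hornerD hornerN -!polP.
have fM : monoid_morphism f.
  split=> [|x y]; first by rewrite (fP _ 1) ?rmorph1 ?hornerE.
  rewrite (fP _ (pol x * pol y)); first by rewrite rmorphM /= hornerM.
  rewrite (rmorphM iota) (rmorphM (map_poly ratr)) hornerM -!polP //.
pose m1 := GRing.isZmodMorphism.Build _ _ f fB.
pose m2 := GRing.isMonoidMorphism.Build _ _ f fM.
pose g : {rmorphism F -> algC} := HB.pack f m1 m2.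
by exists g.
Qed.

End Embeddings.

Definition integers (F : fieldType) (iota : F -> algC) : set F := fun x => iota x \in Aint.

(** What the later sections need to know of the number field. The family [e] need not be an integral
    basis: its lattice lies between $dO$ and $O$. Stability of the embeddings under conjugation
    serves to recognise real coordinates. *)
Record field_embeddings (F : fieldType) (iota : {rmorphism F -> algC}) (n : nat)
    (s : 'I_n -> {rmorphism F -> algC}) (e : 'I_n -> F) (d : nat) : Prop :=
  FieldEmbeddings {
  emb_dim_gt0 : (0 < n)%N;
  emb_basis_int : forall i, integers iota (e i);
  emb_span : forall x, exists c : 'I_n -> rat, x = \sum_i ratr (c i) * e i;
  emb_index_gt0 : (0 < d)%N;
  emb_index : forall x, integers iota x ->
    exists c : 'I_n -> int, d%:R * x = \sum_i (c i)%:~R * e i;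
  emb_det : \det (\matrix_(j, i) s j (e i)) != 0;
  emb_conj : forall j, exists k, forall x, s k x = (s j x)^* }.

(** The powers of an integral generator [z] serve as [e]; the embeddings send [z] to the roots of
    its minimal polynomial, and the determinant is a Vandermonde determinant. *)
Lemma field_embeddings_exist (F : fieldExtType rat) (iota : {rmorphism F -> algC}) (z : F) :
  (forall x, exists p : {poly rat}, iota x = (pQtoC p).[iota z]) ->
  iota z \in Aint ->
  exists n s e d, @field_embeddings F iota n s e d.
Proof.
move=> gen_z int_z.
have [q [Dq mq] rq] := minCpolyP (iota z).
have q0 := monic_neq0 mq.
have qz : root (pQtoC q) (iota z) by rewrite rq.
have irr : irreducible_poly q.
  by apply/(subfx_irreducibleP qz q0)=> p pz0 nzp; rewrite dvdp_leq // -rq.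
(* An irreducible [q] with a factor in common with its derivative would divide it, which degrees
   forbid in characteristic zero. *)
have sep : separable_poly q.
  rewrite unlock /coprimep.
  have g0 : gcdp q q^`() != 0 by rewrite gcdp_eq0 (negPf q0).
  apply: contraT => sg; have := irr.2 _ sg (dvdp_gcdl _ _).
  move=> /eqp_dvdl E; have : q %| q^`() by rewrite -E dvdp_gcdr.
  have sq : (1 < size q)%N by case: irr.
  have q'0 : q^`() != 0.
    apply: contraTneq isT => q'0; have : q^`()`_(size q).-2 = 0 by rewrite q'0 coef0.
    rewrite coef_deriv; have -> : ((size q).-2.+1 = (size q).-1)%N by lia.
    by rewrite -lead_coefE (eqP mq) => /eqP; rewrite pnatr_eq0; lia.
  by move=> /(dvdp_leq q'0); rewrite leqNgt lt_size_deriv.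
have [r Dr] := closed_field_poly_normal (pQtoC q).
have /eqP lq : lead_coef (pQtoC q) == 1 by rewrite -monicE map_monic.
rewrite lq scale1r in Dr.
have ur : uniq r by rewrite -separable_prod_XsubC -Dr separable_map.
have rr w : (w \in r) = root (pQtoC q) w by rewrite Dr root_prod_XsubC.
have sr : size r = (size q).-1.
  by rewrite -(size_map_poly (ratr : rat -> algC)) Dr size_prod_XsubC.
pose n := size r.
have sP (j : 'I_n) := cid (embedding_of_root gen_z rq (etrans (esym (rr _)) (mem_nth 0 (ltn_ord j)))).
pose s j := sval (sP j).
have sE j x p : iota x = (pQtoC p).[iota z] -> s j x = (pQtoC p).[r`_j].
  by rewrite /s; case: (sP j) => f /= H; apply: H.
have sz j i : s j (z ^+ i) = r`_j ^+ i.
  by rewrite (sE _ _ 'X^i) !map_polyXn !hornerXn ?rmorphXn.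
have n0 : (0 < n)%N by rewrite /n sr -subn1 subn_gt0; case: irr.
pose e (i : 'I_n) := z ^+ i.
have span x : exists c : 'I_n -> rat, x = \sum_i ratr (c i) * e i.
  have [p Dp] := gen_z x; exists (fun i => (p %% q)`_i).
  apply: (fmorph_inj iota); rewrite rmorph_sum /= Dp {1}(divp_eq p q).
  rewrite rmorphD rmorphM /= hornerD hornerM (eqP qz) mulr0 add0r.
  rewrite (horner_coef_wide _ (n := n)); last first.
    by rewrite size_map_poly /n sr -ltnS prednK ?ltn_modp // lt0n size_poly_eq0.
  by apply: eq_bigr => i _; rewrite rmorphM fmorph_rat rmorphXn coef_map.
pose V : 'M[algC]_n := \matrix_(j, i) s j (e i).
have DV : V = (Vandermonde n (\row_j r`_j))^T.
  by apply/matrixP=> j i; rewrite !mxE sz.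
have V0 : \det V != 0.
  rewrite DV det_tr det_Vandermonde; apply/prodf_neq0 => i _; apply/prodf_neq0 => j ij.
  by rewrite !mxE subr_eq0 nth_uniq // gt_eqF.
have rA (j : 'I_n) : r`_j \in Aint.
  have : root (pQtoC q) r`_j by rewrite -rr mem_nth.
  rewrite -Dq => /root_monic_Aint; apply; first exact: minCpoly_monic.
  exact: int_z.
have sA j x : integers iota x -> s j x \in Aint.
  move=> xA; have [g [Dg mg] rg] := minCpolyP (iota x).
  apply: (@root_monic_Aint (pQtoC g)); rewrite ?map_monic //; last by rewrite -Dg; exact: xA.
  have gx : (map_poly ratr g).[x] = 0 :> F.
    apply: (fmorph_inj iota); rewrite rmorph0 -horner_map -map_poly_comp.
    rewrite (eq_map_poly (g := ratr)); last by move=> a /=; rewrite fmorph_rat.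
    by apply/eqP; rewrite -/(root _ _) rg.
  rewrite /root -(rmorph0 (s j)) -gx -horner_map -map_poly_comp; apply/eqP.
  by congr (_.[_]); apply: eq_map_poly => a /=; rewrite fmorph_rat.
have VA : \det V \in Aint.
  rewrite /determinant; apply: rpred_sum => t _; rewrite rpredMsign rpred_prod // => j _.
  by rewrite !mxE sz rpredX.
(* An integer multiple [k] of $\det V$ gives the index [d]: by Cramer's rule the coordinates of an
   integer become algebraic integers after multiplication by $\det V$, so [k] times them are
   rational integers. *)
have [k k0 [y yA Dk]] := Aint_dvd_int VA V0.
exists n, s, e, `|k|%N; split=> //.
- by move=> i; rewrite /integers rmorphXn rpredX.
- by rewrite lt0n absz_eq0.
- move=> x xO; have [c Dc] := span x.
  have Vc : V *m (\col_i ratr (c i)) = \col_j s j x.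
    apply/colP=> j; rewrite !mxE Dc rmorph_sum; apply: eq_bigr => i _.
    by rewrite !mxE rmorphM fmorph_rat mulrC.
  have adjA i j : (\adj V) i j \in Aint.
    rewrite !mxE /cofactor rpredMsign /determinant; apply: rpred_sum => t _.
    by rewrite rpredMsign rpred_prod // => l _; rewrite !mxE sz rpredX.
  have cA i : (`|k|%N)%:R * c i \in Num.int.
    rewrite -Cint_rat; apply: Cint_rat_Aint; first exact: Crat_rat.
    have kc : k%:~R * ratr (c i) \in Aint.
      have : (\adj V *m (V *m (\col_i ratr (c i)))) i 0 \in Aint.
        rewrite Vc mxE; apply: rpred_sum => j _; rewrite rpredM ?adjA // mxE.
        exact: sA.
      rewrite mulmxA mul_adj_mx mul_scalar_mx !mxE Dk => H.
      by rewrite mulrAC rpredM.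
    rewrite rmorphM rmorph_nat /=; case: (k) kc => m; first by rewrite pmulrn.
    by rewrite NegzE rmorphN mulNr rpredN.
  exists (fun i => Num.floor ((`|k|%N)%:R * c i)); rewrite Dc mulr_sumr.
  apply: eq_bigr => i _; rewrite mulrA; congr (_ * _).
  apply: (fmorph_inj iota); rewrite rmorph_int rmorphM rmorph_nat fmorph_rat.
  by rewrite -(rmorph_int (ratr : rat -> algC)) floorK // rmorphM rmorph_nat.
- move=> j; have cE p w : (pQtoC p).[w^*] = ((pQtoC p).[w])^*.
    rewrite -horner_map -map_poly_comp; congr (_.[_]).
    by apply: eq_map_poly => a /=; rewrite fmorph_rat.
  have : (r`_j)^* \in r.
    rewrite rr /root cE conjC_eq0.
    by rewrite -/(root _ _) -rr mem_nth.
  move=> /(nthP 0)[k' Hk' E]; exists (Ordinal Hk') => x.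
  by have [p Dp] := gen_z x; rewrite !(sE _ _ p) //= E cE.
Qed.

                                      

(** * Finite predicates and their enumeration *)

Definition fin (T : eqType) (P : T -> Prop) := exists s : seq T, forall x, P x -> x \in s.

(** A duplicate-free list as a function of the predicate alone, so that equivalent predicates give
    the same list; the default for an infinite predicate is the empty list. *)
Definition enump (T : eqType) (P : T -> Prop) : seq T :=
  match pselect (exists s : seq T, uniq s /\ forall x, x \in s <-> P x) with
  | left H => sval (cid H) | right _ => [::] end.

Section FinTheory.
Variable T : eqType.
Implicit Types P Q : T -> Prop.

Lemma enumpP P : fin P -> uniq (enump P) /\ forall x, x \in enump P <-> P x.
Proof.
move=> [s sP]; rewrite /enump; case: pselect => [H|]; first by case: cid.
case; exists (undup [seq x <- s | `[< P x >]]); rewrite undup_uniq; split=> // x.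
rewrite mem_undup mem_filter; split; first by case/andP=> /asboolP.
by move=> Px; rewrite sP // andbT; apply/asboolP.
Qed.

Lemma enump_uniq P : uniq (enump P).
Proof. by rewrite /enump; case: pselect => [H|//]; case: cid => s []. Qed.

Lemma mem_enump P x : fin P -> (x \in enump P) = `[< P x >].
Proof. by move=> /enumpP[_ /(_ x) H]; apply/idP/asboolP; tauto. Qed.

Lemma enump_prop P x : x \in enump P -> P x.
Proof.
by rewrite /enump; case: pselect => [H|//]; case: cid => s [_ sP] /= /sP.
Qed.

Lemma enump_in P x : fin P -> P x -> x \in enump P.
Proof. by move=> fP Px; rewrite mem_enump //; apply/asboolP. Qed.

Lemma fin_sub P Q : fin Q -> (forall x, P x -> Q x) -> fin P.
Proof. by move=> [s sP] H; exists s => x /H /sP. Qed.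

Lemma big_sub_seq (A : nmodType) (s t : seq T) (f : T -> A) :
  uniq s -> uniq t -> {subset s <= t} -> (forall x, x \in t -> x \notin s -> f x = 0) ->
  \sum_(x <- s) f x = \sum_(x <- t) f x.
Proof.
move=> us ut st f0; rewrite [RHS](bigID (mem s)) /= addrC [X in _ = X + _]big1_seq ?add0r; last first.
  by move=> x /andP[xs xt]; apply: f0.
rewrite -[RHS]big_filter; apply: perm_big; apply: uniq_perm; rewrite ?filter_uniq // => x.
by rewrite mem_filter /=; case xs: (x \in s) => //=; rewrite st.
Qed.

Lemma big_enump_sub (A : nmodType) P Q (f : T -> A) :
  fin Q -> (forall x, P x -> Q x) -> (forall x, Q x -> ~ P x -> f x = 0) ->
  \sum_(x <- enump P) f x = \sum_(x <- enump Q) f x.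
Proof.
move=> fQ PQ f0; have fP := fin_sub fQ PQ.
apply: big_sub_seq; rewrite ?enump_uniq // => x; rewrite !mem_enump //.
  by move=> /asboolP /PQ /asboolP.
by move=> /asboolP Qx /asboolPn nP; apply: f0.
Qed.

Lemma eq_enump P Q : (forall x, P x <-> Q x) -> enump P = enump Q.
Proof. by move=> PQ; congr enump; apply/funext => x; apply/propext. Qed.

Lemma size_enump_sub P Q : fin Q -> (forall x, P x -> Q x) ->
  (size (enump P) <= size (enump Q))%N.
Proof.
move=> fQ PQ; apply: uniq_leq_size; rewrite ?enump_uniq // => x.
by move=> /enump_prop /PQ H; apply: enump_in.
Qed.

End FinTheory.

Lemma fin_img (T U : eqType) (P : T -> Prop) (f : T -> U) :
  fin P -> fin (fun y => exists2 x, P x & y = f x).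
Proof. by move=> [s sP]; exists (map f s) => y [x /sP ? ->]; apply: map_f. Qed.

Lemma fin_inj (T U : eqType) (P : T -> Prop) (Q : U -> Prop) (f : T -> U) :
  fin Q -> (forall x, P x -> Q (f x)) ->
  (forall x y, P x -> P y -> f x = f y -> x = y) -> fin P.
Proof.
move=> [s sQ] PQ fI; have [[x0 _]|nP] := pselect (exists x, P x); last first.
  by exists [::] => x Px; case: nP; exists x.
pose g y := if pselect (exists2 x, P x & f x = y) is left H then s2val (cid2 H) else x0.
exists (map g s) => x Px; suff <- : g (f x) = x by apply/map_f/sQ/PQ.
rewrite /g; case: pselect => [H|[]]; last by exists x.
by case: cid2 => x' Px' /= /fI; apply.
Qed.

Lemma size_enump_inj (T U : eqType) (P : T -> Prop) (Q : U -> Prop) (f : T -> U) :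
  fin Q -> (forall x, P x -> Q (f x)) ->
  (forall x y, P x -> P y -> f x = f y -> x = y) ->
  (size (enump P) <= size (enump Q))%N.
Proof.
move=> fQ PQ fI; have fP := fin_inj fQ PQ fI.
rewrite -(size_map f); apply: uniq_leq_size.
  rewrite map_inj_in_uniq ?enump_uniq // => x y /enump_prop Px /enump_prop Py.
  exact: fI.
by move=> _ /mapP[x /enump_prop /PQ ? ->]; apply: enump_in.
Qed.

Lemma size_enump_fibre (T U : eqType) (P : T -> Prop) (s : seq U) (f : T -> U) (k : U -> nat) :
  fin P -> (forall x, P x -> f x \in s) ->
  (forall y, y \in s -> (size (enump (fun x => P x /\ f x = y)) <= k y)%N) ->
  (size (enump P) <= \sum_(y <- s) k y)%N.
Proof.
move=> fP fs fk.
have -> : size (enump P) = count predT (enump P) by rewrite count_predT.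
apply: (@leq_trans (\sum_(y <- s) count (fun x => f x == y) (enump P))%N); last first.
  rewrite !big_seq; apply: leq_sum => y ys; apply: leq_trans (fk y ys).
  rewrite -size_filter; apply: uniq_leq_size; rewrite ?filter_uniq ?enump_uniq // => x.
  rewrite mem_filter => /andP[/eqP fx /enump_prop Px]; apply: enump_in => //.
  by apply: (fin_sub fP) => ? [].
have {fs} : all (fun x => f x \in s) (enump P) by apply/allP => x /enump_prop /fs.
elim: (enump P) => [|x e IH] /=; first by rewrite big1.
case/andP=> xs /IH {}IH; rewrite big_split /= leq_add //.
rewrite (big_rem _ xs) /= eqxx; exact: leq_addr.
Qed.

                           

(** * Indices of subgroups and of lattices *)

Definition subgrp (T : zmodType) (A : set T) := A 0 /\ forall x y, A x -> A y -> A (x - y).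

(** The same shape as [ideal_norm_is], so that norms of ideals are indices of this kind. *)
Definition has_index (T : zmodType) (A B : set T) (k : nat) :=
  exists r : 'I_k -> T, (forall i, A (r i)) /\ forall x, A x -> exists! i, B (x - r i).

Section Index.
Variable T : zmodType.
Implicit Types A B C : set T.

Lemma subgrpN A x : subgrp A -> A x -> A (- x).
Proof. by case=> A0 AB Ax; rewrite -sub0r; apply: AB. Qed.

Lemma subgrpD A x y : subgrp A -> A x -> A y -> A (x + y).
Proof. by move=> sA Ax Ay; rewrite -[y]opprK; apply: sA.2 => //; apply: subgrpN. Qed.

Lemma subgrpC A x y : subgrp A -> A (x - y) -> A (y - x).
Proof. by move=> sA H; rewrite -opprB; apply: subgrpN. Qed.

Lemma subgrp_sum A (I : Type) (s : seq I) (P : pred I) (f : I -> T) : subgrp A ->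
  (forall i, P i -> A (f i)) -> A (\sum_(i <- s | P i) f i).
Proof. by move=> sA H; apply: big_ind => //; [exact: sA.1|move=> *; apply: subgrpD]. Qed.

Lemma subgrpMn A x k : subgrp A -> A x -> A (x *+ k).
Proof.
move=> sA Ax; elim: k => [|k IH]; first by rewrite mulr0n; case: sA.
by rewrite mulrS; apply: subgrpD.
Qed.

Lemma has_index_fin (J : finType) A B (r : J -> T) :
  (forall i, A (r i)) -> (forall x, A x -> exists! i, B (x - r i)) -> has_index A B #|J|.
Proof.
move=> Ar H; exists (fun i => r (enum_val i)); split=> [//|x Ax].
have [i [Bi Ui]] := H x Ax; exists (enum_rank i); split=> [|j Bj]; first by rewrite enum_rankK.
by rewrite (Ui _ Bj) enum_valK.
Qed.

(** A covering list is thinned greedily: an element is kept only when it is incongruent to those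
    already kept. *)
Lemma has_index_cover A B (s : seq T) : subgrp B ->
  (forall y, y \in s -> A y) -> (forall x, A x -> exists2 y, y \in s & B (x - y)) ->
  exists k, has_index A B k.
Proof.
move=> sB sA cov.
suff [t [tA tc tB]] : exists t : seq T, [/\ forall y, y \in t -> A y,
    forall x, A x -> exists2 y, y \in t & B (x - y) &
    forall i j, (i < size t)%N -> (j < size t)%N -> B (t`_i - t`_j) -> i = j].
  exists (size t), (fun i => t`_i); split=> [i|x Ax]; first by apply/tA/mem_nth.
  have [_ /(nthP 0)[i it <-] Bi] := tc x Ax; exists (Ordinal it); split=> // j Bj.
  apply/val_inj/tB => //=; rewrite (_ : _ - _ = (x - t`_j) - (x - t`_i)); first exact: sB.2.
  by rewrite opprB [RHS]addrC addrA subrK.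
have {cov} : forall x, A x -> exists2 y, y \in s & B (x - y) by [].
suff [t [ts tc tB]] : exists t : seq T, [/\ {subset t <= s},
    forall y, y \in s -> exists2 z, z \in t & B (y - z) &
    forall i j, (i < size t)%N -> (j < size t)%N -> B (t`_i - t`_j) -> i = j].
  move=> cov; exists t; split=> // [y /ts /sA //|x /cov[y /tc[z zt yz] xy]].
  by exists z => //; rewrite -(subrK y x) -addrA; apply: subgrpD.
elim: s {sA} => [|x s [t [ts tc tB]]]; first by exists [::].
have [[z zt xz]|nz] := pselect (exists2 z, z \in t & B (x - z)).
  exists t; split=> // [y /ts|y]; first by rewrite inE orbC => ->.
  by rewrite inE => /orP[/eqP->|/tc //]; exists z.
exists (x :: t); split=> [y|y|].
- by rewrite !inE => /orP[->//|/ts->]; rewrite orbT.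
- rewrite inE => /orP[/eqP->|/tc[z zt yz]]; last by exists z; rewrite // inE zt orbT.
  by exists x; rewrite ?mem_head // subrr; case: sB.
- move=> [|i] [|j] //= it jt H.
  + by case: nz; exists t`_j => //; apply: mem_nth.
  + by case: nz; exists t`_i; [apply: mem_nth|apply: subgrpC].
  + by rewrite (tB i j).
Qed.

Lemma has_index_map A B (J : finType) (f : T -> J) : subgrp B ->
  (forall x y, A x -> A y -> f x = f y -> B (x - y)) -> exists k, has_index A B k.
Proof.
move=> sB H; pose g j := if pselect (exists2 x, A x & f x = j) is left E then [:: s2val (cid2 E)] else [::].
apply: (@has_index_cover A B (flatten (map g (enum J)))) => // [y /flatten_mapP[j _]|x Ax].
  by rewrite /g; case: pselect => // E; case: cid2 => x Ax _ /=; rewrite inE => /eqP->.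
have [y yg fy] : exists2 y, y \in g (f x) & A y /\ f y = f x.
  rewrite /g; case: pselect => [E|[]]; last by exists x.
  by case: cid2 => y Ay fy; exists y; rewrite ?inE.
by exists y; [apply/flatten_mapP; exists (f x); rewrite ?mem_enum|apply: H; case: fy].
Qed.

Lemma has_index_gt0 A B k : A 0 -> has_index A B k -> (0 < k)%N.
Proof. by move=> A0 [r [_ /(_ 0 A0)[[i ik] _]]]; apply: leq_ltn_trans ik. Qed.

Lemma has_index_le A B k l : subgrp B -> has_index A B k -> has_index A B l -> (k <= l)%N.
Proof.
move=> sB [r [rA rP]] [r' [rA' rP']].
have g i := cid (rP' (r i) (rA i)).
rewrite -(card_ord k) -(card_ord l); apply: (@leq_card _ _ (fun i => sval (g i))) => i j.
case: (g i) (g j) => a [Ba _] [b [Bb _]] /= ab; subst b.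
have [c [_ Uc]] := rP (r i) (rA i); rewrite -(Uc i) ?subrr; last by case: sB.
apply: Uc; rewrite (_ : r i - r j = (r i - r' a) - (r j - r' a)); first exact: sB.2.
by rewrite opprB addrA subrK.
Qed.

Lemma has_index_uniq A B k l : subgrp B -> has_index A B k -> has_index A B l -> k = l.
Proof.
by move=> sB H1 H2; apply/eqP; rewrite eqn_leq !(@has_index_le A B).
Qed.

Lemma has_index_mul A B C k l : subgrp A -> subgrp B -> subgrp C ->
  (forall x, B x -> A x) -> (forall x, C x -> B x) ->
  has_index A B k -> has_index B C l -> has_index A C (k * l)%N.
Proof.
move=> sA sB sC BA CB [r [rA rP]] [s [sB' sP]].
rewrite -[(k * l)%N]/(k * l)%N -(card_ord k) -(card_ord l) -card_prod.
apply: (@has_index_fin _ A C (fun p : 'I_k * 'I_l => r p.1 + s p.2)) => [p|x Ax].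
  by apply: subgrpD => //; apply: BA.
have [i [Bi Ui]] := rP x Ax; have [j [Cj Uj]] := sP _ Bi.
exists (i, j) => /=; split; first by rewrite opprD addrA.
move=> [i' j'] /=; rewrite opprD addrA => H.
have ii : i = i'.
  by apply: Ui; rewrite -(subrK (s j') (x - r i')); apply: subgrpD => //; apply: CB.
by subst i'; rewrite (Uj j').
Qed.

(** Both intermediate indices are finite: representatives of $A/C$ cover $A/B$, and an element of
    $B$ is determined modulo $C$ by its class in $A/C$. *)
Lemma has_index_mid A B C k : subgrp A -> subgrp B -> subgrp C ->
  (forall x, B x -> A x) -> (forall x, C x -> B x) -> has_index A C k ->
  exists l m, [/\ has_index A B l, has_index B C m & k = (l * m)%N].
Proof.
move=> sA sB sC BA CB iAC; have [r [rA rP]] := iAC.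
have [l il] : exists l, has_index A B l.
  apply: (@has_index_cover A B (codom r)) => // [y /codomP[i ->] //|x /rP[i [Ci _]]].
  by exists (r i); [exact: codom_f|exact: CB].
have [m im] : exists m, has_index B C m.
  pose f x := if pselect (exists i, C (x - r i)) is left H then Some (sval (cid H)) else None.
  have fP x : A x -> exists2 i, f x = Some i & C (x - r i).
    move=> Ax; rewrite /f; case: pselect => [H|[]]; first by case: cid => i Ci; exists i.
    by have [i [Ci _]] := rP x Ax; exists i.
  apply: (@has_index_map B C _ f) => // x y /BA /fP[i -> Ci] /BA /fP[j -> Cj] [ij]; subst j.
  by rewrite (_ : x - y = (x - r i) - (y - r i)); [exact: sC.2|rewrite opprB addrA subrK].
exists l, m; split=> //; apply: has_index_uniq iAC _ => //; exact: has_index_mul il im.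
Qed.

(** Translation by [x] permutes the cosets by some [p]. Summing $r_i+x-r_{p(i)}\in B$ over all
    cosets, the representatives cancel and $kx$ remains. *)
Lemma has_index_kill A B k x : subgrp A -> subgrp B -> has_index A B k -> A x -> B (x *+ k).
Proof.
move=> sA sB [r [rA rP]] Ax.
have g i := cid (rP _ (subgrpD sA (rA i) Ax)).
pose p i := sval (g i).
have pP i : B (r i + x - r (p i)) by rewrite /p; case: (g i) => j [].
have pI : injective p.
  move=> i j pij; have [c [_ Uc]] := rP (r i) (rA i).
  rewrite -(Uc i) ?subrr; last by case: sB.
  apply: Uc; rewrite (_ : r i - r j = (r i + x - r (p i)) - (r j + x - r (p j))); first exact: sB.2.
  by rewrite pij opprB addrA subrK opprD addrACA subrr addr0.
have : B (\sum_i (r i + x - r (p i))) by apply: subgrp_sum.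
have E : \sum_i r (p i) = \sum_i r i by rewrite [RHS](reindex_inj pI).
rewrite sumrB big_split /= E addrAC subrr add0r.
by rewrite sumr_const card_ord.
Qed.

Lemma has_index1 A B : subgrp B -> (forall x, B x -> A x) -> has_index A B 1 ->
  forall x, A x -> B x.
Proof.
move=> sB BA [r [rA rP]] x Ax.
have [i [Bi _]] := rP x Ax; have [j [Bj _]] := rP 0 (BA _ sB.1).
by rewrite -[x]subr0 (_ : x - 0 = (x - r i) - (0 - r j)); [exact: sB.2|rewrite (ord1 i) (ord1 j) opprB addrA subrK].
Qed.

End Index.

Lemma has_index_morph (T U : zmodType) (f : {additive T -> U}) (A B : set T) k :
  injective f -> has_index A B k ->
  has_index (fun y => exists2 x, A x & y = f x) (fun y => exists2 x, B x & y = f x) k.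
Proof.
move=> fI [r [rA rP]]; exists (fun i => f (r i)); split=> [i|y [x Ax ->]]; first by exists (r i).
have [i [Bi Ui]] := rP x Ax; exists i; split; first by exists (x - r i); rewrite ?raddfB.
by move=> j [b Bb]; rewrite -raddfB => /fI E; apply: Ui; rewrite E.
Qed.

Definition row_lattice n (M : 'M[int]_n) : set 'rV[int]_n := fun v => exists c, v = c *m M.

(** Divisibility is imposed on one coordinate at a time, each step multiplying the index by one
    $|d_i|$. *)
Lemma diag_lattice_index n (d : 'I_n -> int) : (forall i, d i != 0) ->
  has_index (fun _ : 'rV[int]_n => True) (fun v => forall i, (d i %| v ord0 i)%Z) (\prod_i `|d i|)%N.
Proof.
move=> d0; pose L k : set 'rV[int]_n := fun v => forall i : 'I_n, (i < k)%N -> (d i %| v ord0 i)%Z.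
have sL k : subgrp (L k).
  split=> [i _|u v Lu Lv i ik]; first by rewrite mxE dvdz0.
  by rewrite !mxE rpredB ?Lu ?Lv.
have LS k v : L k.+1 v -> L k v by move=> Lv i ik; apply: Lv; apply: ltnW.
have main k : (k <= n)%N -> has_index (fun _ : 'rV[int]_n => True) (L k) (\prod_(i < n | (i < k)%N) `|d i|)%N.
  elim: k => [_|k IH kn].
    rewrite big_pred0 //; exists (fun=> 0); split=> // x _; exists ord0.
    by split=> // i _; rewrite (ord1 i).
  pose j := Ordinal kn.
  rewrite (bigD1 j) //= mulnC; apply: (@has_index_mul _ _ (L k)) => //.
  - exact: LS.
  - rewrite (eq_bigl (fun i : 'I_n => (i < k)%N)); first exact: IH (ltnW kn).
    by move=> i; rewrite -val_eqE /= ltnS (leq_eqVlt i k); case: ltngtP.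
  - exists (fun t : 'I__ => \row_i (if i == j then (t : nat)%:Z else 0)); split=> [t i ik|x Lx].
      by rewrite mxE -val_eqE /= ltn_eqF.
    have tP : (`|(x ord0 j %% d j)%Z| < `|d j|)%N.
      by rewrite -ltz_nat !abszE ger0_norm ?modz_ge0 ?ltz_mod.
    exists (Ordinal tP); split.
      move=> i; rewrite ltnS leq_eqVlt => /orP[ik|ik]; last first.
        by rewrite !mxE -val_eqE /= ltn_eqF // subr0 Lx.
      have -> : i = j by apply/val_inj/eqP.
      rewrite !mxE eqxx /= abszE ger0_norm ?modz_ge0 // -eqz_mod_dvd.
      by rewrite modz_mod.
    move=> t' /(_ j (ltnSn k)); rewrite !mxE eqxx -eqz_mod_dvd => /eqP E.
    apply/val_inj => /=; rewrite E -modz_abs modz_small ?absz_nat //.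
    by rewrite ltz_nat ltn_ord.
have E : (\prod_(i < n | (i < n)%N) `|d i| = \prod_i `|d i|)%N.
  by apply: eq_bigl => i; rewrite ltn_ord.
have := main n (leqnn n); rewrite E.
move=> [r [rA rP]]; exists r; split=> // x _.
have [i [Li Ui]] := rP x I; exists i; split=> [t|i' H]; first exact: Li.
by apply: Ui => t _.
Qed.

(** In the Smith form $M=LDR$ the unimodular $L$ only changes coordinates, and right multiplication
    by $R$ carries the diagonal lattice onto the row lattice. *)
Lemma row_lattice_index n (M : 'M[int]_n) : \det M != 0 ->
  has_index (fun _ => True) (row_lattice M) `|\det M|.
Proof.
move=> M0; have [L uL [R uR [d _ DM]]] := int_Smith_normal_form M.
pose D : 'M[int]_n := diag_mx (\row_i d`_i).
have DD : \matrix_(i, j) (d`_i *+ (i == j :> nat)) = D by apply/matrixP=> i j; rewrite !mxE val_eqE.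
rewrite DD in DM.
have uD U : U \in unitmx -> `|\det U|%N = 1%N by rewrite unitmxE unfold_in /= => /orP[]/eqP->.
have dM : `|\det M|%N = (\prod_(i < n) `|nth 0%R d i|)%N.
  rewrite DM !det_mulmx !abszM (uD _ L uL) (uD _ R uR) mul1n muln1 det_diag.
  rewrite (big_morph absz abszM absz1).
  by apply: eq_bigr => i _; rewrite mxE.
have d0 (i : 'I_n) : d`_i != 0.
  apply: contraNneq M0 => di; rewrite -absz_eq0 dM (bigD1 i) //= di.
  by rewrite absz0 mul0n.
rewrite dM; have [r [_ rP]] := @diag_lattice_index n (fun i => d`_i) d0.
exists (fun i => r i *m R); split=> // x _.
have key (v : 'rV[int]_n) : (forall i, (d`_(i : 'I_n) %| v ord0 i)%Z) <-> row_lattice M (v *m R).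
  split=> [H|[c]].
    have [c Dc] : exists c, v = c *m D.
      exists (\row_i (v ord0 i %/ d`_i)%Z); apply/rowP=> i.
      by rewrite mul_mx_diag !mxE divzK.
    by exists (c *m invmx L); rewrite DM !mulmxA mulmxKV // Dc.
  rewrite DM !mulmxA => /(can_inj (mulmxK uR)) -> i.
  by rewrite mul_mx_diag !mxE dvdz_mull.
have [i [Bi Ui]] := rP (x *m invmx R) I; exists i; split.
  by move: Bi; rewrite key mulmxBl mulmxKV.
by move=> j Bj; apply: Ui; rewrite key mulmxBl mulmxKV.
Qed.

Definition smul (F : fieldType) (x : F) (A : set F) : set F := fun y => exists2 a, A a & y = x * a.

Section Smul.
Variable F : fieldType.
Implicit Types (A B : set F) (x y : F).

Lemma smul_subgrp x A : subgrp A -> subgrp (smul x A).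
Proof.
case=> A0 AB; split; first by exists 0; rewrite ?mulr0.
by move=> _ _ [a Aa ->] [b Ab ->]; exists (a - b); rewrite ?mulrBr //; apply: AB.
Qed.

Lemma smulP x A y : x != 0 -> smul x A (x * y) <-> A y.
Proof. by move=> x0; split=> [[a Aa /(mulfI x0) ->]//|Ay]; exists y. Qed.

Lemma smul_mul x y A : smul x (smul y A) = smul (x * y) A.
Proof.
apply/funext => z; apply/propext; split.
  by move=> [_ [a Aa ->] ->]; exists a; rewrite ?mulrA.
by move=> [a Aa ->]; exists (y * a); rewrite ?mulrA //; exists a.
Qed.

Lemma smul1 A : smul 1 A = A.
Proof.
apply/funext => z; apply/propext; split; first by move=> [a Aa ->]; rewrite mul1r.
by move=> Az; exists z; rewrite ?mul1r.
Qed.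

Lemma smul_index x A B k : x != 0 -> has_index A B k -> has_index (smul x A) (smul x B) k.
Proof.
move=> x0 [r [rA rP]]; exists (fun i => x * r i); split=> [i|_ [a Aa ->]]; first by exists (r i).
have [i [Bi Ui]] := rP a Aa; exists i; split=> [|j]; rewrite -mulrBr smulP //.
exact: Ui.
Qed.

End Smul.

Lemma nat_root (Z : algR) n : (0 < n)%N -> 0 <= Z ->
  exists m : nat, m%:R ^+ n <= Z < (m.+1)%:R ^+ n.
Proof.
move=> n0 Z0.
have ex : exists m : nat, Z < (m.+1)%:R ^+ n.
  exists (Num.bound Z); apply: (lt_le_trans (archi_boundP Z0)).
  rewrite -natrX ler_nat; apply: leq_trans (leqnSn _) _.
  by rewrite -{1}(expn1 (_.+1)) leq_pexp2l.
exists (ex_minn ex); case: ex_minnP => [[|m] Hm min]; rewrite Hm andbT.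
  by rewrite expr0n; case: n n0 {ex Hm min}.
by rewrite leNgt; apply/negP => /min; rewrite ltnn.
Qed.

                                          

(** * Archimedean size of field elements and the count of short integers *)

Section Lattice.
Variables (F : fieldType) (iota : {rmorphism F -> algC}) (n : nat).
Variables (s : 'I_n -> {rmorphism F -> algC}) (e : 'I_n -> F) (d : nat).
Hypothesis emb : field_embeddings iota s e d.
Local Notation O := (integers iota).
Local Notation R := algR.

Lemma O_subgrp : subgrp O.
Proof.
rewrite /integers; split=> [|x y Ox Oy]; first by rewrite rmorph0 rpred0.
by rewrite rmorphB rpredB.
Qed.

Lemma O1 : O 1. Proof. by rewrite /integers rmorph1 rpred1. Qed.
Lemma O0 : O 0. Proof. by rewrite /integers rmorph0 rpred0. Qed.
Lemma OM x y : O x -> O y -> O (x * y).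
Proof. by rewrite /integers rmorphM => Ox Oy; rewrite rpredM. Qed.
Lemma OD x y : O x -> O y -> O (x + y).
Proof. by rewrite /integers rmorphD => Ox Oy; rewrite rpredD. Qed.
Lemma ON x : O x -> O (- x).
Proof. by rewrite /integers rmorphN => Ox; rewrite rpredN. Qed.
Lemma OB x y : O x -> O y -> O (x - y).
Proof. by move=> Ox Oy; apply: OD => //; apply: ON. Qed.
Lemma O_int (k : int) : O k%:~R.
Proof. by rewrite /integers rmorph_int Aint_int. Qed.
Lemma O_nat (k : nat) : O k%:R.
Proof. by rewrite pmulrn; apply: O_int. Qed.

Lemma intF_eq0 (k : int) : (k%:~R == 0 :> F) = (k == 0).
Proof. by rewrite -(fmorph_eq0 iota) rmorph_int intr_eq0. Qed.
Lemma natF_eq0 (k : nat) : (k%:R == 0 :> F) = (k == 0%N).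
Proof. by rewrite pmulrn intF_eq0. Qed.

(** The values are taken in the ordered field [algR], where linear arithmetic applies; [nrm] is the
    sum of the absolute values, [Nm] their product, that is, the absolute norm. *)
Definition absv j x : R := in_algR (normr_real (s j x)).
Definition nrm x : R := \sum_j absv j x.
Definition Nm x : R := \prod_j absv j x.

Lemma NmE x : Nm x = \prod_j absv j x.
Proof. by []. Qed.

Lemma absv_ge0 j x : 0 <= absv j x.
Proof. exact: (normr_ge0 (s j x)). Qed.
Lemma absvM j x y : absv j (x * y) = absv j x * absv j y.
Proof. by apply: val_inj; rewrite /= rmorphM normrM. Qed.
Lemma absvD j x y : absv j (x + y) <= absv j x + absv j y.
Proof. by rewrite /absv; have := ler_normD (s j x) (s j y); rewrite -rmorphD. Qed.
Lemma absv_eq0 j x : (absv j x == 0) = (x == 0).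
Proof. by rewrite -val_eqE /= normr_eq0 fmorph_eq0. Qed.
Lemma absv0 j : absv j 0 = 0.
Proof. by apply/eqP; rewrite absv_eq0. Qed.
Lemma absv_gt0 j x : x != 0 -> 0 < absv j x.
Proof. by rewrite lt0r absv_eq0 absv_ge0 => ->. Qed.
Lemma absvN j x : absv j (- x) = absv j x.
Proof. by apply: val_inj; rewrite /= rmorphN normrN. Qed.
Lemma absv1 j : absv j 1 = 1.
Proof. by apply: val_inj; rewrite /= rmorph1 normr1. Qed.
Lemma absv_nat j (k : nat) : absv j k%:R = k%:R.
Proof. by apply: val_inj; rewrite /= !rmorph_nat normr_nat. Qed.
Lemma absv_int j (k : int) : absv j k%:~R = `|k|%:~R.
Proof. by apply: val_inj; rewrite /= !rmorph_int intr_norm. Qed.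
Lemma absv_sum j (I : Type) (t : seq I) (P : pred I) (f : I -> F) :
  absv j (\sum_(i <- t | P i) f i) <= \sum_(i <- t | P i) absv j (f i).
Proof.
elim/big_ind2: _ => [|x x' y y' H H'|//]; first by rewrite absv0.
exact: le_trans (absvD _ _ _) (lerD H H').
Qed.

Lemma absv_le_nrm j x : absv j x <= nrm x.
Proof. by rewrite /nrm (bigD1 j) //= lerDl sumr_ge0 // => i _; apply: absv_ge0. Qed.
Lemma nrm_ge0 x : 0 <= nrm x.
Proof. by apply: sumr_ge0 => j _; apply: absv_ge0. Qed.
Lemma nrm_gt0 x : x != 0 -> 0 < nrm x.
Proof.
move=> x0; have n0 := emb_dim_gt0 emb.
exact: lt_le_trans (absv_gt0 (Ordinal n0) x0) (absv_le_nrm _ _).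
Qed.
Lemma nrmD x y : nrm (x + y) <= nrm x + nrm y.
Proof. by rewrite -big_split; apply: ler_sum => j _; apply: absvD. Qed.
Lemma nrmN x : nrm (- x) = nrm x.
Proof. by apply: eq_bigr => j _; rewrite absvN. Qed.
Lemma nrmM x y : nrm (x * y) <= nrm x * nrm y.
Proof.
rewrite /nrm mulr_suml; apply: ler_sum => j _; rewrite absvM.
by rewrite ler_wpM2l ?absv_ge0 // absv_le_nrm.
Qed.
Lemma nrm_int k x : nrm (k%:~R * x) = `|k|%:~R * nrm x.
Proof. by rewrite /nrm mulr_sumr; apply: eq_bigr => j _; rewrite absvM absv_int. Qed.
Lemma nrm_nat (k : nat) x : nrm (k%:R * x) = k%:R * nrm x.
Proof. by rewrite /nrm mulr_sumr; apply: eq_bigr => j _; rewrite absvM absv_nat. Qed.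
Lemma nrm_sum (I : Type) (t : seq I) (P : pred I) (f : I -> F) :
  nrm (\sum_(i <- t | P i) f i) <= \sum_(i <- t | P i) nrm (f i).
Proof. by rewrite /nrm [X in _ <= X]exchange_big; apply: ler_sum => j _; apply: absv_sum. Qed.

Lemma NmM x y : Nm (x * y) = Nm x * Nm y.
Proof. by rewrite /Nm -big_split; apply: eq_bigr => j _; apply: absvM. Qed.
Lemma Nm1 : Nm 1 = 1.
Proof. by rewrite /Nm big1 // => j _; rewrite absv1. Qed.
Lemma Nm_gt0 x : x != 0 -> 0 < Nm x.
Proof. by move=> x0; apply: prodr_gt0 => j _; apply: absv_gt0. Qed.
Lemma Nm_ge0 x : 0 <= Nm x.
Proof. by apply: prodr_ge0 => j _; apply: absv_ge0. Qed.
Lemma Nm_nat (k : nat) : Nm k%:R = k%:R ^+ n.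
Proof.
rewrite /Nm (eq_bigr (fun=> k%:R)); first by rewrite prodr_const card_ord.
by move=> j _; rewrite absv_nat.
Qed.
Lemma Nm_le_nrm x : Nm x <= nrm x ^+ n.
Proof.
rewrite /Nm -[X in _ ^+ X]card_ord -prodr_const.
by apply: ler_prod => j _; rewrite absv_ge0 absv_le_nrm.
Qed.
Lemma Nm_le_absv j x : Nm x <= absv j x * nrm x ^+ n.-1.
Proof.
rewrite /Nm (bigD1 j) //= ler_wpM2l ?absv_ge0 //.
have -> : n.-1 = #|[pred i | i != j]|.
  have := cardC1 j; rewrite card_ord => <-; apply: eq_card => i; by rewrite !inE.
rewrite -prodr_const; apply: ler_prod => i _.
by rewrite absv_ge0 absv_le_nrm.
Qed.

Definition base_lattice : set F := fun x => exists c : 'I_n -> int, x = \sum_i (c i)%:~R * e i.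
Local Notation A0 := base_lattice.

Lemma A0_subgrp : subgrp A0.
Proof.
split; first by exists (fun=> 0); rewrite big1 // => i _; rewrite mul0r.
move=> _ _ [c ->] [c' ->]; exists (fun i => c i - c' i); rewrite -sumrB.
by apply: eq_bigr => i _; rewrite rmorphB mulrBl.
Qed.

Lemma A0_O x : A0 x -> O x.
Proof.
move=> [c ->]; apply: subgrp_sum => [|i _]; first exact: O_subgrp.
by apply: OM; [exact: O_int|exact: (emb_basis_int emb)].
Qed.

Lemma O_A0 x : O x -> A0 (d%:R * x).
Proof. by move=> /(emb_index emb). Qed.

Let S : 'M[algC]_n := \matrix_(j, i) s j (e i).

(** The coordinates are recovered from the conjugates by the inverse of the embedding matrix, whose
    entries give [C]. *)
Lemma coord_bound : exists2 C : nat, (0 < C)%N &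
  forall (c : 'I_n -> int) x, x = \sum_i (c i)%:~R * e i ->
  forall i, `|c i|%:~R <= C%:R * nrm x.
Proof.
pose C : R := \sum_i \sum_j in_algR (normr_real (invmx S i j)).
exists (Num.bound C).+1 => // c x Dx i.
have uS : S \in unitmx by rewrite unitmxE unitfE (emb_det emb).
have C0 : 0 <= C by apply: sumr_ge0 => k _; apply: sumr_ge0 => j _; apply: (normr_ge0 (invmx S k j)).
have /colP /(_ i) : \col_i (c i)%:~R = invmx S *m \col_j s j x.
  apply: (canRL (mulKmx uS)); apply/colP => j; rewrite !mxE Dx rmorph_sum.
  by apply: eq_bigr => k _; rewrite !mxE rmorphM rmorph_int mulrC.
rewrite !mxE => E.
apply: (@le_trans _ _ (C * nrm x)); last first.
  rewrite ler_wpM2r ?nrm_ge0 // ltW // (lt_le_trans (archi_boundP C0)) //.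
  by rewrite ler_nat.
apply: (@le_trans _ _ (\sum_j in_algR (normr_real (invmx S i j)) * nrm x)); last first.
  rewrite -mulr_suml ler_wpM2r ?nrm_ge0 // /C [X in _ <= X](bigD1 i) //= lerDl.
  by apply: sumr_ge0 => k _; apply: sumr_ge0 => j _; apply: (normr_ge0 (invmx S k j)).
apply: (@le_trans _ _ (\sum_j in_algR (normr_real (invmx S i j)) * absv j x)); last first.
  apply: ler_sum => j _; rewrite ler_wpM2l ?absv_le_nrm //.
  exact: (normr_ge0 (invmx S i j)).
rewrite -[_ <= _]/(algRval _ <= algRval _) rmorph_int rmorph_sum /= intr_norm E.
apply: le_trans (ler_norm_sum _ _ _) _; apply: ler_sum => j _.
by rewrite normrM !mxE.
Qed.

Lemma coord_inj (c c' : 'I_n -> int) :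
  \sum_i (c i)%:~R * e i = \sum_i (c' i)%:~R * e i -> c = c'.
Proof.
move=> E; have [C C0 HC] := coord_bound.
have : \sum_i (c i - c' i)%:~R * e i = 0.
  by under eq_bigr do rewrite rmorphB mulrBl; rewrite sumrB E subrr.
move=> /esym /HC H; apply/funext => i; apply/eqP; rewrite -subr_eq0 -normr_eq0.
have := H i; rewrite /nrm big1 ?mulr0; last by move=> j _; rewrite absv0.
by rewrite lerz0 normr_le0 normr_eq0.
Qed.

(** For a short integer $x$ the coordinates of $dx$ are integers in a box $[-m,m]^n$ with $m^n$ at
    most a constant times $Y$, and $(2m+1)^n\le(3m)^n$. *)
Lemma short_vectors : exists C : nat, forall Y : R, 1 <= Y ->
  fin (fun x => O x /\ nrm x ^+ n <= Y) /\
  (size (enump (fun x => O x /\ nrm x ^+ n <= Y)))%:R <= C%:R * Y.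
Proof.
have [C C0 HC] := coord_bound; have n0 := emb_dim_gt0 emb.
exists ((3 * (C * d)) ^ n)%N => Y Y1.
pose P x := O x /\ nrm x ^+ n <= Y.
have d0 := emb_index_gt0 emb.
(* [Z] absorbs the factor $Cd$ by which a coordinate of $dx$ may exceed [nrm x]; [m] is the integer
   part of its $n$-th root. *)
pose Z : R := ((C * d)%:R) ^+ n * Y.
have Z1 : 1 <= Z.
  by rewrite -[1]mul1r ler_pM // exprn_ege1 // -[1]/(1%:R) ler_nat muln_gt0 C0.
have [m /andP[mZ Zm]] := nat_root n0 (le_trans ler01 Z1).
have m0 : (0 < m)%N.
  rewrite lt0n; apply: contraTneq Zm => ->; rewrite -leNgt expr1n //.
have cP x : exists c : 'I_n -> int, O x -> d%:R * x = \sum_i (c i)%:~R * e i.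
  have [Ox|nO] := pselect (O x); last by exists (fun=> 0).
  by have [c Dc] := emb_index emb Ox; exists c.
pose co x := sval (cid (cP x)).
have coP x : O x -> d%:R * x = \sum_i (co x i)%:~R * e i by rewrite /co; case: cid.
have cob x i : P x -> (`|co x i| <= m)%N.
  move=> [Ox xY]; have := HC _ _ (coP x Ox) i; rewrite nrm_nat => H.
  rewrite -ltnS ltnNge; apply/negP => /= Hm.
  have : Z < Z; last by rewrite ltxx.
  apply: (lt_le_trans Zm); apply: (@le_trans _ _ ((C%:R * (d%:R * nrm x)) ^+ n)).
    rewrite lerXn2r ?nnegrE ?ler0n //.
      by rewrite !mulr_ge0 ?ler0n ?nrm_ge0.
    apply: le_trans H; rewrite -abszE -pmulrn ler_nat //.
  rewrite mulrA -natrM exprMn ler_wpM2l // exprn_ge0 //.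
pose f x : {ffun 'I_n -> 'I_(2 * m).+1} := [ffun i => inord (absz (co x i + m%:Z))].
pose Q (_ : {ffun 'I_n -> 'I_(2 * m).+1}) := True.
have fQ : fin Q by exists (enum {: {ffun 'I_n -> 'I_(2 * m).+1}}) => g _; rewrite mem_enum.
have fI x y : P x -> P y -> f x = f y -> x = y.
  move=> Px Py /ffunP fxy.
  have dx : d%:R * x = d%:R * y.
    rewrite (coP _ Px.1) (coP _ Py.1); apply: eq_bigr => i _; congr (_%:~R * _).
    have := fxy i; rewrite !ffunE => /(congr1 val) /=.
    have := cob x i Px; have := cob y i Py => h1 h2.
    rewrite !inordK; lia.
  by apply: (mulfI _ dx); rewrite natF_eq0 -lt0n.
split; first by apply: (fin_inj (f := f) fQ).
have le : (size (enump P) <= (2 * m).+1 ^ n)%N.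
  apply: leq_trans (size_enump_inj (f := f) fQ _ fI) _ => //.
  have -> : ((2 * m).+1 ^ n)%N = size (enum {: {ffun 'I_n -> 'I_(2 * m).+1}}).
    by rewrite -cardE card_ffun !card_ord.
  by apply: uniq_leq_size; rewrite ?enump_uniq // => g _; rewrite mem_enum.
apply: (@le_trans _ _ (((3 * m) ^ n)%:R)).
  rewrite ler_nat; apply: leq_trans le _; rewrite leq_exp2r //; lia.
rewrite !expnMn !natrM -!mulrA ler_wpM2l ?ler0n //.
by rewrite !natrX (le_trans mZ) // /Z natrM exprMn mulrA.
Qed.

End Lattice.

              

(** * Units, and the absolute norm as an index *)

Definition is_unit (F : fieldType) (iota : F -> algC) (u : F) :=
  [/\ u != 0, integers iota u & integers iota u^-1].

(** This is the group $V$ whose orbits are counted: multiplying $D$ by the square of a unit changes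
    neither $K(\sqrt D)$ nor [al D]. *)
Definition unit_square (F : fieldType) (iota : F -> algC) (u : F) :=
  exists2 v, is_unit iota v & u = v ^+ 2.

Lemma expr_le_mono (x y : algR) n : (0 < n)%N -> 0 <= x -> 0 <= y -> x ^+ n <= y ^+ n -> x <= y.
Proof. by move=> n0 x0 y0; rewrite ler_pXn2r ?nnegrE. Qed.

Section Units.
Variables (F : fieldType) (iota : {rmorphism F -> algC}) (n : nat).
Variables (s : 'I_n -> {rmorphism F -> algC}) (e : 'I_n -> F) (d : nat).
Hypothesis emb : field_embeddings iota s e d.
Local Notation O := (integers iota).
Local Notation R := algR.
Local Notation A0 := (base_lattice e).
Local Notation Nm := (Nm s).
Local Notation unit := (is_unit iota).
Local Notation V := (unit_square iota).

Lemma O_clear x : exists2 k : nat, (0 < k)%N & O (k%:R * x).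
Proof.
have [k k0 kx] := Aint_scale (iota x); exists `|k|%N; first by rewrite absz_gt0.
rewrite /integers rmorphM rmorph_nat; case: (k) kx => m; first by rewrite pmulrn.
by rewrite NegzE rmorphN mulNr rpredN.
Qed.

Lemma A0_clear x : exists2 k : nat, (0 < k)%N & forall i, A0 (k%:R * x * e i).
Proof.
have [k k0 Ok] := O_clear x; exists (d * k)%N; first by rewrite muln_gt0 k0 (emb_index_gt0 emb).
by move=> i; rewrite natrM -!mulrA; apply: (O_A0 emb); rewrite mulrA; apply: OM => //; apply: emb_basis_int emb _.
Qed.

Lemma smul_A0 y x : (forall i, A0 (y * e i)) -> A0 x -> A0 (y * x).
Proof.
move=> H [c ->]; rewrite mulr_sumr; apply: subgrp_sum => [|i _]; first exact: A0_subgrp.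
have [c' Dc'] := H i; exists (fun j => c i * c' j).
rewrite mulrCA Dc' mulr_sumr; apply: eq_bigr => j _.
by rewrite mulrA rmorphM.
Qed.

(** In the coordinates of [e], multiplication by [y] is an integer matrix; the embedding matrix
    conjugates it to the diagonal matrix of the conjugates of [y], so its determinant is their
    product. *)
Lemma index_A0 y : y != 0 -> (forall i, A0 (y * e i)) ->
  exists2 k, has_index A0 (smul y A0) k & k%:R = Nm y.
Proof.
move=> y0 yA; pose c i := sval (cid (yA i)).
have cP i : y * e i = \sum_j (c i j)%:~R * e j by rewrite /c; case: cid.
pose M : 'M[int]_n := \matrix_(i, j) c i j.
pose S : 'M[algC]_n := \matrix_(j, i) s j (e i).
have S0 : \det S != 0 by exact: emb_det emb.
have dM : (\det M)%:~R = \prod_j s j y.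
  apply: (mulfI S0); rewrite -det_map_mx -[\det (map_mx _ M)]det_tr -det_mulmx.
  have -> : S *m (map_mx intr M)^T = diag_mx (\row_j s j y) *m S.
    apply/matrixP => j i; rewrite mul_diag_mx !mxE -rmorphM cP rmorph_sum.
    by apply: eq_bigr => l _; rewrite !mxE rmorphM rmorph_int mulrC.
  by rewrite det_mulmx det_diag mulrC; congr (_ * _); apply: eq_bigr => j _; rewrite mxE.
have M0 : \det M != 0.
  rewrite -(intr_eq0 algC) dM; apply/prodf_neq0 => j _; by rewrite fmorph_eq0.
exists `|\det M|%N; last first.
  apply: val_inj; rewrite rmorph_nat /= rmorph_prod /=.
  by rewrite -normr_prod -dM -intr_norm -abszE -pmulrn.
pose f (v : 'rV[int]_n) : F := \sum_i (v 0 i)%:~R * e i.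
have fB : zmod_morphism f.
  move=> u v; rewrite /f -sumrB; apply: eq_bigr => i _.
  by rewrite !mxE rmorphB mulrBl.
pose m1 := GRing.isZmodMorphism.Build _ _ f fB.
pose g : {additive 'rV[int]_n -> F} := HB.pack f m1.
have fI : injective g.
  move=> u v /(coord_inj emb) H; apply/rowP => i; by rewrite (congr1 (@^~ i) H).
have := has_index_morph fI (row_lattice_index M0).
suff [-> ->] : ((fun y0 => exists2 x, True & y0 = g x) = A0) /\
  ((fun y0 => exists2 x, row_lattice M x & y0 = g x) = smul y A0) by [].
have AE : (fun y0 => exists2 x, True & y0 = g x) = A0.
  apply/funext => x; apply/propext; split.
    by move=> [v _ ->]; exists (fun i => v 0 i).
  by move=> [a ->]; exists (\row_i a i) => //; apply: eq_bigr => i _; rewrite mxE.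
split=> //; apply/funext => x; apply/propext.
have fM v : f (v *m M) = y * f v.
  rewrite /f mulr_sumr; under [RHS]eq_bigr do rewrite mulrCA cP mulr_sumr.
  rewrite exchange_big; apply: eq_bigr => j _.
  rewrite mxE rmorph_sum mulr_suml; apply: eq_bigr => i _.
  by rewrite mxE rmorphM mulrA.
split.
  move=> [_ [v ->] ->]; exists (f v); last exact: fM.
  by rewrite -AE; exists v.
move=> [a + ->]; rewrite -AE => -[v _ ->]; exists (v *m M); first by exists v.
by rewrite [RHS]fM.
Qed.

Lemma smulO_sub x y : O x -> smul x O y -> O y.
Proof. by move=> Ox [a Oa ->]; apply: OM. Qed.

(** Integers whose [d]-multiples have the same coordinates modulo $dk$ are congruent modulo $kO$,
    and there are finitely many such residues. *)
Lemma index_O_nat k : (0 < k)%N -> exists l, has_index O (smul k%:R O) l.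
Proof.
move=> k0; have d0 := emb_index_gt0 emb.
have cP x : exists c : 'I_n -> int, O x -> d%:R * x = \sum_i (c i)%:~R * e i.
  have [Ox|nO] := pselect (O x); last by exists (fun=> 0).
  by have [c Dc] := emb_index emb Ox; exists c.
pose co x := sval (cid (cP x)).
have coP x : O x -> d%:R * x = \sum_i (co x i)%:~R * e i by rewrite /co; case: cid.
have [m Dm] : exists m, (d * k = m.+1)%N by exists (d * k).-1; rewrite prednK // muln_gt0 d0.
pose f x : {ffun 'I_n -> 'I_m.+1} := [ffun i => inord (absz (co x i %% m.+1)%Z)].
apply: (@has_index_map _ O _ _ f); first exact/smul_subgrp/O_subgrp.
move=> x y Ox Oy /ffunP fxy.
have dv i : (m.+1 %| co x i - co y i)%Z.
  have := fxy i; rewrite !ffunE => /(congr1 val) /=.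
  have b z : (absz (co z i %% m.+1)%Z < m.+1)%N.
    by rewrite -ltz_nat abszE ger0_norm ?modz_ge0 ?ltz_pmod.
  rewrite !inordK // => /(congr1 Posz); rewrite !abszE !ger0_norm ?modz_ge0 // => E.
  by rewrite -eqz_mod_dvd; apply/eqP.
exists (\sum_i ((co x i - co y i) %/ m.+1)%Z%:~R * e i).
  by apply: subgrp_sum => [|i _]; [exact: O_subgrp|apply: OM; [exact: O_int|exact: emb_basis_int emb _]].
have dF : d%:R != 0 :> F by rewrite (natF_eq0 iota) -lt0n.
apply: (mulfI dF); rewrite mulrBr coP // coP // -sumrB mulrA -natrM Dm mulr_sumr.
apply: eq_bigr => i _; rewrite mulrA pmulrn -rmorphM /= -mulrBl -rmorphB /=.
by congr (_%:~R * _); rewrite mulrC divzK.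
Qed.

Lemma smul_sub (x y : F) (A : set F) : (forall a, A a -> A (y * a)) ->
  forall z, smul (x * y) A z -> smul x A z.
Proof. by move=> H z [a Aa ->]; exists (y * a); rewrite ?mulrA //; apply: H. Qed.

Lemma index_O_A0 : exists2 a, has_index O A0 a & (0 < a)%N.
Proof.
have [l il] := index_O_nat (emb_index_gt0 emb).
have [] := @has_index_mid _ O A0 (smul d%:R O) l (O_subgrp _) (A0_subgrp _) (smul_subgrp _ (O_subgrp _)) _ _ il.
- exact: A0_O emb.
- by move=> _ [x Ox ->]; apply: O_A0 emb _ _.
- by move=> a [m [ia _ _]]; exists a => //; apply: has_index_gt0 ia; exact: O0.
Qed.

(** The index $[O:yA_0]$ is computed through $A_0$ and through $yO$; since $[yO:yA_0]=[O:A_0]$, that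
    factor cancels. *)
Lemma index_O_aux y : y != 0 -> O y -> (forall i, A0 (y * e i)) ->
  exists2 k, has_index O (smul y O) k & k%:R = Nm y.
Proof.
move=> y0 Oy yA; have [k ik <-] := index_A0 y0 yA; have [a ia a0] := index_O_A0.
have sA := A0_subgrp e; have sO := O_subgrp iota.
have i1 : has_index O (smul y A0) (a * k).
  apply: has_index_mul ia ik => //; [exact: smul_subgrp|exact: A0_O emb|].
  by move=> _ [b Ab ->]; apply: smul_A0.
have i2 := smul_index y0 ia.
have [] := @has_index_mid _ O (smul y O) (smul y A0) _ sO (smul_subgrp _ sO) (smul_subgrp _ sA) _ _ i1.
- by move=> x; apply: smulO_sub.
- by move=> _ [x /(A0_O emb) Ox ->]; exists x.
move=> l [m [il im /eqP E]]; exists l => //.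
have am : m = a by apply: has_index_uniq im i2; exact: smul_subgrp.
by move: E; rewrite am mulnC eqn_pmul2r // => /eqP->.
Qed.

(** Choose $k$ with $kxA_0\subseteq A_0$. In the chain $O\supseteq kO\supseteq kxO$ the total index
    and the first one are known from [index_O_aux], and the second is $[O:xO]$. *)
Lemma index_O x : x != 0 -> O x -> exists2 k, has_index O (smul x O) k & k%:R = Nm x.
Proof.
move=> x0 Ox; have [k k0 kA] := A0_clear x; have sO := O_subgrp iota.
have kF : k%:R != 0 :> F by rewrite (natF_eq0 iota) -lt0n.
have kR : k%:R ^+ n != 0 :> R by rewrite expf_neq0 // pnatr_eq0 -lt0n.
have [l il Nl] : exists2 l, has_index O (smul (k%:R * x) O) l & l%:R = Nm (k%:R * x).
  by apply: index_O_aux; rewrite ?mulf_neq0 //; apply: OM => //; apply: O_nat.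
have [m im Nk] : exists2 l, has_index O (smul k%:R O) l & l%:R = Nm k%:R.
  apply: index_O_aux => //; first exact: O_nat.
  move=> i; rewrite mulr_natl; apply: subgrpMn; first exact: A0_subgrp.
  exists (fun j => (j == i)%:R); rewrite (bigD1 i) //= eqxx mul1r big1 ?addr0 //.
  by move=> j /negPf ->; rewrite mul0r.
have [] := @has_index_mid _ O (smul k%:R O) (smul (k%:R * x) O) l sO (smul_subgrp _ sO) (smul_subgrp _ sO) _ _ il.
- by move=> y; apply: smulO_sub; apply: O_nat.
- by apply: smul_sub => a Oa; apply: OM.
move=> m' [p [im' ip E]].
have mm : m' = m by apply: has_index_uniq im' im; exact: smul_subgrp.
have ip' : has_index O (smul x O) p.
  have := smul_index (invr_neq0 kF) ip; rewrite !smul_mul mulVf // smul1.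
  by rewrite mulKf.
exists p => //; apply: (mulfI kR); rewrite -(Nm_nat s) -Nk -natrM.
by rewrite -mm -E Nl NmM -Nk mm.
Qed.

Lemma Nm_ge1 x : x != 0 -> O x -> 1 <= Nm x.
Proof.
move=> x0 Ox; have [k ik <-] := index_O x0 Ox.
by rewrite -[1]/(1%:R) ler_nat; apply: has_index_gt0 ik; exact: O0.
Qed.

Lemma index_O_mem x k : O x -> has_index O (smul x O) k -> smul x O k%:R.
Proof.
move=> Ox ik; have := has_index_kill (O_subgrp _) (smul_subgrp x (O_subgrp _)) ik (O1 _).
by [].
Qed.

Lemma unit1 : unit 1.
Proof. by rewrite /is_unit oner_neq0 invr1; split=> //; apply: O1. Qed.
Lemma unitM u v : unit u -> unit v -> unit (u * v).
Proof.
move=> [u0 Ou Ou'] [v0 Ov Ov']; split; rewrite ?mulf_neq0 //; first exact: OM.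
by rewrite invfM; apply: OM.
Qed.
Lemma unitV u : unit u -> unit u^-1.
Proof. by move=> [u0 Ou Ou']; split; rewrite ?invr_eq0 ?invrK. Qed.
Lemma Nm_unit u : unit u -> Nm u = 1.
Proof.
move=> [u0 Ou Ov]; have h1 := Nm_ge1 u0 Ou; have h2 := Nm_ge1 (invr_neq0 u0) Ov.
apply/eqP; rewrite eq_le h1 andbT -[X in _ <= X](Nm1 s) -(divff u0) NmM.
by rewrite ler_peMr ?Nm_ge0.
Qed.
Lemma V_unit u : V u -> unit u.
Proof. by move=> [v uv ->]; apply: unitM. Qed.
Lemma V1 : V 1. Proof. by exists 1; [exact: unit1|rewrite expr1n]. Qed.
Lemma VM u v : V u -> V v -> V (u * v).
Proof. by move=> [a ua ->] [b ub ->]; exists (a * b); rewrite ?exprMn //; apply: unitM. Qed.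
Lemma VV u : V u -> V u^-1.
Proof. by move=> [a ua ->]; exists a^-1; rewrite ?exprVn //; apply: unitV. Qed.

(** If $[O:xO]=k$ then $x$ divides $k$; hence two elements of index $k$ that are congruent modulo
    $k$ divide each other. So one element per residue class modulo $k$ suffices. *)
Lemma fin_norm (C : nat) : exists l : seq F,
  (forall b, b \in l -> b != 0 /\ O b) /\
  forall a, a != 0 -> O a -> Nm a <= C%:R -> exists2 b, b \in l & unit (a / b).
Proof.
have ex (k : nat) : (0 < k)%N -> exists l : seq F,
    (forall b, b \in l -> b != 0 /\ O b) /\
    forall a, a != 0 -> O a -> has_index O (smul a O) k -> exists2 b, b \in l & unit (a / b).
  move=> k0; have [m [r [rO rP]]] := index_O_nat k0.
  pose P i b := [/\ b != 0, O b, has_index O (smul b O) k & smul k%:R O (b - r i)].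
  pose g i := if pselect (exists b, P i b) is left E then [:: sval (cid E)] else [::].
  exists (flatten (map g (enum 'I_m))); split.
    move=> b /flatten_mapP[i _]; rewrite /g; case: pselect => // E.
    by case: cid => c [c0 Oc _ _] /=; rewrite inE => /eqP->.
  move=> a a0 Oa ia; have [i [Bi _]] := rP a Oa.
  have [b bg [b0 Ob ib Bb]] : exists2 b, b \in g i & P i b.
    rewrite /g; case: pselect => [E|[]]; last by exists a.
    by case: cid => b Pb; exists b; rewrite ?inE.
  exists b; first by apply/flatten_mapP; exists i; rewrite ?mem_enum.
  have key x y : x != 0 -> O x -> O y -> has_index O (smul x O) k ->
      smul k%:R O (x - r i) -> smul k%:R O (y - r i) -> O (y / x).
    move=> x0 Ox Oy ix Bx By; have [t Ot Dt] := index_O_mem Ox ix.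
    have [w Ow Dw] : smul k%:R O (y - x).
      rewrite (_ : y - x = (y - r i) - (x - r i)); last by ring.
      by apply: (smul_subgrp _ (O_subgrp _)).2.
    (* Here $k=xt$ and $y-x=kw$. *)
    have -> : y / x = 1 + t * w.
      rewrite -[y](subrK x) Dw Dt; field.
      exact: x0.
    by apply: OD; [exact: O1|exact: OM].
  split; first by rewrite mulf_neq0 ?invr_eq0.
    exact: key.
  by rewrite invf_div; apply: key.
pose L k : seq F := if pselect (0 < k)%N is left H then sval (cid (ex k H)) else [::].
exists (flatten (map L (seq.iota 0 C.+1))); split.
  move=> b /flatten_mapP[k _]; rewrite /L; case: pselect => // H.
  by case: cid => l [lO _] /= /lO.
move=> a a0 Oa Na; have [k ik Nk] := index_O a0 Oa.
have k0 : (0 < k)%N by apply: has_index_gt0 ik; exact: O0.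
have [b bL ub] : exists2 b, b \in L k & unit (a / b).
  rewrite /L; case: pselect => // H; case: cid => l [_ lP] /=; exact: lP.
exists b => //; apply/flatten_mapP; exists k => //.
by rewrite mem_iota /= add0n ltnS -(ler_nat R) Nk.
Qed.

End Units.

(** * Reduction theory: balancing elements by units and by squares of units *)

Section Balance.
Variables (F : fieldType) (iota : {rmorphism F -> algC}) (n : nat).
Variables (s : 'I_n -> {rmorphism F -> algC}) (e : 'I_n -> F) (d : nat).
Hypothesis emb : field_embeddings iota s e d.
Local Notation O := (integers iota).
Local Notation R := algR.
Local Notation A0 := (base_lattice e).
Local Notation nrm := (nrm s).
Local Notation Nm := (Nm s).
Local Notation absv := (absv s).
Local Notation unit := (is_unit iota).
Local Notation V := (unit_square iota).

Let n0 : (0 < n)%N := emb_dim_gt0 emb.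

Lemma natural_bound (x : R) : exists2 k : nat, (0 < k)%N & x <= k%:R.
Proof.
exists (Num.bound `|x|).+1 => //; apply: le_trans (ler_norm x) _; apply: ltW.
by apply: lt_trans (archi_boundP (normr_ge0 x)) _; rewrite ltr_nat.
Qed.

Lemma le_natX (k : nat) : k%:R <= k.+1%:R ^+ n :> R.
Proof.
rewrite -natrX ler_nat (leq_trans (leqnSn k)) // -{1}(expn1 k.+1).
by rewrite leq_pexp2l.
Qed.

                                                                                                  
                                                                                 
(** Minkowski's pigeonhole: the lattice $yA_0$ contains a nonzero $b=ya$ with [nrm b] at most a
    constant times $N(y)^{1/n}$. Then $N(a)$ is bounded, so $a$ is a unit times one of finitely many
    elements, and that unit balances $y$. *)
Lemma balance : exists B : nat, forall x, x != 0 ->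
  exists2 u, unit u & nrm (u * x) ^+ n <= B%:R * Nm x.
Proof.
have [E E0 HE] := natural_bound (\sum_i nrm (e i)).
have [l [lO lP]] := fin_norm emb (E ^ n).
have [D D0 HD] := natural_bound (\sum_(b <- l) nrm b^-1).
exists ((E * D) ^ n)%N => x x0; have [k k0 kA] := A0_clear emb x.
have kF : k%:R != 0 :> F by rewrite (natF_eq0 iota) -lt0n.
pose y := k%:R * x; have y0 : y != 0 by rewrite mulf_neq0.
suff [u uu Hu] : exists2 u, unit u & nrm (u * y) ^+ n <= ((E * D) ^ n)%:R * Nm y.
  exists u => //; move: Hu; rewrite /y mulrCA nrm_nat NmM (Nm_nat s) exprMn mulrCA.
  by rewrite ler_pM2l // exprn_gt0 // ltr0n.
have [v iv Nv] := index_A0 emb y0 kA.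
have [m /andP[mv vm]] := nat_root n0 (ler0n R v).
have [r [rA rP]] := iv.
(* The box has $(m+1)^n>v=[A_0:yA_0]$ points, so two of them are congruent modulo $yA_0$. *)
pose h (g : {ffun 'I_n -> 'I_m.+1}) : F := \sum_i ((g i : nat)%:Z)%:~R * e i.
have hA g : A0 (h g) by exists (fun i => (g i : nat)%:Z).
have cl g := cid (rP _ (hA g)).
have [g [g' [gg' Eg]]] : exists g g', g <> g' /\ sval (cl g) = sval (cl g').
  apply: contrapT => H; suff : (#|{: {ffun 'I_n -> 'I_m.+1}}| <= #|'I_v|)%N.
    rewrite card_ffun !card_ord leqNgt => /negP; apply.
    by rewrite -(ltr_nat R) natrX.
  apply: (@leq_card _ _ (fun g => sval (cl g))) => g g' E'.
  by apply: contrapT => gg'; apply: H; exists g, g'.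
pose b := h g - h g'.
have Db : b = \sum_i ((g i : nat)%:Z - (g' i : nat)%:Z)%:~R * e i.
  by rewrite /b /h -sumrB; apply: eq_bigr => i _; rewrite rmorphB mulrBl.
have [a Aa Da] : smul y A0 b.
  have Bg g1 : smul y A0 (h g1 - r (sval (cl g1))) by case: (cl g1) => i [].
  have := Bg g; rewrite Eg => Bi.
  rewrite (_ : b = (h g - r (sval (cl g'))) - (h g' - r (sval (cl g')))); last by rewrite /b; ring.
  by apply: (smul_subgrp _ (A0_subgrp _)).2.
have b0 : b != 0.
  apply/eqP => b0; apply: gg'; apply/ffunP => i; apply/val_inj/eqP.
  have /(coord_inj emb)/(congr1 (@^~ i)) : \sum_i ((g i : nat)%:Z)%:~R * e i = \sum_i ((g' i : nat)%:Z)%:~R * e i.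
    by apply/eqP; rewrite -subr_eq0; apply/eqP.
  by move=> /= [->].
have a0 : a != 0 by apply: contra_neq b0; rewrite Da => ->; rewrite mulr0.
have nb : nrm b <= m%:R * E%:R.
  rewrite Db; apply: le_trans (nrm_sum _ _ _ _) _.
  apply: le_trans (_ : \sum_i m%:R * nrm (e i) <= _); last first.
    by rewrite -mulr_sumr ler_wpM2l ?ler0n.
  apply: ler_sum => i _; rewrite nrm_int ler_wpM2r ?nrm_ge0 //.
  rewrite -[m%:R]/(m%:Z%:~R) ler_int.
  by have := ltn_ord (g i); have := ltn_ord (g' i); rewrite !ltnS; lia.
have Na : Nm a <= (E ^ n)%:R.
  have Ny := Nm_gt0 s y0; rewrite -(ler_pM2l Ny) -NmM -Da.
  apply: le_trans (Nm_le_nrm s b) _.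
  apply: (@le_trans _ _ ((m%:R * E%:R) ^+ n)).
    by rewrite lerXn2r // ?nnegrE ?nrm_ge0 // mulr_ge0 ?ler0n.
  by rewrite exprMn -Nv natrX ler_wpM2r // exprn_ge0 ?ler0n.
(* The unit is $a/c$: it takes $y$ to $b/c$, and $c$ ranges over a finite list fixed in advance. *)
have [c cl' uc] := lP a a0 (A0_O emb Aa) Na.
have c0 : c != 0 by case: (lO c cl').
exists (a / c) => //.
have -> : a / c * y = b * c^-1 by rewrite Da; ring.
have nc : nrm c^-1 <= D%:R.
  apply: le_trans HD; rewrite (big_rem c) //= lerDl sumr_ge0 // => t _; exact: nrm_ge0.
apply: (@le_trans _ _ ((m%:R * E%:R * D%:R) ^+ n)).
  rewrite lerXn2r // ?nnegrE ?nrm_ge0 // ?mulr_ge0 ?ler0n //.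
  apply: le_trans (nrmM _ _ _) _; apply: ler_pM => //; exact: nrm_ge0.
rewrite -mulrA exprMn mulrC -natrM -natrX -Nv ler_wpM2l ?ler0n //.
Qed.

Lemma fin_bounded (C : R) : fin (fun x => O x /\ nrm x <= C).
Proof.
have [k k0 Ck] := natural_bound C.
have [c Hc] := short_vectors emb.
have k1 : 1 <= k%:R ^+ n :> R by rewrite exprn_ege1 // -[1]/(1%:R) ler_nat.
have [H _] := Hc _ k1; apply: fin_sub H _ => x [Ox xC]; split=> //.
by rewrite lerXn2r // ?nnegrE ?nrm_ge0 ?ler0n // (le_trans xC).
Qed.

                                                                                               
                                                                           
(** The vector of the numbers $\sqrt{|u|_j}$ is a real combination of the vectors of conjugates of
    the $e_i$; a large multiple of it is rounded to an element of the lattice, the rounding error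
    being bounded independently of the multiple. *)
Lemma approx_sqrt u : u != 0 -> exists2 T : R, 0 < T & exists2 x, O x &
  forall j, T * Num.sqrt (absv j u) <= 2 * absv j x /\ absv j x <= 2 * (T * Num.sqrt (absv j u)).
Proof.
move=> u0; pose y j : R := Num.sqrt (absv j u).
have y0 j : 0 < y j by rewrite sqrtr_gt0 absv_gt0.
pose S : 'M[algC]_n := \matrix_(j, i) s j (e i).
have uS : S \in unitmx by rewrite unitmxE unitfE (emb_det emb).
have [c Sc0] : exists c : 'cV_n, S *m c = \col_j algRval (y j).
  by exists (invmx S *m \col_j algRval (y j)); rewrite mulKVmx.
have Sc j : \sum_i s j (e i) * c i 0 = algRval (y j).
  have /colP /(_ j) := Sc0; rewrite !mxE => <-.
  by apply: eq_bigr => i _; rewrite mxE.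
(* The target vector is unchanged when conjugation permutes the embeddings, so its coordinates,
   being unique, are real. *)
have cR i : c i 0 \is Num.real.
  suff /colP /(_ i) E : \col_i (c i 0)^* = c by rewrite CrealE -[X in _ == X]E mxE.
  apply: (can_inj (mulKmx uS)); apply/colP => j; rewrite !mxE.
  have [k Hk] := emb_conj emb j.
  have yk : y k = y j by rewrite /y; congr Num.sqrt; apply: val_inj; rewrite /= Hk norm_conjC.
  transitivity (\sum_i s j (e i) * c i 0); last by apply: eq_bigr => l _; rewrite mxE.
  rewrite Sc -yk -[RHS](@CrealP _ _ (algRvalP _)) -Sc rmorph_sum.
  by apply: eq_bigr => l _; rewrite !mxE rmorphM /= Hk conjCK.
pose t i := in_algR (cR i).
have [E E0 HE] := natural_bound (\sum_i nrm (e i)).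
(* [T] is so large that the rounding error [E] is at most half of the target at each place. *)
pose T : R := \sum_j (2 * E%:R / y j).
have Tj j : 2 * E%:R <= T * y j.
  rewrite -ler_pdivrMr //; rewrite /T (bigD1 j) //= lerDl sumr_ge0 // => i _.
  by rewrite divr_ge0 ?mulr_ge0 ?ler0n // ltW.
have E1 : 0 < E%:R :> R by rewrite ltr0n.
exists T.
  have := Tj (Ordinal n0); have := y0 (Ordinal n0); move: (y _) => w w0 Hw.
  by rewrite -(pmulr_lgt0 _ w0); lra.
pose c' i : int := Num.floor (T * t i).
exists (\sum_i (c' i)%:~R * e i).
  by apply: (A0_O emb); exists c'.
move=> j; set x := \sum_i _; rewrite -/(y j).
pose dl : R := in_algR (normr_real (s j x - algRval (T * y j))).
have h1 : dl <= E%:R.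
  apply: le_trans HE.
  have D : s j x - algRval (T * y j) = \sum_i algRval ((c' i)%:~R - T * t i) * s j (e i).
    rewrite (_ : algRval (T * y j) = algRval T * algRval (y j)) // -Sc mulr_sumr rmorph_sum -sumrB; apply: eq_bigr => i _.
    by rewrite rmorphB !rmorphM rmorph_int rmorph_int mulrBl -mulrA; congr (_ - _ * _); rewrite mulrC.
  apply: (@le_trans _ _ (\sum_i absv j (e i))); last first.
    by apply: ler_sum => i _; apply: absv_le_nrm.
  rewrite -[_ <= _]/(algRval _ <= algRval _) rmorph_sum /= D.
  apply: le_trans (ler_norm_sum _ _ _) _; apply: ler_sum => i _.
  rewrite normrM ler_piMl ?normr_ge0 //.
  have : `|(c' i)%:~R - T * t i| <= 1.
    have := floor_itv (T * t i); rewrite intrD => /andP[f1 f2].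
    by rewrite /c' distrC ger0_norm; lra.
  by [].
have h2 : absv j x <= T * y j + dl.
  have yy : 0 <= T * y j by have := Tj j; lra.
  have : `|s j x| <= `|s j x - algRval (T * y j)| + `|algRval (T * y j)|.
    by rewrite -{1}(subrK (algRval (T * y j)) (s j x)); apply: ler_normD.
  by rewrite (ger0_norm (yy : 0 <= algRval _)) addrC.
have h3 : T * y j <= absv j x + dl.
  have yy : 0 <= T * y j by have := Tj j; lra.
  have : `|algRval (T * y j)| <= `|s j x| + `|s j x - algRval (T * y j)|.
    rewrite -{1}(subKr (s j x) (algRval (T * y j))); exact: ler_normB.
  by rewrite (ger0_norm (yy : 0 <= algRval _)).
have := Tj j; move: (T * y j) (absv j x) h1 h2 h3 => w1 w2; lra.
Qed.

(** Let $x$ be an integer with $|x|_j$ comparable to $T\sqrt{|u|_j}$. A unit $v$ balancing $x$ makes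
    $|vx|_j$ at most a constant times $T$, hence $|v^2u|_j$ is bounded; there are finitely many
    bounded integers, and $u$ differs from $v^2u$ by a square. *)
Lemma units_mod_squares : exists l : seq F,
  (forall w, w \in l -> unit w) /\
  forall u, unit u -> exists2 w, w \in l & V (u / w).
Proof.
have [B HB] := balance.
pose C : R := 16 * (B.+1)%:R ^+ 2.
have fC : fin (fun w => [/\ unit w & nrm w <= n%:R * C]).
  by apply: fin_sub (fin_bounded (n%:R * C)) _ => w [[_ Ow _] H].
exists (enump (fun w => [/\ unit w & nrm w <= n%:R * C])); split.
  by move=> w /enump_prop[].
move=> u uu; have [u0 _ _] := uu.
have [T T0 [x Ox xP]] := approx_sqrt u0.
have x0 : x != 0.
  rewrite -(absv_eq0 s (Ordinal n0)) gt_eqF //.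
  have [h _] := xP (Ordinal n0); have : 0 < T * Num.sqrt (absv (Ordinal n0) u).
    by rewrite mulr_gt0 // sqrtr_gt0 absv_gt0.
  lra.
have [v uv Hv] := HB x x0.
(* The product of the $\sqrt{|u|_j}$ is 1 because $u$ has norm 1. *)
have Nx : Nm x <= (2 * T) ^+ n.
  have -> : (2 * T) ^+ n = \prod_j (2 * (T * Num.sqrt (absv j u))).
    under eq_bigr do rewrite mulrA.
    rewrite big_split /= prodr_const card_ord -[LHS]mulr1; congr (_ * _).
    apply/esym/eqP; rewrite -(pexpr_eq1 (n := 2)) //; last by apply: prodr_ge0 => j _; exact: sqrtr_ge0.
    rewrite -prodrXl (eq_bigr (fun j => absv j u)); first by apply/eqP; exact: (Nm_unit emb uu).
    by move=> j _; rewrite sqr_sqrtr ?absv_ge0.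
  apply: ler_prod => j _; rewrite absv_ge0 /=; by have [] := xP j.
have nvx : nrm (v * x) <= (B.+1)%:R * (2 * T).
  apply: (@expr_le_mono _ _ n) => //; rewrite ?nrm_ge0 ?mulr_ge0 ?ler0n ?(ltW T0) //.
  apply: le_trans Hv _; rewrite exprMn ler_pM ?ler0n ?Nm_ge0 //.
  exact: le_natX.
have key j : absv j (v ^+ 2 * u) <= C.
  have [h1 h2] := xP j.
  have hx : 0 < absv j x by exact: absv_gt0.
  have h3 : absv j v * absv j x <= (B.+1)%:R * (2 * T).
    by rewrite -absvM; apply: le_trans (absv_le_nrm _ _ _) nvx.
  have := absv_ge0 s j u; rewrite expr2 !absvM => hu.
  rewrite -(sqr_sqrtr hu); move: (Num.sqrt (absv j u)) (sqrtr_ge0 (absv j u)) h1 => w w0 h1.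
  have h4 : absv j v * (T * w) <= 4 * (B.+1)%:R * T.
    apply: le_trans (_ : absv j v * (2 * absv j x) <= _); first by rewrite ler_wpM2l ?absv_ge0.
    lra.
  have h5 : absv j v * w <= 4 * (B.+1)%:R.
    rewrite -(ler_pM2l T0); lra.
  rewrite (_ : _ * _ * _ = (absv j v * w) ^+ 2); last by ring.
  rewrite /C (_ : 16 * _ = (4 * (B.+1)%:R) ^+ 2); last by ring.
  by rewrite lerXn2r // ?nnegrE ?mulr_ge0 ?absv_ge0 ?ler0n.
have uw : unit (v ^+ 2 * u) by apply: unitM => //; apply: unitM.
exists (v ^+ 2 * u).
  apply: enump_in => //; split=> //; rewrite /nrm.
  apply: le_trans (_ : \sum_(j < n) C <= _); first by apply: ler_sum => j _; apply: key.
  by rewrite sumr_const card_ord mulr_natl.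
have v0 : v != 0 by case: uv.
exists v^-1; first exact: unitV.
by field; rewrite v0 u0.
Qed.

(** The balancing unit is corrected by one of finitely many representatives modulo squares, at the
    cost of a constant. *)
Lemma V_balance : exists2 B : nat, (0 < B)%N & forall x, x != 0 ->
  exists2 u, V u & nrm (u * x) ^+ n <= B%:R * Nm x.
Proof.
have [B HB] := balance; have [l [lu lP]] := units_mod_squares.
have [D D0 HD] := natural_bound (\sum_(b <- l) nrm b^-1).
exists (D ^ n * B).+1 => // x x0; have [u uu Hu] := HB x x0.
have [w wl Vw] := lP u uu; exists (u / w) => //.
have nw : nrm w^-1 <= D%:R.
  apply: le_trans HD; rewrite (big_rem w) //= lerDl sumr_ge0 // => t _; exact: nrm_ge0.
apply: (@le_trans _ _ ((D ^ n * B)%:R * Nm x)); last first.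
  by rewrite ler_wpM2r ?Nm_ge0 // ler_nat.
rewrite natrM natrX; apply: (@le_trans _ _ (D%:R ^+ n * nrm (u * x) ^+ n)); last first.
  by rewrite -mulrA ler_wpM2l ?exprn_ge0 ?ler0n.
rewrite -exprMn lerXn2r // ?nnegrE ?mulr_ge0 ?nrm_ge0 ?ler0n //.
rewrite (_ : u / w * x = w^-1 * (u * x)); last by ring.
by apply: le_trans (nrmM _ _ _) _; rewrite ler_wpM2r ?nrm_ge0.
Qed.

(** All factors of the norm but the $j$-th are at most [nrm x], so the $j$-th cannot be much
    smaller. *)
Lemma balanced_absv (B : R) x j : x != 0 -> nrm x ^+ n <= B * Nm x -> nrm x <= B * absv j x.
Proof.
move=> x0 H; have nx := nrm_gt0 emb x0.
have B0 : 0 <= B.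
  have : 0 <= B * Nm x by apply: le_trans H; apply: exprn_ge0; exact: ltW.
  by rewrite pmulr_lge0 // Nm_gt0.
have p0 : 0 < nrm x ^+ n.-1 by rewrite exprn_gt0.
rewrite -(ler_pM2r p0) -exprS prednK // -mulrA.
by apply: le_trans H _; rewrite ler_wpM2l // Nm_le_absv.
Qed.

(** The absolute values of a balanced $x$ are all comparable to [nrm x]. If $ux$ is balanced too, of
    the same norm, then $|u|_j$ is bounded, and bounded integers are finite in number. *)
Lemma V_proper (B : R) : fin (fun u => V u /\
  exists x, [/\ x != 0, nrm x ^+ n <= B * Nm x & nrm (u * x) ^+ n <= B * Nm x]).
Proof.
have [k k0 Bk] := natural_bound B.
apply: fin_sub (fin_bounded (n%:R * (k.+1%:R * k%:R))) _ => u [Vu [x [x0 h1 h2]]].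
have [u0 Ou _] := V_unit Vu; split=> //.
have nx := nrm_gt0 emb x0.
have h3 : nrm (u * x) <= k.+1%:R * nrm x.
  apply: (@expr_le_mono _ _ n) => //; rewrite ?mulr_ge0 ?ler0n ?nrm_ge0 //.
  apply: le_trans h2 _; rewrite exprMn.
  apply: le_trans (_ : k%:R * Nm x <= _); first by rewrite ler_wpM2r ?Nm_ge0.
  apply: ler_pM; rewrite ?ler0n ?Nm_ge0 //; [exact: le_natX|exact: Nm_le_nrm].
have h4 j : absv j u <= k.+1%:R * k%:R.
  have xj := absv_gt0 s j x0.
  have h5 : nrm x <= k%:R * absv j x.
    apply: le_trans (balanced_absv j x0 h1) _.
    by rewrite ler_wpM2r // ltW.
  rewrite -(ler_pM2r xj) -absvM; apply: le_trans (absv_le_nrm _ _ _) _.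
  apply: le_trans h3 _; rewrite -mulrA ler_wpM2l ?ler0n //.
apply: le_trans (_ : \sum_(j < n) k.+1%:R * k%:R <= _); first by apply: ler_sum => j _; apply: h4.
by rewrite sumr_const card_ord -[X in X <= _]mulr_natl.
Qed.

End Balance.

                                                 

(** * Orbits under squares of units, and a slowly varying weight *)

Definition pos (x : algR) : algR := if 0 <= x then x else 0.

Lemma pos_ge0 x : 0 <= pos x. Proof. by rewrite /pos; case: ifP. Qed.
Lemma pos_ge x : x <= pos x. Proof. by rewrite /pos; case: (lerP 0 x) => // /ltW. Qed.
Lemma pos_id x : 0 <= x -> pos x = x. Proof. by rewrite /pos => ->. Qed.
Lemma pos_neg x : x <= 0 -> pos x = 0.
Proof. by rewrite /pos => x0; case: (lerP 0 x) => // x1; apply/eqP; rewrite eq_le x0. Qed.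
Lemma pos_le x y : 0 <= y -> x <= y -> pos x <= y. Proof. by rewrite /pos; case: ifP. Qed.

Lemma bernoulli_up (t : algR) m : 0 <= t <= 1 -> (1 + t) ^+ m <= 1 + (2 ^+ m - 1) * t.
Proof.
move=> /andP[t0 t1]; elim: m => [|m IH]; first by rewrite !expr0; lra.
rewrite exprSr; apply: (@le_trans _ _ ((1 + (2 ^+ m - 1) * t) * (1 + t))).
  by rewrite ler_wpM2r //; lra.
have : 1 <= 2 ^+ m :> algR by rewrite exprn_ege1 // ler1n.
rewrite exprSr; move: (2 ^+ m) => c c1.
have : 0 <= (c - 1) * (t * (1 - t)) by rewrite !mulr_ge0 //; lra.
lra.
Qed.

Lemma sum_mem_le (T : eqType) (s t : seq T) : uniq s ->
  \sum_(x <- s) (x \in t)%:R <= (size t)%:R :> algR.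
Proof.
move=> us; rewrite -natr_sum ler_nat.
have -> : (\sum_(x <- s) (x \in t : nat) = count (mem t) s)%N.
  by elim: s {us} => [|x s IH]; rewrite ?big_nil ?big_cons //= IH.
rewrite -size_filter.
apply: uniq_leq_size; rewrite ?filter_uniq // => x; rewrite mem_filter => /andP[] //.
Qed.

Definition veq (F : fieldType) (iota : F -> algC) (x y : F) :=
  exists2 u, unit_square iota u & y = u * x.

(** [choose] returns the same element for equivalent predicates, so this picks one representative
    for the whole orbit. *)
Definition vrep (F : fieldType) (iota : F -> algC) (x : F) : F :=
  choose (fun y => `[< veq iota x y >]) x.

Section Orbits.
Variables (F : fieldType) (iota : {rmorphism F -> algC}) (n : nat).
Variables (s : 'I_n -> {rmorphism F -> algC}) (e : 'I_n -> F) (d : nat).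
Hypothesis emb : field_embeddings iota s e d.
Local Notation O := (integers iota).
Local Notation R := algR.
Local Notation nrm := (nrm s).
Local Notation Nm := (Nm s).
Local Notation absv := (absv s).
Local Notation V := (unit_square iota).
Local Notation veq := (veq iota).
Local Notation vrep := (vrep iota).
Let n0 : (0 < n)%N := emb_dim_gt0 emb.

Lemma V_neq0 u : V u -> u != 0. Proof. by case/V_unit. Qed.
Lemma Nm_V u : V u -> Nm u = 1. Proof. by move/V_unit/(Nm_unit emb). Qed.

Lemma veq_refl x : veq x x. Proof. by exists 1; [exact: V1|rewrite mul1r]. Qed.
Lemma veq_sym x y : veq x y -> veq y x.
Proof.
by move=> [u Vu ->]; exists u^-1; [exact: VV|rewrite mulKf // V_neq0].
Qed.
Lemma veq_trans x y z : veq x y -> veq y z -> veq x z.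
Proof.
by move=> [u Vu ->] [v Vv ->]; exists (v * u); [exact: VM|rewrite mulrA].
Qed.
Lemma Nm_veq x y : veq x y -> Nm y = Nm x.
Proof. by move=> [u /Nm_V Nu ->]; rewrite NmM Nu mul1r. Qed.
Lemma veq_neq0 x y : veq x y -> x != 0 -> y != 0.
Proof. by move=> [u /V_neq0 u0 ->] x0; rewrite mulf_neq0. Qed.

Lemma vrepK x : veq x (vrep x).
Proof. by apply/asboolP/(@chooseP _ (fun y => `[< veq x y >])); apply/asboolP/veq_refl. Qed.

Lemma vrepP x y : vrep x = vrep y <-> veq x y.
Proof.
split=> [E|xy].
  by apply: veq_trans (vrepK x) _; rewrite E; apply/veq_sym/vrepK.
have -> : vrep x = choose (fun z => `[< veq x z >]) x by [].
rewrite (@eq_choose _ _ (fun z => `[< veq y z >])); last first.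
  move=> z; apply/asboolP/asboolP; last exact: veq_trans.
  exact/veq_trans/veq_sym.
by apply: choose_id; apply/asboolP; [exact: veq_sym|exact: veq_refl].
Qed.

Lemma vrep_id x : vrep (vrep x) = vrep x.
Proof. by apply/vrepP/veq_sym/vrepK. Qed.

Definition v_invariant (G : set F) := forall u x, V u -> G x -> G (u * x).
Definition bounded_denom (G : set F) := exists2 k : nat, (0 < k)%N & forall x, G x -> O (k%:R * x).
Definition orbits (G : set F) (X : R) : set F :=
  fun D => [/\ G D, D != 0, vrep D = D & Nm D <= X].

Lemma invariant_veq G x y : v_invariant G -> veq x y -> G x -> G y.
Proof. by move=> iG [u Vu ->]; apply: iG. Qed.

Lemma fin_orbits G X : v_invariant G -> bounded_denom G -> fin (orbits G X).
Proof.
move=> iG [k k0 kG]; have [B B0 HB] := V_balance emb; have [C HC] := short_vectors emb.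
pose Y : R := 1 + k%:R ^+ n * (B%:R * `|X|).
have Y1 : 1 <= Y by rewrite lerDl !mulr_ge0 ?exprn_ge0 ?ler0n.
have kF : k%:R != 0 :> F by rewrite (natF_eq0 iota) -lt0n.
apply: fin_sub (fin_img (fun y => vrep (k%:R^-1 * y)) (HC Y Y1).1) _.
move=> D [GD D0 rD DX]; have [u Vu Hu] := HB D D0; exists (k%:R * (u * D)).
  split; first exact/kG/iG.
  rewrite nrm_nat exprMn; apply: ler_wpDl => //; rewrite ler_wpM2l ?exprn_ge0 ?ler0n //.
  apply: le_trans Hu _; rewrite ler_wpM2l ?ler0n //; exact: le_trans DX (ler_norm _).
by rewrite mulKf // -{1}rD; apply/vrepP; exists u.
Qed.

(** A balanced element of each orbit is a short integer, and [short_vectors] counts those. *)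
Lemma count_orbits : exists C : nat, forall (G : set F) (X : R), v_invariant G ->
  (forall x, G x -> O x) -> 1 <= X -> (size (enump (orbits G X)))%:R <= C%:R * X.
Proof.
have [B B0 HB] := V_balance emb; have [C HC] := short_vectors emb.
exists (C * B)%N => G X iG GO X1.
have Y1 : 1 <= B%:R * X by rewrite -[X in X <= _]mul1r ler_pM // ler1n.
have [fQ cQ] := HC _ Y1; apply: (@le_trans _ _ (C%:R * (B%:R * X))); last by rewrite natrM mulrA.
apply: le_trans cQ; rewrite ler_nat.
have uP D : exists u, D != 0 -> V u /\ nrm (u * D) ^+ n <= B%:R * Nm D.
  have [->|D0] := eqVneq D 0; first by exists 0.
  by have [u Vu Hu] := HB D D0; exists u.
pose u D := sval (cid (uP D)).
have uE D : D != 0 -> V (u D) /\ nrm (u D * D) ^+ n <= B%:R * Nm D by rewrite /u; case: cid.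
apply: (@size_enump_inj _ _ _ _ (fun D => u D * D)) => //.
  move=> D [GD D0 _ DX]; have [Vu Hu] := uE D D0; split; first exact/GO/iG.
  by apply: le_trans Hu _; rewrite ler_wpM2l ?ler0n.
move=> D D' [_ D0 rD _] [_ D0' rD' _] E; have [Vu _] := uE D D0; have [Vu' _] := uE D' D0'.
rewrite -rD -rD'; apply/vrepP; apply: (@veq_trans _ (u D * D)); first by exists (u D).
by rewrite E; apply: veq_sym; exists (u D').
Qed.

(** The Riesz mean, that is, the integral of the orbit count up to [X]. Its summand vanishes
    continuously at norm [X], which a plain count does not. *)
Definition Bsum (G : set F) (X : R) : R := \sum_(D <- enump (orbits G X)) (X - Nm D).

Lemma BsumE G X : Bsum G X = \sum_(D <- enump (orbits G X)) (X - Nm D).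
Proof. by []. Qed.

Section Weights.
Variable B : nat.
Hypothesis B0 : (0 < B)%N.
Hypothesis HB : forall x, x != 0 -> exists2 u, V u & nrm (u * x) ^+ n <= B%:R * Nm x.

Let b : R := 2 * B%:R.
Let b0 : 0 < b. Proof. by rewrite mulr_gt0 // ltr0n. Qed.

                                                                                                  
           
(** [qf] measures imbalance and is invariant under scaling by positive integers. [phi] is a bump
    supported where [qf] is below $b=2B$ and at least 1/2 where it is at most $B$, which happens in
    each orbit. Dividing by the orbit sum [Phi] gives [wt], a partition of unity on each orbit, and
    [hX] is the weight that replaces one orbit by all its points. *)
Definition qf x : R := nrm x ^+ n / Nm x.
Definition phi x : R := pos (1 - qf x / b).
Definition orbS x := enump (fun y => [/\ veq x y, y != 0 & qf y < b]).
Definition Phi x : R := \sum_(y <- orbS x) phi y.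
Definition wt x : R := phi x / Phi x.
Definition hX (X : R) x : R := if x == 0 then 0 else wt x * pos (X - Nm x).

Lemma qf_le (A : R) x : x != 0 -> (qf x <= A) = (nrm x ^+ n <= A * Nm x).
Proof. by move=> x0; rewrite /qf ler_pdivrMr // Nm_gt0. Qed.
Lemma qf_lt (A : R) x : x != 0 -> (qf x < A) = (nrm x ^+ n < A * Nm x).
Proof. by move=> x0; rewrite /qf ltr_pdivrMr // Nm_gt0. Qed.
Lemma qf_ge0 x : 0 <= qf x.
Proof. by rewrite divr_ge0 ?Nm_ge0 ?exprn_ge0 ?nrm_ge0. Qed.
Lemma phi_ge0 x : 0 <= phi x. Proof. exact: pos_ge0. Qed.
Lemma phi_le1 x : phi x <= 1.
Proof. by apply: pos_le => //; rewrite gerBl divr_ge0 ?qf_ge0 // ltW. Qed.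
Lemma phi_eq0 x : b <= qf x -> phi x = 0.
Proof. by move=> H; apply: pos_neg; rewrite subr_le0 ler_pdivlMr // mul1r. Qed.

Lemma fin_orbS x : x != 0 -> fin (fun y => [/\ veq x y, y != 0 & qf y < b]).
Proof.
move=> x0; have [u Vu Hu] := HB x0.
have ux0 : u * x != 0 by rewrite mulf_neq0 // V_neq0.
apply: fin_sub (fin_img (fun v => v * (u * x)) (V_proper emb b)) _ => y [[v Vv Dy] y0 qy].
exists (v / u); last by rewrite Dy mulrA mulfVK // V_neq0.
have E : v / u * (u * x) = y by rewrite Dy mulrA mulfVK // V_neq0.
have Nu : Nm (u * x) = Nm x by rewrite NmM Nm_V // mul1r.
split; first by apply: VM => //; apply: VV.
exists (u * x); rewrite E; split=> //; rewrite Nu.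
  apply: le_trans Hu _; rewrite ler_wpM2r ?Nm_ge0 // /b; have : 0 <= B%:R :> R by rewrite ler0n.
  lra.
move: qy; rewrite qf_lt // => /ltW; rewrite Dy NmM (Nm_V Vv) mul1r //.
Qed.

Lemma mem_orbS x y : x != 0 -> (y \in orbS x) = `[< [/\ veq x y, y != 0 & qf y < b] >].
Proof. by move=> x0; rewrite mem_enump //; apply: fin_orbS. Qed.

Lemma orbS_veq x y : veq x y -> orbS x = orbS y.
Proof.
move=> xy; apply: eq_enump => z; split=> -[h ? ?]; split=> //.
  exact: veq_trans (veq_sym xy) h.
exact: veq_trans xy h.
Qed.

Lemma Phi_ge x : x != 0 -> 1 / 2 <= Phi x.
Proof.
move=> x0; have [u Vu Hu] := HB x0.
have ux0 : u * x != 0 by rewrite mulf_neq0 // V_neq0.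
have Nu : Nm (u * x) = Nm x by rewrite NmM Nm_V // mul1r.
have qu : qf (u * x) <= B%:R by rewrite qf_le // Nu.
have BR : 0 < B%:R :> R by rewrite ltr0n.
have inS : u * x \in orbS x.
  rewrite mem_orbS //; apply/asboolP; split=> //; first by exists u.
  by rewrite /b; lra.
rewrite /Phi (big_rem _ inS) /=; apply: ler_wpDr.
  by apply: sumr_ge0 => y _; apply: phi_ge0.
apply: le_trans (pos_ge _).
have : qf (u * x) / b <= 1 / 2 by rewrite ler_pdivrMr // /b; lra.
lra.
Qed.

Lemma phi_le_Phi x : x != 0 -> phi x <= Phi x.
Proof.
move=> x0; have [qx|qx] := ltP (qf x) b; last first.
  by rewrite phi_eq0 //; apply: sumr_ge0 => y _; apply: phi_ge0.
have inS : x \in orbS x by rewrite mem_orbS //; apply/asboolP; split=> //; exact: veq_refl.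
rewrite /Phi (big_rem _ inS) /= lerDl.
by apply: sumr_ge0 => y _; apply: phi_ge0.
Qed.

Lemma wt_bound x : x != 0 -> 0 <= wt x <= 1.
Proof.
move=> x0; have P0 : 0 < Phi x by have := Phi_ge x0; lra.
by rewrite divr_ge0 ?phi_ge0 ?(ltW P0) //= ler_pdivrMr // mul1r phi_le_Phi.
Qed.

Lemma hX_ge0 X x : 0 <= hX X x.
Proof.
rewrite /hX; case: eqVneq => // x0.
by rewrite mulr_ge0 ?pos_ge0 //; case/andP: (wt_bound x0).
Qed.

Lemma hX_le X x : 0 <= X -> hX X x <= X.
Proof.
move=> X0; rewrite /hX; case: eqVneq => // x0; have /andP[w0 w1] := wt_bound x0.
rewrite -[X in _ <= X]mul1r; apply: ler_pM => //; first exact: pos_ge0.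
by apply: pos_le => //; rewrite gerBl Nm_ge0.
Qed.

Lemma hX_neq0 X x : hX X x != 0 -> [/\ x != 0, qf x < b & Nm x < X].
Proof.
rewrite /hX; case: (eqVneq x 0) => [_|x0]; first by rewrite eqxx.
move=> H; split=> //.
  rewrite ltNge; apply: contra H => /phi_eq0; rewrite /wt => ->.
  by rewrite !mul0r.
rewrite ltNge; apply: contra H => H; rewrite pos_neg ?mulr0 //.
by rewrite subr_le0.
Qed.

(** Unfolding: the weights [wt] on one orbit add up to 1 and the norm is constant there. The list
    [t] may be any finite part of [G] that contains the support of [hX]. *)
Lemma Bsum_weights G X (t : seq F) : v_invariant G -> bounded_denom G -> uniq t ->
  (forall x, x \in t -> G x) ->
  (forall x, G x -> x != 0 -> nrm x ^+ n <= b * Nm x -> Nm x <= X -> x \in t) ->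
  Bsum G X = \sum_(x <- t) hX X x.
Proof.
move=> iG bG ut tG tc; have fE := fin_orbits X iG bG.
pose E := enump (orbits G X).
transitivity (\sum_(D <- E) \sum_(x <- t) (if vrep x == D then hX X x else 0)); last first.
  rewrite exchange_big /=; rewrite !big_seq; apply: eq_bigr => x xt.
  have [->|hx] := eqVneq (hX X x) 0; first by rewrite big1 // => D _; case: ifP.
  have [x0 qx Nx] := hX_neq0 hx.
  have xE : vrep x \in E.
    apply: enump_in => //; split; first exact: invariant_veq (vrepK x) (tG x xt).
    - exact: veq_neq0 (vrepK x) x0.
    - exact: vrep_id.
    - by rewrite (Nm_veq (vrepK x)) ltW.
  rewrite (bigD1_seq (vrep x)) ?enump_uniq //= eqxx big1 ?addr0 // => D /negPf.
  by rewrite eq_sym => ->.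
rewrite /Bsum -/E !big_seq; apply: eq_bigr => D /enump_prop [GD D0 rD DX].
rewrite -big_mkcond -big_filter.
have S_t y : y \in orbS D -> y \in [seq x <- t | vrep x == D].
  rewrite mem_orbS // => /asboolP[Dy y0 qy]; rewrite mem_filter -[X in _ == X]rD.
  apply/andP; split; first by apply/eqP/vrepP/veq_sym.
  apply: tc => //; first exact: invariant_veq Dy GD.
    by rewrite -qf_le // ltW.
  by rewrite (Nm_veq Dy).
rewrite -(@big_sub_seq _ _ (orbS D)) ?filter_uniq ?enump_uniq //; last first.
  move=> x; rewrite mem_filter => /andP[/eqP Dx xt] nS; apply/eqP; apply: contraT => /hX_neq0[x0 qx _].
  by case/negP: nS; rewrite mem_orbS //; apply/asboolP; split=> //; rewrite -Dx; apply/veq_sym/vrepK.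
transitivity (\sum_(y <- orbS D) phi y / Phi D * (X - Nm D)).
  have PD : 0 < Phi D by have := Phi_ge D0; lra.
  by rewrite -mulr_suml -mulr_suml -/(Phi D) divff ?mul1r // gt_eqF.
rewrite !big_seq; apply: eq_bigr => y; rewrite mem_orbS // => /asboolP[Dy y0 qy].
rewrite /hX (negPf y0) (Nm_veq Dy) pos_id ?subr_ge0 //; congr (_ * _).
by rewrite /wt /Phi (orbS_veq Dy).
Qed.

(** Comparability is also required of all multiples by a common [u], since [Phi] involves [phi] at
    the points [u * x]. *)
Definition close (L : R) x y := [/\ x != 0, y != 0, Nm y <= L * Nm x, Nm x <= L * Nm y &
  forall u, u != 0 -> qf (u * y) <= L * qf (u * x) /\ qf (u * x) <= L * qf (u * y)].

Lemma close_sym L x y : close L x y -> close L y x.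
Proof. by case=> ? ? ? ? H; split=> // u /H[]. Qed.

Lemma close_absv (l L : R) x y : 0 < l -> l ^+ (2 * n) <= L -> 1 <= l -> x != 0 -> y != 0 ->
  (forall j, absv j y <= l * absv j x /\ absv j x <= l * absv j y) -> close L x y.
Proof.
move=> l0 lL l1 x0 y0 H.
have ln : l ^+ n <= L.
  apply: le_trans lL; rewrite mulnC exprM expr2 -[X in X <= _]mulr1 ler_wpM2l ?exprn_ge0 ?(ltW l0) //.
  exact: exprn_ege1.
have key a c : (forall j, absv j a <= l * absv j c) -> Nm a <= l ^+ n * Nm c /\ nrm a <= l * nrm c.
  move=> h; split.
    rewrite /Nm -[X in l ^+ X]card_ord -prodr_const -big_split /=.
    by apply: ler_prod => j _; rewrite absv_ge0 h.
  by rewrite /nrm mulr_sumr; apply: ler_sum => j _; apply: h.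
have qkey a c : a != 0 -> c != 0 -> (forall j, absv j a <= l * absv j c /\ absv j c <= l * absv j a) ->
    qf a <= L * qf c.
  move=> a0 c0 h; have [_ h1] := key a c (fun j => (h j).1); have [h2 _] := key c a (fun j => (h j).2).
  rewrite qf_le //; apply: (@le_trans _ _ ((l * nrm c) ^+ n)).
    by rewrite lerXn2r // ?nnegrE ?mulr_ge0 ?nrm_ge0 ?(ltW l0).
  rewrite exprMn.
  have -> : L * qf c * Nm a = (L * nrm c ^+ n / Nm c) * Nm a by rewrite /qf mulrA.
  rewrite mulrAC ler_pdivlMr ?Nm_gt0 //.
  apply: (@le_trans _ _ (l ^+ n * nrm c ^+ n * (l ^+ n * Nm a))).
    by rewrite ler_wpM2l // mulr_ge0 ?exprn_ge0 ?nrm_ge0 ?(ltW l0).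
  rewrite (_ : _ * _ * _ = l ^+ (2 * n) * (nrm c ^+ n * Nm a)); last by rewrite mulnC exprM expr2; ring.
  by rewrite -[X in _ <= X]mulrA ler_wpM2r // mulr_ge0 ?exprn_ge0 ?nrm_ge0 ?Nm_ge0.
split=> //.
- by apply: le_trans (key y x (fun j => (H j).1)).1 _; rewrite ler_wpM2r ?Nm_ge0.
- by apply: le_trans (key x y (fun j => (H j).2)).1 _; rewrite ler_wpM2r ?Nm_ge0.
move=> u u0; have a0 j : 0 <= absv j u by exact: absv_ge0.
by split; apply: qkey; rewrite ?mulf_neq0 // => j; have [h1 h2] := H j;
   rewrite !absvM ![l * (_ * _)]mulrCA; split; rewrite ler_wpM2l.
Qed.

(** No absolute value of a large balanced [x] is small, so adding a fixed [v] changes each of them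
    by a factor near 1. *)
Lemma close_add v (A eta : R) : 0 < A -> 0 < eta <= 1 -> exists T0 : R, forall x, x != 0 ->
  nrm x ^+ n <= A * Nm x -> T0 <= nrm x -> close (1 + eta) x (x + v).
Proof.
(* A factor $1+t$ at each place alters [qf] by at most $(1+t)^{2n}\le1+(2^{2n}-1)t$. *)
move=> A0 /andP[e0 e1]; pose t : R := eta / 2 ^+ (2 * n).
have p1 : 1 <= 2 ^+ (2 * n) :> R by rewrite exprn_ege1 // ler1n.
have p0 : 0 < 2 ^+ (2 * n) :> R by lra.
have t0 : 0 < t by rewrite divr_gt0.
have t1 : t <= 1 by rewrite ler_pdivrMr // mul1r; lra.
have tE : t * 2 ^+ (2 * n) = eta by rewrite divfK // gt_eqF.
have lL : (1 + t) ^+ (2 * n) <= 1 + eta.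
  apply: le_trans (bernoulli_up _ _) _; first by rewrite (ltW t0).
  by rewrite lerD2l -tE mulrC ler_wpM2l ?(ltW t0) //; lra.
exists (A * ((1 + t) * (nrm v + 1)) / t) => x x0 xA xT.
have h j : (1 + t) * (nrm v + 1) <= t * absv j x.
  have := balanced_absv emb j x0 xA => H.
  by have := le_trans xT H; rewrite -mulrA ler_pM2l // ler_pdivrMr // [absv _ _ * _]mulrC.
have v0 := nrm_ge0 s v.
have h1 j : absv j (x + v) <= (1 + t) * absv j x.
  have := absvD s j x v; have := absv_le_nrm s j v; have := h j; nra.
have h2 j : absv j x <= (1 + t) * absv j (x + v).
  have : absv j x <= absv j (x + v) + absv j v.
    by rewrite -{1}(addrK v x) -(absvN s j v); apply: absvD.
  have := absv_le_nrm s j v; have := h j => H3 H4 H5.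
  have H6 : absv j x - nrm v <= absv j (x + v) by lra.
  have : (1 + t) * (absv j x - nrm v) <= (1 + t) * absv j (x + v) by rewrite ler_wpM2l //; lra.
  nra.
have xv0 : x + v != 0.
  rewrite -(absv_eq0 s (Ordinal n0)) gt_eqF //; have := h2 (Ordinal n0).
  have : 0 < absv (Ordinal n0) x by exact: absv_gt0.
  move: (absv _ _) (absv _ _) => p q; nra.
by apply: (@close_absv (1 + t)) => //; lra.
Qed.

Lemma pos_diff (L p q : R) : 1 <= L -> 0 <= p -> 0 <= q -> p <= L * q -> q <= L * p ->
  `|pos (1 - p) - pos (1 - q)| <= L - 1.
Proof.
move=> L1 p0 q0 pq qp; have key a c : 0 <= a -> 0 <= c -> c <= L * a -> pos (1 - a) - pos (1 - c) <= L - 1.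
  move=> a0 c0 ca; rewrite {1}/pos; case: (lerP 0 (1 - a)) => h.
    have := pos_ge (1 - c); nra.
  have := pos_ge0 (1 - c); lra.
rewrite ler_norml; have := key _ _ p0 q0 qp; have := key _ _ q0 p0 pq.
move: (pos (1 - p)) (pos (1 - q)) => u v h1 h2.
by apply/andP; split; lra.
Qed.

(** By [V_proper] finitely many [u] can contribute, the same ones for every [x] in this range; so
    [Phi] is as regular as [phi]. *)
Lemma Phi_proper : exists Bl : seq F, (forall u, u \in Bl -> V u) /\ forall x, x != 0 -> qf x <= 2 * b ->
  Phi x = \sum_(u <- Bl) phi (u * x).
Proof.
have fB := V_proper emb (2 * b); set P := (fun u => _) in fB.
exists (enump P); split=> [u /enump_prop[]//|x x0 qx].
rewrite -(big_map (fun u => u * x) xpredT phi); apply: big_sub_seq.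
- exact: enump_uniq.
- by rewrite map_inj_uniq ?enump_uniq //; apply: mulIf.
- move=> y; rewrite mem_orbS // => /asboolP[[u Vu Dy] y0 qy]; apply/mapP; exists u => //.
  apply: enump_in => //; split=> //; exists x; split=> //; first by rewrite -qf_le.
  have Nu : Nm (u * x) = Nm x by rewrite NmM Nm_V // mul1r.
  by rewrite -Nu -Dy -qf_le //; have := b0; lra.
- move=> _ /mapP[u /enump_prop[Vu _] ->]; rewrite mem_orbS // => nS; apply: phi_eq0.
  rewrite leNgt; apply: contra nS => h; apply/asboolP; split=> //; first by exists u.
  by rewrite mulf_neq0 // V_neq0.
Qed.

(** [phi] changes by at most [eta], hence [Phi] by a constant times [eta]. As [Phi] is at least 1/2,
    the quotient [wt] also changes by $O(\eta)$, and the factor [pos (X - Nm x)] changes by at most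
    $\eta X$. *)
Lemma hX_diff : exists2 C : R, 0 <= C & forall eta x y X, 0 < eta <= 1 -> close (1 + eta) x y -> 0 <= X ->
  `|hX X y - hX X x| <= C * eta * X.
Proof.
have [Bl [BlV BlP]] := Phi_proper; pose c : R := (size Bl)%:R.
have c0 : 0 <= c by rewrite ler0n.
exists (2 + 4 * c + 1); first by lra.
move=> eta x y X /andP[e0 e1] [x0 y0 Nyx Nxy quxy] X0.
have [qyx qxy] : qf y <= (1 + eta) * qf x /\ qf x <= (1 + eta) * qf y.
  by have := quxy 1 (oner_neq0 _); rewrite !mul1r.
have rhs0 : 0 <= (2 + 4 * c + 1) * eta * X by rewrite !mulr_ge0 //; lra.
have qx0 := qf_ge0 x; have qy0 := qf_ge0 y.
have [bad|] := pselect (b <= qf x /\ b <= qf y).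
  by rewrite /hX (negPf x0) (negPf y0) /wt !phi_eq0 ?bad.1 ?bad.2 // !mul0r subrr normr0.
(* One of the two points lies in the support, and closeness keeps the other within [2 * b], where
   [Phi_proper] applies to both. *)
move=> nbad; have [qx2 qy2] : qf x <= 2 * b /\ qf y <= 2 * b.
  have [h|h] := ltP (qf x) b.
    by split; [lra|nra].
  have [h'|h'] := ltP (qf y) b; last by case: nbad.
  by split; [nra|lra].
have dphi u : u != 0 -> `|phi (u * y) - phi (u * x)| <= eta.
  move=> u0; have [h1 h2] := quxy u u0.
  have -> : eta = (1 + eta) - 1 by lra.
  have ib : 0 < b^-1 by rewrite invr_gt0.
  apply: pos_diff; [lra| | | |]; try by rewrite divr_ge0 ?qf_ge0 ?(ltW b0).
    by rewrite mulrA ler_pM2r.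
  by rewrite mulrA ler_pM2r.
have dPhi : `|Phi y - Phi x| <= c * eta.
  rewrite !BlP // -sumrB; apply: le_trans (ler_norm_sum _ _ _) _.
  apply: (@le_trans _ _ (\sum_(u <- Bl) eta)).
    by rewrite !big_seq; apply: ler_sum => u /BlV /V_neq0; apply: dphi.
  by rewrite big_const_seq count_predT iter_addr_0 /c mulr_natl.
have Px := Phi_ge x0; have Py := Phi_ge y0.
have dw : `|wt y - wt x| <= (2 + 4 * c) * eta.
  have Px0 : 0 < Phi x by lra. have Py0 : 0 < Phi y by lra.
  have d1 := dphi 1 (oner_neq0 _); rewrite !mul1r in d1.
  have f1 := phi_le1 x; have f0 := phi_ge0 x.
  have -> : wt y - wt x = ((phi y - phi x) + wt x * (Phi x - Phi y)) / Phi y.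
    by rewrite /wt; field; rewrite !gt_eqF.
  rewrite normrM normfV (gtr0_norm Py0) ler_pdivrMr //.
  apply: le_trans (ler_normD _ _) _; rewrite normrM.
  have /andP[w0 w1] := wt_bound x0.
  rewrite (ger0_norm w0) (distrC (Phi x)).
  have h : wt x * `|Phi y - Phi x| <= c * eta.
    rewrite -[X in _ <= X]mul1r; apply: ler_pM => //.
  have ce : 0 <= c * eta by rewrite mulr_ge0 // ltW.
  have : (2 + 4 * c) * eta * (1 / 2) <= (2 + 4 * c) * eta * Phi y.
    by rewrite ler_wpM2l // mulr_ge0 ?(ltW e0) //; lra.
  lra.
have dp : `|pos (X - Nm y) - pos (X - Nm x)| <= eta * X.
  have Nx0 := Nm_ge0 s x; have Ny0 := Nm_ge0 s y.
  have eX : 0 <= eta * X by rewrite mulr_ge0 // ltW.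
  have key p q : 0 <= p -> 0 <= q -> q <= (1 + eta) * p -> pos (X - p) - pos (X - q) <= eta * X.
    move=> p0 q0 qp; rewrite {1}/pos; case: (lerP 0 (X - p)) => h.
      have := pos_ge (X - q); nra.
    have := pos_ge0 (X - q); lra.
  rewrite ler_norml; have := key _ _ Nx0 Ny0 Nyx; have := key _ _ Ny0 Nx0 Nxy => h1 h2.
  by apply/andP; split; lra.
rewrite /hX (negPf x0) (negPf y0).
have -> : wt y * pos (X - Nm y) - wt x * pos (X - Nm x) =
   (wt y - wt x) * pos (X - Nm y) + wt x * (pos (X - Nm y) - pos (X - Nm x)) by ring.
apply: le_trans (ler_normD _ _) _; rewrite (normrM (wt y - wt x)) (normrM (wt x)).
have /andP[w0 w1] := wt_bound x0.
have pX : `|pos (X - Nm y)| <= X.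
  by rewrite (ger0_norm (pos_ge0 _)); apply: pos_le => //; rewrite gerBl Nm_ge0.
have h1 : `|wt y - wt x| * `|pos (X - Nm y)| <= (2 + 4 * c) * eta * X by apply: ler_pM.
have h2 : `|wt x| * `|pos (X - Nm y) - pos (X - Nm x)| <= eta * X.
  by rewrite -[X in _ <= X]mul1r; apply: ler_pM; rewrite ?(ger0_norm w0).
lra.
Qed.

(** The finitely many short [x], in number independent of [X], contribute $O(X)$. For the others
    with a nonzero term [close_add] applies: they are $O(X)$ in number, each contributing $O(\eta
    X)$ by [hX_diff]. *)
Lemma hX_translate v (eps : R) : 0 < eps -> exists X0 : R, forall X, X0 <= X ->
  forall t : seq F, uniq t -> (forall x, x \in t -> O x) ->
  \sum_(x <- t) `|hX X (x + v) - hX X x| <= eps * X ^+ 2.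
Proof.
move=> eps0; have [C C0 HC] := hX_diff; have [K HK] := short_vectors emb.
pose c1 : R := C * (K%:R * (4 * b)) + 1.
have c10 : 0 < c1 by rewrite ltr_wpDl // !mulr_ge0 ?ler0n ?(ltW b0).
pose eta : R := Num.min 1 (eps / 2 / c1).
have eta0 : 0 < eta by rewrite lt_min ltr01 !divr_gt0.
have eta1 : eta <= 1 by rewrite ge_min lexx.
have eta2 : eta * c1 <= eps / 2.
  by rewrite -ler_pdivlMr // ge_min lexx orbT.
have etaI : 0 < eta <= 1 by rewrite eta0.
have b20 : 0 < 2 * b by have := b0; lra.
have [T0 HT0] := close_add v b20 etaI.
have [T1 HT1] := close_add (- v) b0 etaI.
pose T : R := Num.max T0 (T1 + nrm v).
have fT := fin_bounded emb T.
pose s1 := enump (fun x => O x /\ nrm x <= T).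
exists (1 + (size s1)%:R * 2 / eps) => X HX t ut tO.
have s10 : 0 <= (size s1)%:R :> R by rewrite ler0n.
have X1 : 1 <= X by apply: le_trans HX; rewrite lerDl divr_ge0 ?mulr_ge0 ?(ltW eps0).
have X0 : 0 <= X by lra.
have Y1 : 1 <= 4 * b * X.
  have : 1 <= B%:R :> R by rewrite ler1n.
  rewrite /b; nra.
have [fQ cQ] := HK _ Y1.
(* If $x$ or $x+v$ carries weight, closeness up to a factor 2 gives [qf x <= 2 * b] and
   [Nm x <= 2 * X], hence the bound $4bX$. *)
pose s2 := enump (fun x => O x /\ nrm x ^+ n <= 4 * b * X).
have term x : O x -> `|hX X (x + v) - hX X x| <= X * (x \in s1)%:R + C * eta * X * (x \in s2)%:R.
  move=> Ox; have Ce : 0 <= C * eta * X by rewrite !mulr_ge0 // ltW.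
  have [xs1|xs1] := boolP (x \in s1).
    rewrite mulr1; apply: ler_wpDr; first by rewrite mulr_ge0 ?ler0n.
    have := hX_ge0 X x; have := hX_ge0 X (x + v); have := hX_le x X0; have := hX_le (x + v) X0.
    by move=> h1 h2 h3 h4; rewrite ler_norml; apply/andP; split; lra.
  have xT : T < nrm x.
    by rewrite ltNge; apply: contra xs1 => H; apply: enump_in.
  have xT0 : T0 <= nrm x by apply: le_trans (ltW xT); rewrite le_max lexx.
  have xT1 : T1 + nrm v <= nrm x by apply: le_trans (ltW xT); rewrite le_max lexx orbT.
  rewrite mulr0 add0r.
  have [->|hne] := eqVneq (hX X (x + v) - hX X x) 0; first by rewrite normr0 mulr_ge0 ?ler0n.
  have cl : close (1 + eta) x (x + v).
    have [hx|hx] := eqVneq (hX X x) 0.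
      have hv : hX X (x + v) != 0 by move: hne; rewrite hx subr0.
      have [xv0 qv Nv] := hX_neq0 hv.
      have : close (1 + eta) (x + v) (x + v - v); last by rewrite addrK; apply: close_sym.
      apply: HT1 => //; first by rewrite -qf_le // ltW.
      have : nrm x <= nrm (x + v) + nrm v.
        by rewrite -{1}(addrK v x) -(nrmN s v); apply: nrmD.
      lra.
    have [x0 qx Nx] := hX_neq0 hx; apply: HT0 => //.
    by rewrite -qf_le //; have := b0; lra.
  have [x0 xv0 N1 N2 qu] := cl.
  have xs2 : x \in s2.
    apply: enump_in => //; split=> //.
    have [q1 q2] := qu 1 (oner_neq0 _); rewrite !mul1r in q1 q2.
    have Nx0 := Nm_ge0 s x; have Nv0 := Nm_ge0 s (x + v).
    have qx0 := qf_ge0 x; have qv0 := qf_ge0 (x + v).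
    have [h3 h4] : qf x <= 2 * b /\ Nm x <= 2 * X.
      have [hx|hx] := eqVneq (hX X x) 0.
        have hv : hX X (x + v) != 0 by move: hne; rewrite hx subr0.
        by have [_ qv Nv] := hX_neq0 hv; split; nra.
      by have [_ qx Nx] := hX_neq0 hx; have := b0; split; lra.
    rewrite qf_le // in h3; apply: le_trans h3 _; have := b0; nra.
  by rewrite xs2 mulr1; apply: HC.
apply: (@le_trans _ _ (X * (size s1)%:R + C * eta * X * (size s2)%:R)).
  apply: (@le_trans _ _ (\sum_(x <- t) (X * (x \in s1)%:R + C * eta * X * (x \in s2)%:R))).
    by rewrite !big_seq; apply: ler_sum => x /tO; apply: term.
  rewrite big_split /= -!mulr_sumr; apply: lerD; rewrite ler_wpM2l ?sum_mem_le // !mulr_ge0 // ltW //.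
have h1 : C * eta * X * (size s2)%:R <= eps / 2 * X ^+ 2.
  apply: (@le_trans _ _ (C * eta * X * (K%:R * (4 * b * X)))).
    by rewrite ler_wpM2l // !mulr_ge0 // ltW.
  have -> : C * eta * X * (K%:R * (4 * b * X)) = eta * (c1 - 1) * X ^+ 2 by rewrite /c1; ring.
  rewrite ler_wpM2r ?exprn_ge0 //; have := eta0; lra.
have h2 : X * (size s1)%:R <= eps / 2 * X ^+ 2.
  have h : (size s1)%:R <= eps / 2 * X.
    rewrite mulrAC ler_pdivlMr // mulrC -ler_pdivrMl // mulrC mulrC.
    by rewrite mulrC mulrC; move: HX; rewrite [_ * 2]mulrC; lra.
  by rewrite expr2 mulrA [X in X <= _]mulrC ler_wpM2r.
lra.
Qed.

End Weights.
End Orbits.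

(** * Asymptotics of Riesz means over periodic sets *)

Lemma uniform_threshold (T : eqType) (vs : seq T) (P : T -> algR -> Prop) :
  (forall v X Y, P v X -> X <= Y -> P v Y) ->
  (forall v, exists X, P v X) -> exists X, forall v, v \in vs -> P v X.
Proof.
move=> mono H; elim: vs => [|v vs [X HX]]; first by exists 0.
have [Y HY] := H v; exists (Num.max X Y) => w; rewrite inE => /orP[/eqP->|/HX wX].
  by apply: mono HY _; rewrite le_max lexx orbT.
by apply: mono wX _; rewrite le_max lexx.
Qed.

                                                                                                   
                                    
(** The $n$-th powers of consecutive large terms of the progression $1+mj$ have ratio near 1. So for
    a large denominator, the first numerator past $c$ times it overshoots by a factor of at most
    $1+\eta$. *)
Lemma approx_ratio (m n : nat) (c eta : algR) : (0 < n)%N -> (0 < m)%N -> 0 < c -> 0 < eta <= 1 ->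
  exists j j' : nat, c <= ((1 + m * j)%:R / (1 + m * j')%:R) ^+ n <= c * (1 + eta).
Proof.
move=> n0 m0 c0 /andP[e0 e1].
have p1 : 1 <= 2 ^+ n :> algR by rewrite exprn_ege1 // ler1n.
have m1 : 1 <= m%:R :> algR by rewrite ler1n.
(* For $a\ge K_0$ one has $(1+m/a)^n\le1+\eta$; the denominator [k1] is then taken large enough to
   push the numerator beyond $K_0+m$. *)
have [K0 K00 HK] := natural_bound (2 ^+ n * m%:R / eta).
have K1 : 2 ^+ n * m%:R <= eta * K0%:R by rewrite -ler_pdivrMl // mulrC.
have [k1 k10 Hk1] := natural_bound ((K0 + m)%:R ^+ n / c).
pose k' : algR := (1 + m * k1)%:R.
have k'1 : 1 <= k' by rewrite ler1n.
have k'0 : 0 < k' by lra.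
have k'n : 0 < k' ^+ n by rewrite exprn_gt0.
have big : (K0 + m)%:R ^+ n <= c * k' ^+ n.
  rewrite -ler_pdivrMl // mulrC; apply: le_trans Hk1 _; rewrite /k' -natrX ler_nat.
  apply: (@leq_trans (1 + m * k1)); first by rewrite addnC (leq_trans (leq_pmull k1 m0)) // leq_addr.
  by rewrite -{1}(expn1 (1 + _)%N) leq_pexp2l.
have ex : exists j : nat, c * k' ^+ n <= (1 + m * j)%:R ^+ n.
  have [N N0 HN] := natural_bound (c * k' ^+ n); exists N; apply: le_trans HN _.
  rewrite -natrX ler_nat; apply: (@leq_trans (1 + m * N)); first by rewrite addnC (leq_trans (leq_pmull N m0)) // leq_addr.
  by rewrite -{1}(expn1 (1 + _)%N) leq_pexp2l.
have [j [h1 h2]] : exists j, c * k' ^+ n <= (1 + m * j)%:R ^+ n /\ ((1 + m * j.-1)%:R ^+ n < c * k' ^+ n \/ j = 0%N).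
  exists (ex_minn ex); case: ex_minnP => -[|i] Hi min; split=> //; [by right|left].
  by rewrite ltNge; apply/negP => /min; rewrite ltnn.
exists j, k1; rewrite expr_div_n ler_pdivlMr // h1 /= ler_pdivrMr //.
have kbig : (K0 + m)%:R <= (1 + m * j)%:R :> algR.
  by apply: (@expr_le_mono _ _ n) => //; rewrite ?ler0n //; apply: le_trans h1.
have j0 : (0 < j)%N.
  rewrite lt0n; apply/negP => /eqP j0; move: kbig; rewrite j0 muln0 addn0 ler_nat.
  by rewrite leqNgt -[1%N]addn0 -addn1 addnC leq_add // addn1.
case: h2 => [h2|E]; last by rewrite E in j0.
pose a : algR := (1 + m * j.-1)%:R.
have aE : (1 + m * j)%:R = a + m%:R :> algR.
  rewrite /a -natrD; congr _%:R; move: j0; case: (j) => // i _ /=.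
  by rewrite mulnS addnA addnAC.
have aK : K0%:R <= a by move: kbig; rewrite aE natrD lerD2r.
have K0R : 1 <= K0%:R :> algR by rewrite ler1n.
have a0 : 0 < a by lra.
have -> : (1 + m * j)%:R ^+ n = a ^+ n * (1 + m%:R / a) ^+ n :> algR.
  by rewrite aE -exprMn mulrDr mulr1 mulrCA divff ?mulr1 // gt_eqF.
have ma : 0 <= m%:R / a <= 1.
  rewrite divr_ge0 ?ler0n ?(ltW a0) //= ler_pdivrMr // mul1r.
  nra.
have h3 : (1 + m%:R / a) ^+ n <= 1 + eta.
  apply: le_trans (bernoulli_up _ ma) _; rewrite lerD2l.
  case/andP: ma => ma0 ma1.
  apply: (@le_trans _ _ (2 ^+ n * (m%:R / a))); first by rewrite ler_wpM2r //; lra.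
  rewrite mulrA ler_pdivrMr //; nra.
rewrite mulrAC; apply: ler_pM => //; rewrite ?exprn_ge0 ?(ltW a0) //; last exact: ltW.
by case/andP: ma => ma0 _; lra.
Qed.

Section Density.
Variables (F : fieldType) (iota : {rmorphism F -> algC}) (n : nat).
Variables (s : 'I_n -> {rmorphism F -> algC}) (e : 'I_n -> F) (d : nat).
Hypothesis emb : field_embeddings iota s e d.
Local Notation O := (integers iota).
Local Notation R := algR.
Local Notation nrm := (nrm s).
Local Notation Nm := (Nm s).
Local Notation veq := (veq iota).
Local Notation vrep := (vrep iota).
Local Notation v_invariant := (v_invariant iota).
Local Notation bounded_denom := (bounded_denom iota).
Local Notation orbits := (orbits iota s).
Local Notation Bsum := (Bsum iota s).
Let n0 : (0 < n)%N := emb_dim_gt0 emb.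

Lemma Bsum_ge0 G X : 0 <= Bsum G X.
Proof.
by rewrite !BsumE big_seq; apply: sumr_ge0 => D /enump_prop[_ _ _]; rewrite subr_ge0.
Qed.

Lemma Bsum_mono G X Y : v_invariant G -> bounded_denom G -> X <= Y -> Bsum G X <= Bsum G Y.
Proof.
move=> iG bG XY; have fY := fin_orbits emb Y iG bG.
have E : Bsum G Y = \sum_(D <- enump (orbits G Y)) pos (Y - Nm D).
  rewrite !BsumE !big_seq; apply: eq_bigr => D /enump_prop[_ _ _ DY].
  by rewrite pos_id // subr_ge0.
have -> : Bsum G X = \sum_(D <- enump (orbits G Y)) pos (X - Nm D).
  rewrite -(big_enump_sub (P := orbits G X)) //.
  - rewrite !BsumE !big_seq; apply: eq_bigr => D /enump_prop[_ _ _ DX].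
    by rewrite pos_id // subr_ge0.
  - by move=> D [? ? ? DX]; split=> //; apply: le_trans DX XY.
  - move=> D [? ? ? DY] nD; apply: pos_neg; rewrite subr_le0 ltW // ltNge; apply/negP => DX.
    by apply: nD.
rewrite E; apply: ler_sum => D _; apply: pos_le; first exact: pos_ge0.
by apply: le_trans (pos_ge _); lra.
Qed.

Lemma Bsum_bound : exists2 C : R, 0 <= C & forall G X, v_invariant G -> (forall x, G x -> O x) ->
  1 <= X -> Bsum G X <= C * X ^+ 2.
Proof.
have [C HC] := count_orbits emb; exists C%:R; first by rewrite ler0n.
move=> G X iG GO X1; have X0 : 0 <= X by lra.
apply: (@le_trans _ _ (\sum_(D <- enump (orbits G X)) X)).
  by apply: ler_sum => D _; rewrite gerBl Nm_ge0.
rewrite big_const_seq count_predT iter_addr_0 -[X *+ _]mulr_natl expr2 mulrA ler_wpM2r //.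
exact: HC.
Qed.

Lemma sub_bounded_denom (G : set F) : (forall x, G x -> O x) -> bounded_denom G.
Proof. by move=> GO; exists 1%N => // x /GO; rewrite mul1r. Qed.

(** After unfolding, the sum over [G] is the sum over [v] of the translated weights on [G0], and
    [hX_translate] bounds the effect of each translation. *)
Lemma Bsum_translates (G0 G : set F) (vs : seq F) : uniq vs ->
  v_invariant G0 -> v_invariant G -> bounded_denom G -> (forall x, G0 x -> O x) ->
  (forall x, G x <-> exists2 v, v \in vs & G0 (x - v)) ->
  (forall x v v', v \in vs -> v' \in vs -> G0 (x - v) -> G0 (x - v') -> v = v') ->
  forall eps : R, 0 < eps -> exists X0 : R, forall X, X0 <= X ->
  `|Bsum G X - (size vs)%:R * Bsum G0 X| <= eps * X ^+ 2.
Proof.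
move=> uvs iG0 iG bG G0O GP vU eps eps0.
have [B B0 HB] := V_balance emb; pose b : R := 2 * B%:R.
have b0 : 0 < b by rewrite mulr_gt0 // ltr0n.
pose eps1 : R := eps / (size vs).+1%:R.
have sz0 : 0 < (size vs).+1%:R :> R by rewrite ltr0n.
have eps10 : 0 < eps1 by rewrite divr_gt0.
pose P v X0 := forall X, X0 <= X -> forall t : seq F, uniq t -> (forall x, x \in t -> O x) ->
  \sum_(x <- t) `|hX iota s B X (x + v) - hX iota s B X x| <= eps1 * X ^+ 2.
have [|v|X0 HX0] := @uniform_threshold _ vs P.
- by move=> v X Y H XY Z YZ; apply: H; apply: le_trans YZ.
- exact: (hX_translate emb B0 HB v eps10).
exists (Num.max 0 X0) => X; rewrite ge_max => /andP[Xge0 HX].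
(* [W] bounds every point of weight at level [X] together with its translates, so that one finite
   part of [G0] serves for all [v]. *)
have [W W0 HW] := natural_bound (b * X + 1 + \sum_(v <- vs) nrm v).
have fW : fin (fun x => G0 x /\ nrm x <= W%:R).
  by apply: fin_sub (fin_bounded emb W%:R) _ => x [/G0O].
pose t0 := enump (fun x => G0 x /\ nrm x <= W%:R).
have small x : nrm x ^+ n <= b * X -> nrm x <= b * X + 1.
  move=> H; have bX : 0 <= b * X by rewrite mulr_ge0 // ltW.
  have [h|h] := lerP (nrm x) 1; first by lra.
  apply: (@le_trans _ _ (nrm x ^+ n)); last by lra.
  by rewrite -{1}[nrm x]expr1 ler_eXn2l.
have Sv0 : 0 <= \sum_(v <- vs) nrm v by apply: sumr_ge0 => v _; apply: nrm_ge0.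
have nb x : nrm x ^+ n <= b * Nm x -> Nm x <= X -> nrm x <= b * X + 1.
  by move=> h1 h2; apply: small; apply: le_trans h1 _; rewrite ler_wpM2l ?(ltW b0).
have E0 : Bsum G0 X = \sum_(x <- t0) hX iota s B X x.
  apply: (Bsum_weights emb B0 HB) => //; first exact: sub_bounded_denom.
  - exact: enump_uniq.
  - by move=> x /enump_prop[].
  - move=> x Gx x0 xb Nx; apply: enump_in => //; split=> //.
    have := nb x xb Nx; lra.
have E1 : Bsum G X = \sum_(v <- vs) \sum_(x <- t0) hX iota s B X (x + v).
  rewrite (Bsum_weights emb B0 HB (t := [seq x + v | v <- vs, x <- t0])) //.
  - by rewrite big_allpairs_dep.
  - apply: allpairs_uniq => //; first exact: enump_uniq.
    move=> [v x] [v' x'] /= /allpairsP[[a c] [/= av cx [-> ->]]] /allpairsP[[a' c'] [/= av' cx' [-> ->]]] E.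
    have [Gc _] := enump_prop cx; have [Gc' _] := enump_prop cx'.
    have aa : a = a'.
      apply: (vU (c + a)) => //; first by rewrite addrK.
      by rewrite E addrK.
    by subst a'; move: E => /addIr ->.
  - move=> _ /allpairsP[[v x] [/= vv /enump_prop[Gx _] ->]]; apply/GP; exists v => //.
    by rewrite addrK.
  - move=> x Gx x0 xb Nx; have [v vv Gv] := (GP x).1 Gx.
    apply/allpairsP; exists (v, x - v); split=> //=; last by rewrite subrK.
    apply: enump_in => //; split=> //.
    have h1 := nb x xb Nx; have : nrm v <= \sum_(v <- vs) nrm v.
      by rewrite (big_rem v) //= lerDl sumr_ge0 // => w _; apply: nrm_ge0.
    have := nrmD s x (- v); rewrite nrmN; lra.
have -> : (size vs)%:R * Bsum G0 X = \sum_(v <- vs) \sum_(x <- t0) hX iota s B X x.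
  by rewrite E0 big_const_seq count_predT iter_addr_0 mulr_natl.
rewrite E1 -sumrB; apply: le_trans (ler_norm_sum _ _ _) _.
apply: (@le_trans _ _ (\sum_(v <- vs) eps1 * X ^+ 2)).
  rewrite [X in X <= _]big_seq [X in _ <= X]big_seq; apply: ler_sum => v vv; rewrite -sumrB.
  apply: le_trans (ler_norm_sum _ _ _) _; apply: HX0 => //; first exact: enump_uniq.
  by move=> x /enump_prop[/G0O].
rewrite big_const_seq count_predT iter_addr_0 -[(_ * _) *+ _]mulr_natl mulrA ler_wpM2r ?exprn_ge0 //.
rewrite /eps1 mulrCA ler_piMr ?(ltW eps0) // ler_pdivrMr // mul1r ler_nat.
exact: leqnSn.
Qed.

Lemma orbits_smul (A : nmodType) (c : F) (G : set F) (X : R) (f : F -> A) : c != 0 ->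
  v_invariant G -> bounded_denom G -> (forall x y, veq x y -> f x = f y) ->
  \sum_(D <- enump (orbits (smul c G) (Nm c * X))) f D = \sum_(D <- enump (orbits G X)) f (c * D).
Proof.
move=> c0 iG [k k0 kG] fV.
have iG' : v_invariant (smul c G).
  by move=> u _ Vu [x Gx ->]; exists (u * x); [exact: iG|ring].
have bG' : bounded_denom (smul c G).
  have [l l0 Ol] := O_clear iota c; exists (l * k)%N; first by rewrite muln_gt0 l0.
  by move=> _ [x /kG Gx ->]; rewrite natrM mulrACA; apply: OM.
have fG := fin_orbits emb X iG (ex_intro2 _ _ k k0 kG).
have fG' := fin_orbits emb (Nm c * X) iG' bG'.
pose t := [seq vrep (c * D) | D <- enump (orbits G X)].
have cV x y : veq (c * x) (c * y) -> veq x y.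
  by move=> [u Vu E]; exists u => //; apply: (mulfI c0); rewrite E; ring.
have pt : perm_eq (enump (orbits (smul c G) (Nm c * X))) t.
  apply: uniq_perm; first exact: enump_uniq.
    rewrite map_inj_in_uniq ?enump_uniq // => x y /enump_prop[_ _ rx _] /enump_prop[_ _ ry _].
    by move=> /vrepP /cV /vrepP; rewrite rx ry.
  move=> D; rewrite mem_enump //; apply/asboolP/mapP.
    move=> [[x Gx Dx] D0 rD ND]; exists (vrep x).
      apply: enump_in => //; split.
      - exact: invariant_veq (vrepK iota x) Gx.
      - by apply: veq_neq0 (vrepK iota x) _; apply: contra_neq D0 => x0; rewrite Dx x0 mulr0.
      - exact: vrep_id.
      - rewrite (Nm_veq emb (vrepK iota x)).
        by move: ND; rewrite Dx NmM ler_pM2l // Nm_gt0.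
    rewrite -rD Dx; apply/vrepP; have [u Vu ->] := vrepK iota x.
    by exists u => //; ring.
  move=> [x /enump_prop[Gx x0 rx Nx] ->]; have cx := vrepK iota (c * x); split.
  - by apply: (invariant_veq iG' cx); exists x.
  - by apply: veq_neq0 cx _; rewrite mulf_neq0.
  - exact: vrep_id.
  - by rewrite (Nm_veq emb cx) NmM ler_wpM2l ?Nm_ge0.
rewrite (perm_big _ pt) big_map; apply: eq_bigr => D _.
by apply/esym/fV/vrepK.
Qed.

(** Multiplication by [c] is a bijection of orbits that scales norms by [Nm c]. *)
Lemma Bsum_smul (c : F) (G : set F) (X : R) : c != 0 -> v_invariant G -> bounded_denom G ->
  Bsum (smul c G) (Nm c * X) = Nm c * Bsum G X.
Proof.
move=> c0 iG bG; rewrite !BsumE orbits_smul //; last first.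
  by move=> x y xy; rewrite (Nm_veq emb xy).
by rewrite mulr_sumr; apply: eq_bigr => D _; rewrite NmM mulrBr.
Qed.

Section Periodic.
Variables (G : set F) (m : nat).
Hypothesis m0 : (0 < m)%N.
Hypothesis iG : v_invariant G.
Hypothesis GO : forall x, G x -> O x.
Hypothesis perG : forall x y, G x -> O y -> G (x + m%:R * y).

(** Since $k\equiv1$ modulo $m$, the periodic set $G$ is a disjoint union of translates of $kG$ by
    $mr_i$, with $r_i$ running over the $k^n$ classes of $O/kO$. Thus the mean of $G$ at $k^nX$ is
    about $k^n$ times that of $kG$, which equals $k^n$ times the mean of $G$ at $X$. *)
Lemma Bsum_dilate (j : nat) (eps : R) : 0 < eps -> exists X0 : R, forall X, X0 <= X ->
  let k : R := (1 + m * j)%:R in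
  `|Bsum G (k ^+ n * X) - k ^+ (2 * n) * Bsum G X| <= eps * X ^+ 2.
Proof.
move=> eps0; pose kF : F := (1 + m * j)%:R; pose k : R := (1 + m * j)%:R.
have kF0 : kF != 0 by rewrite (natF_eq0 iota).
have Ok : O kF by exact: O_nat.
have kN : Nm kF = k ^+ n by exact: Nm_nat.
have k1 : 1 <= k by rewrite ler1n.
have kn : 0 < k ^+ n by rewrite exprn_gt0 //; lra.
have mF : m%:R != 0 :> F by rewrite (natF_eq0 iota) -lt0n.
have [l [r [rO rP]] Nl] := index_O emb kF0 Ok.
have kE : kF = 1 + m%:R * j%:R by rewrite /kF natrD natrM.
have iGk : v_invariant (smul kF G).
  by move=> u _ Vu [x Gx ->]; exists (u * x); [exact: iG|ring].
have rI i i' : smul kF O (r i - r i') -> i = i'.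
  move=> H; have [c [_ Uc]] := rP _ (rO i).
  by rewrite -(Uc i) ?subrr; [exact: Uc|by exists 0; [exact: O0|rewrite mulr0]].
pose vs := [seq m%:R * r i | i <- enum 'I_l].
have vsP v : v \in vs -> exists i, v = m%:R * r i by move=> /mapP[i _ ->]; exists i.
have uvs : uniq vs.
  rewrite map_inj_uniq ?enum_uniq // => i i' /(mulfI mF) E; apply: rI.
  by rewrite E subrr; exists 0; [exact: O0|rewrite mulr0].
have szv : (size vs)%:R = k ^+ n by rewrite size_map size_enum_ord Nl.
have GP x : G x <-> exists2 v, v \in vs & smul kF G (x - v).
  split=> [Gx|[v /vsP[i ->] [g Gg E]]].
    (* Writing $-jx=r_i+kz$ gives $x-mr_i=k(x+mz)$, because $k=1+mj$. *)
    have Oy : O (- j%:R * x) by apply: OM; [apply: ON; exact: O_nat|exact: GO].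
    have [i [[z Oz Dz] _]] := rP _ Oy.
    exists (m%:R * r i); first by apply/mapP; exists i; rewrite ?mem_enum.
    exists (x + m%:R * z); first exact: perG.
    have -> : r i = - j%:R * x - kF * z by rewrite -Dz; ring.
    by rewrite kE; ring.
  have -> : x = g + m%:R * (j%:R * g + r i).
    by rewrite -[x](subrK (m%:R * r i)) E kE; ring.
  by apply: perG => //; apply: OD => //; apply: OM; [exact: O_nat|exact: GO].
have vU x v v' : v \in vs -> v' \in vs -> smul kF G (x - v) -> smul kF G (x - v') -> v = v'.
  move=> /vsP[i ->] /vsP[i' ->] [g /GO Og E] [g' /GO Og' E']; rewrite (rI i i') //.
  exists ((r i - r i') - j%:R * (g' - g)).
    by apply: OB; [exact: OB|apply: OM; [exact: O_nat|exact: OB]].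
  have H : m%:R * (r i - r i') = kF * (g' - g).
    rewrite [RHS]mulrBr -E -E'; ring.
  have E3 : r i - r i' = kF * (r i - r i') - j%:R * (m%:R * (r i - r i')) by rewrite {1}kE; ring.
  by rewrite H in E3; rewrite {1}E3; ring.
pose eps1 : R := eps / k ^+ (2 * n).
have k2n : 0 < k ^+ (2 * n) by rewrite exprn_gt0 //; lra.
have eps10 : 0 < eps1 by rewrite divr_gt0.
have GkO x : smul kF G x -> O x by move=> [g /GO Og ->]; apply: OM.
have [X0 HX0] := Bsum_translates uvs iGk iG (sub_bounded_denom GO) GkO GP vU eps10.
exists (Num.max 0 X0) => X; rewrite ge_max => /andP[Xge0 HX] /=.
have XX : X0 <= k ^+ n * X.
  by apply: le_trans HX _; rewrite ler_peMl // exprn_ege1.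
have := HX0 _ XX; rewrite szv -kN (Bsum_smul _ kF0 iG (sub_bounded_denom GO)) kN mulrA -expr2 -exprM.
rewrite [(n * 2)%N]mulnC => H; apply: le_trans H _.
rewrite exprMn -exprM [(n * 2)%N]mulnC mulrA /eps1 divfK // gt_eqF //.
Qed.

(** Bound $c$ from above by $(k/k')^n$ with $k,k'\equiv1$ modulo $m$, which changes it little by
    [approx_ratio]; then use monotonicity and the two dilations. *)
Lemma Bsum_regular_up (c eps : R) : 0 < c -> 0 < eps -> exists X0 : R, forall X, X0 <= X ->
  Bsum G (c * X) <= c ^+ 2 * Bsum G X + eps * X ^+ 2.
Proof.
move=> c0 eps0; have [C C0 HC] := Bsum_bound; have bG := sub_bounded_denom GO.
have c2 : 0 < c ^+ 2 by rewrite exprn_gt0.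
have [eta [eta0 eta1 eta2]] : exists eta : R, [/\ 0 < eta, eta <= 1 & eta * (3 * c ^+ 2 * (C + 1)) <= eps / 2].
  have q0 : 0 < 3 * c ^+ 2 * (C + 1) by rewrite !mulr_gt0 //; lra.
  exists (Num.min 1 (eps / 2 / (3 * c ^+ 2 * (C + 1)))); split.
  - by rewrite lt_min ltr01 !divr_gt0.
  - by rewrite ge_min lexx.
  - by rewrite -ler_pdivlMr // ge_min lexx orbT.
have etaI : 0 < eta <= 1 by rewrite eta0.
have [k [k' [k1 k'1 h1 h2 Hk]]] : exists k k' : R, [/\ 1 <= k, 1 <= k', c <= (k / k') ^+ n,
    (k / k') ^+ n <= c * (1 + eta) & forall eps1, 0 < eps1 -> exists X0 : R, forall X, X0 <= X ->
    `|Bsum G (k ^+ n * X) - k ^+ (2 * n) * Bsum G X| <= eps1 * X ^+ 2 /\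
    `|Bsum G (k' ^+ n * X) - k' ^+ (2 * n) * Bsum G X| <= eps1 * X ^+ 2].
  have [j [j' /andP[h1 h2]]] := approx_ratio n0 m0 c0 etaI.
  exists (1 + m * j)%:R, (1 + m * j')%:R; split; rewrite ?ler1n // => eps1 eps10.
  have [X1 H1] := Bsum_dilate j eps10; have [X2 H2] := Bsum_dilate j' eps10.
  exists (Num.max X1 X2) => X; rewrite ge_max => /andP[h3 h4].
  split; [exact: H1|exact: H2].
have K0 : 0 < k' ^+ n by rewrite exprn_gt0 //; lra.
have K1 : 1 <= k' ^+ n by rewrite exprn_ege1.
have [rr Err] : exists rr, rr = (k / k') ^+ n by exists ((k / k') ^+ n).
rewrite -Err in h1 h2.
have rr0 : 0 <= rr by lra.
have rp : 0 < 1 + rr ^+ 2 by rewrite ltr_pwDl // exprn_ge0.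
have [eps1 eps10 Eeps] : exists2 eps1, 0 < eps1 & eps1 * (1 + rr ^+ 2) = eps / 2.
  by exists (eps / 2 / (1 + rr ^+ 2)); [rewrite !divr_gt0|rewrite divfK // gt_eqF].
have [X0 {}Hk] := Hk _ eps10.
exists (Num.max 1 (k' ^+ n * X0)) => X; rewrite ge_max => /andP[Xge1 HX].
(* Both dilations start from the same [Y]: $k'^nY=X$ and $k^nY$ is the enlarged multiple of $X$. *)
have [Y EY] : exists Y, k' ^+ n * Y = X by exists (X / k' ^+ n); rewrite mulrCA divff ?mulr1 // gt_eqF.
have : X0 <= Y by rewrite -(ler_pM2l K0) EY.
move=> /Hk[]; have Er : k ^+ n * Y = rr * X.
  by rewrite -EY Err expr_div_n mulrA divfK // gt_eqF.
rewrite EY Er => H1 H2.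
have Y2 : eps1 * Y ^+ 2 <= eps1 * X ^+ 2.
  rewrite ler_wpM2l ?(ltW eps10) // lerXn2r // ?nnegrE.
  - by rewrite -(pmulr_rge0 _ K0) EY; lra.
  - by lra.
  - by rewrite -EY ler_peMl // -(pmulr_rge0 _ K0) EY; lra.
have cX : Bsum G (c * X) <= Bsum G (rr * X).
  by apply: Bsum_mono => //; rewrite ler_wpM2r //; lra.
have BX := HC G X iG GO Xge1; have B0 := Bsum_ge0 G X.
have H3 : Bsum G (rr * X) <= k ^+ (2 * n) * Bsum G Y + eps1 * X ^+ 2.
  by have := le_trans (ler_norm _) H1; lra.
have H4 : k' ^+ (2 * n) * Bsum G Y <= Bsum G X + eps1 * X ^+ 2.
  by move: H2; rewrite distrC => /(le_trans (ler_norm _)); lra.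
have H5 : k ^+ (2 * n) * Bsum G Y <= rr ^+ 2 * (Bsum G X + eps1 * X ^+ 2).
  have -> : k ^+ (2 * n) * Bsum G Y = rr ^+ 2 * (k' ^+ (2 * n) * Bsum G Y).
    have k2 : k' ^+ (2 * n) != 0 by rewrite expf_neq0 // gt_eqF //; lra.
    by rewrite Err -exprM [(n * 2)%N]mulnC expr_div_n mulrA divfK.
  by rewrite ler_wpM2l // exprn_ge0.
have H6 : rr ^+ 2 * Bsum G X <= c ^+ 2 * Bsum G X + eps / 2 * X ^+ 2.
  have h3 : rr ^+ 2 <= c ^+ 2 * (1 + 3 * eta).
    apply: (@le_trans _ _ ((c * (1 + eta)) ^+ 2)).
      by rewrite lerXn2r // ?nnegrE // mulr_ge0 //; lra.
    by rewrite exprMn ler_wpM2l ?(ltW c2) //; nra.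
  have h4 : rr ^+ 2 * Bsum G X <= c ^+ 2 * (1 + 3 * eta) * Bsum G X by rewrite ler_wpM2r.
  have h5 : 3 * eta * c ^+ 2 * Bsum G X <= 3 * eta * c ^+ 2 * (C * X ^+ 2).
    by rewrite ler_wpM2l // !mulr_ge0 //; lra.
  have h6 : 3 * eta * c ^+ 2 * (C * X ^+ 2) <= eps / 2 * X ^+ 2.
    rewrite mulrA ler_wpM2r ?exprn_ge0 //; first by lra.
    have : 0 <= eta * c ^+ 2 by rewrite mulr_ge0 // ltW.
    lra.
  lra.
have H7 : eps1 * X ^+ 2 * (1 + rr ^+ 2) = eps / 2 * X ^+ 2.
  by rewrite mulrAC Eeps.
lra.
Qed.

(** The lower bound is the upper bound for $1/c$, taken at $cX$. *)
Lemma Bsum_regular (c eps : R) : 0 < c -> 0 < eps -> exists X0 : R, forall X, X0 <= X ->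
  `|Bsum G (c * X) - c ^+ 2 * Bsum G X| <= eps * X ^+ 2.
Proof.
move=> c0 eps0; have [X1 H1] := Bsum_regular_up c0 eps0.
have ic : 0 < c^-1 by rewrite invr_gt0.
have e2 : 0 < eps / c ^+ 4 by rewrite divr_gt0 // exprn_gt0.
have [X2 H2] := Bsum_regular_up ic e2.
exists (Num.max X1 (X2 / c)) => X; rewrite ge_max => /andP[/H1 {}H1].
rewrite ler_pdivrMr // mulrC => /H2; rewrite mulKf ?gt_eqF // => {}H2.
rewrite ler_norml; apply/andP; split; last by lra.
have c2 : 0 < c ^+ 2 by rewrite exprn_gt0.
have : c ^+ 2 * Bsum G X <= c ^+ 2 * (c^-1 ^+ 2 * Bsum G (c * X) + eps / c ^+ 4 * (c * X) ^+ 2).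
  by rewrite ler_wpM2l // ltW.
have -> : c ^+ 2 * (c^-1 ^+ 2 * Bsum G (c * X) + eps / c ^+ 4 * (c * X) ^+ 2) = Bsum G (c * X) + eps * X ^+ 2.
  by field; rewrite gt_eqF.
lra.
Qed.

End Periodic.
End Density.

Lemma set_ext (T : Type) (A B : set T) : (forall x, A x <-> B x) -> A = B.
Proof. by move=> H; apply/funext => x; apply/propext. Qed.

Lemma set_anti (T : Type) (A B : set T) : (forall x, A x -> B x) -> (forall x, B x -> A x) -> A = B.
Proof. by move=> H1 H2; apply: set_ext => x; split; [exact: H1|exact: H2]. Qed.

                          

(** * Fractional ideals and their invertibility *)

Section ZSpan.
Variable F : fieldType.
Implicit Types (g : seq F) (x y : F).

Definition zspan g x := exists c : F -> int, x = \sum_(y <- g) (c y)%:~R * y.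

Lemma zspan_sub g g' x : uniq g -> uniq g' -> {subset g <= g'} -> zspan g x -> zspan g' x.
Proof.
move=> ug ug' gg' [c ->]; exists (fun y => if y \in g then c y else 0).
rewrite -(@big_sub_seq _ _ g g') // => [|y _ /negPf->]; last by rewrite mul0r.
by rewrite !big_seq; apply: eq_bigr => y ->.
Qed.

Lemma zspanD g x y : zspan g x -> zspan g y -> zspan g (x + y).
Proof.
move=> [c ->] [c' ->]; exists (fun z => c z + c' z); rewrite -big_split.
by apply: eq_bigr => z _; rewrite rmorphD mulrDl.
Qed.

Lemma zspan_mem g x : uniq g -> x \in g -> zspan g x.
Proof.
move=> ug xg; exists (fun y => (y == x)%:R); rewrite (bigD1_seq x) //= eqxx mul1r big1 ?addr0 //.
by move=> y /negPf->; rewrite mul0r.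
Qed.

Definition fingen (A : set F) := exists g, [/\ uniq g, forall y, y \in g -> A y & forall x, A x -> zspan g x].

Lemma fingen_index A B k : (forall x, B x -> A x) -> has_index A B k -> fingen B -> fingen A.
Proof.
move=> BA [r [rA rP]] [g [ug gB gs]]; exists (undup (codom r ++ g)); split; first exact: undup_uniq.
  move=> y; rewrite mem_undup mem_cat => /orP[/codomP[i ->]//|/gB/BA//].
move=> x /rP[i [Bi _]]; rewrite -[x](subrK (r i)); apply: zspanD.
  apply: (@zspan_sub g) => //; first exact: undup_uniq.
  - by move=> y yg; rewrite mem_undup mem_cat yg orbT.
  - exact: gs.
apply: zspan_mem; first exact: undup_uniq.
by rewrite mem_undup mem_cat codom_f.
Qed.

Lemma fingen_smul c A : c != 0 -> fingen A -> fingen (smul c A).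
Proof.
move=> c0 [g [ug gA gs]]; exists (map ( *%R c) g); split.
- by rewrite map_inj_uniq //; apply: mulfI.
- by move=> _ /mapP[y /gA Ay ->]; exists y.
- move=> _ [x /gs[a Dx] ->]; exists (fun z => a (z / c)); rewrite big_map Dx mulr_sumr.
  by apply: eq_bigr => y _; rewrite [c * y / c]mulrAC divff // mul1r mulrCA.
Qed.

End ZSpan.

Section Ideals.
Variables (F : fieldType) (iota : {rmorphism F -> algC}) (n : nat).
Variables (s : 'I_n -> {rmorphism F -> algC}) (e : 'I_n -> F) (d : nat).
Hypothesis emb : field_embeddings iota s e d.
Local Notation O := (integers iota).
Implicit Types (I J A B : set F) (x y z : F).

(** [frac_ideal] read inside the abstract field, before embedding in [algC]. *)
Record fideal I : Prop := Frac {
  frac0 : I 0;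
  fracD : forall x y, I x -> I y -> I (x + y);
  fracM : forall r x, O r -> I x -> I (r * x);
  frac_neq0 : exists2 x, I x & x != 0;
  frac_denom : exists2 c, O c /\ c != 0 & forall x, I x -> O (c * x) }.

Definition imul I J : set F := fun x => exists2 t : seq (F * F),
  (forall p, p \in t -> I p.1 /\ J p.2) & x = \sum_(p <- t) p.1 * p.2.
Definition iinv I : set F := fun x => forall y, I y -> O (x * y).

Lemma frac_subgrp I : fideal I -> subgrp I.
Proof.
move=> fI; split; first exact: frac0.
move=> x y Ix Iy; apply: (fracD fI) => //; rewrite -mulN1r; apply: (fracM fI) => //.
exact/ON/O1.
Qed.

Lemma fracB I x y : fideal I -> I x -> I y -> I (x - y).
Proof. by move=> /frac_subgrp[_]; apply. Qed.

Lemma frac_O : fideal O.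
Proof.
split; first exact: O0.
- exact: OD.
- exact: OM.
- by exists 1; [exact: O1|exact: oner_neq0].
- by exists 1; [split; [exact: O1|exact: oner_neq0]|move=> x; rewrite mul1r].
Qed.

Lemma imul_mem I J x y : I x -> J y -> imul I J (x * y).
Proof.
move=> Ix Jy; exists [:: (x, y)]; last by rewrite big_seq1.
by move=> p; rewrite inE => /eqP->.
Qed.

Lemma imul0 I J : imul I J 0.
Proof. by exists [::]; rewrite ?big_nil. Qed.

Lemma imulD I J x y : imul I J x -> imul I J y -> imul I J (x + y).
Proof.
move=> [t tP ->] [u uP ->]; exists (t ++ u); last by rewrite big_cat.
by move=> p; rewrite mem_cat => /orP[/tP|/uP].
Qed.

Lemma imul_ind I J (P : F -> Prop) : P 0 -> (forall x y, P x -> P y -> P (x + y)) ->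
  (forall x y, I x -> J y -> P (x * y)) -> forall z, imul I J z -> P z.
Proof.
move=> P0 PD PM z [t tP ->]; rewrite big_seq; apply: big_ind => // p /tP[]; exact: PM.
Qed.

Lemma imul_frac I J : fideal I -> fideal J -> fideal (imul I J).
Proof.
move=> fI fJ; split; first exact: imul0.
- exact: imulD.
- move=> r x Or; elim/imul_ind: x / => [|x y h1 h2|x y Ix Jy].
  + by rewrite mulr0; exact: imul0.
  + by rewrite mulrDr; apply: imulD.
  + by rewrite mulrA; apply: imul_mem => //; apply: fracM.
- have [x Ix x0] := frac_neq0 fI; have [y Jy y0] := frac_neq0 fJ.
  by exists (x * y); [exact: imul_mem|rewrite mulf_neq0].
- have [a [Oa a0] aI] := frac_denom fI; have [b [Ob b0] bJ] := frac_denom fJ.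
  exists (a * b); first by split; [exact: OM|rewrite mulf_neq0].
  move=> x; elim/imul_ind: x / => [|x y h1 h2|x y Ix Jy].
  + by rewrite mulr0; exact: O0.
  + by rewrite mulrDr; apply: OD.
  + by rewrite mulrACA; apply: OM; [exact: aI|exact: bJ].
Qed.

Lemma imul_mono I I' J J' : (forall x, I x -> I' x) -> (forall x, J x -> J' x) ->
  forall x, imul I J x -> imul I' J' x.
Proof. by move=> h1 h2 x [t tP ->]; exists t => // p /tP[/h1 ? /h2]. Qed.

Lemma imulC I J : imul I J = imul J I.
Proof.
by apply: set_anti => x; elim/imul_ind: x / => [|x y h1 h2|x y Ix Jy];
  [exact: imul0|exact: imulD|rewrite mulrC; exact: imul_mem|exact: imul0|exact: imulD|rewrite mulrC; exact: imul_mem].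
Qed.

Lemma imulA I J K : imul I (imul J K) = imul (imul I J) K.
Proof.
apply: set_anti => x; elim/imul_ind: x / => [|x y h1 h2|x y Ix Jy]; try exact: imul0; try exact: imulD.
  elim/imul_ind: y / Jy => [|y z h1 h2|y z Jy Kz]; first by rewrite mulr0; exact: imul0.
    by rewrite mulrDr; apply: imulD.
  by rewrite mulrA; apply: imul_mem => //; apply: imul_mem.
elim/imul_ind: x / Ix => [|x z h1 h2|x z Jx Kz]; first by rewrite mul0r; exact: imul0.
  by rewrite mulrDl; apply: imulD.
by rewrite -mulrA; apply: imul_mem => //; apply: imul_mem.
Qed.

Lemma imul1 I : fideal I -> imul O I = I.
Proof.
move=> fI; apply: set_anti => x; last by move=> Ix; rewrite -[x]mul1r; apply: imul_mem => //; exact: O1.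
elim/imul_ind: x / => [|x y h1 h2|x y Ix Jy]; [exact: frac0|exact: fracD|exact: fracM].
Qed.

Lemma imul_sub I J K : fideal K -> (forall x y, I x -> J y -> K (x * y)) -> forall z, imul I J z -> K z.
Proof. by move=> fK H z; apply: imul_ind => //; [exact: frac0|exact: fracD]. Qed.

Lemma smul_frac c I : c != 0 -> fideal I -> fideal (smul c I).
Proof.
move=> c0 fI; split.
- by exists 0; [exact: frac0|rewrite mulr0].
- by move=> _ _ [x Ix ->] [y Iy ->]; exists (x + y); [exact: fracD|rewrite mulrDr].
- by move=> r _ Or [x Ix ->]; exists (r * x); [exact: fracM|rewrite mulrCA].
- by have [x Ix x0] := frac_neq0 fI; exists (c * x); [exists x|rewrite mulf_neq0].
- have [a [Oa a0] aI] := frac_denom fI; have [k k0 Ok] := O_clear iota c^-1.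
  have kF : k%:R != 0 :> F by rewrite (natF_eq0 iota) -lt0n.
  exists (a * (k%:R * c^-1)); first by split; [exact: OM|rewrite !mulf_neq0 ?invr_eq0].
  move=> _ [x Ix ->]; have -> : a * (k%:R / c) * (c * x) = k%:R * (a * x) by field.
  by apply: OM; [exact: O_nat|exact: aI].
Qed.

Lemma imul_smul c I J : imul (smul c I) J = smul c (imul I J).
Proof.
apply: set_anti => x.
  elim/imul_ind: x / => [|x y|x y [a Ia ->] Jy].
  + by exists 0; [exact: imul0|rewrite mulr0].
  + by move=> [a Ia ->] [b Ib ->]; exists (a + b); [exact: imulD|rewrite mulrDr].
  + by exists (a * y); [exact: imul_mem|rewrite mulrA].
move=> [y + ->]; elim/imul_ind: y / => [|y z h1 h2|y z Iy Jz].
- by rewrite mulr0; exact: imul0.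
- by rewrite mulrDr; apply: imulD.
- by rewrite mulrA; apply: imul_mem => //; exists y.
Qed.

Lemma iinv_frac I : fideal I -> fideal (iinv I).
Proof.
move=> fI; split.
- by move=> y _; rewrite mul0r; exact: O0.
- by move=> x y Ix Iy z Iz; rewrite mulrDl; apply: OD; [exact: Ix|exact: Iy].
- by move=> r x Or Ix y Iy; rewrite -mulrA; apply: OM => //; exact: Ix.
- have [a [Oa a0] aI] := frac_denom fI; by exists a.
- have [x Ix x0] := frac_neq0 fI; have [a [Oa a0] aI] := frac_denom fI.
  exists (a * x); first by split; [exact: aI|rewrite mulf_neq0].
  by move=> y Hy; rewrite mulrAC -mulrA; apply: OM => //; exact: Hy.
Qed.

Lemma iinv_anti I J : (forall x, I x -> J x) -> forall x, iinv J x -> iinv I x.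
Proof. by move=> IJ x Jx y /IJ; apply: Jx. Qed.

Lemma base_fingen : fingen (base_lattice e).
Proof.
exists (undup (codom e)); split; first exact: undup_uniq.
  move=> y; rewrite mem_undup => /codomP[i ->].
  exists (fun j => (j == i)%:R); rewrite (bigD1 i) //= eqxx mul1r big1 ?addr0 //.
  by move=> j /negPf->; rewrite mul0r.
move=> x [c ->]; elim/big_ind: _ => [||i _].
- by exists (fun=> 0); rewrite big1 // => y _; rewrite mul0r.
- exact: zspanD.
- exists (fun y => if y == e i then c i else 0).
  rewrite (bigD1_seq (e i)) ?undup_uniq ?mem_undup ?codom_f //= eqxx big1 ?addr0 //.
  by move=> y /negPf->; rewrite mul0r.
Qed.

Lemma O_fingen : fingen O.
Proof.
have [a ia _] := index_O_A0 emb; exact: fingen_index (A0_O emb) ia base_fingen.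
Qed.

                                                                                                                   
(** Everything is caught between two principal ideals, $xO\subseteq I\subseteq J\subseteq c^{-1}O$,
    whose index is finite by [index_O]. *)
Lemma frac_index I J : fideal I -> fideal J -> (forall x, I x -> J x) -> exists k, has_index J I k.
Proof.
move=> fI fJ IJ; have [x Ix x0] := frac_neq0 fI; have [c [Oc c0] cJ] := frac_denom fJ.
have sO := O_subgrp iota.
have [k ik _] := index_O emb (mulf_neq0 c0 x0) (cJ _ (IJ _ Ix)).
have ik' : has_index (smul c^-1 O) (smul x O) k.
  by have := smul_index (invr_neq0 c0) ik; rewrite smul_mul mulKf.
have [] := @has_index_mid _ (smul c^-1 O) J (smul x O) k (smul_subgrp _ sO) (frac_subgrp fJ) (smul_subgrp _ sO) _ _ ik'.
- by move=> y Jy; exists (c * y); [exact: cJ|rewrite mulKf].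
- by move=> _ [a Oa ->]; apply: IJ; rewrite mulrC; apply: (fracM fI).
move=> l [m [_ im _]].
have [] := @has_index_mid _ J I (smul x O) m (frac_subgrp fJ) (frac_subgrp fI) (smul_subgrp _ sO) IJ _ im.
- by move=> _ [a Oa ->]; rewrite mulrC; apply: (fracM fI).
by move=> p [q [ip _ _]]; exists p.
Qed.

Lemma frac_fingen I : fideal I -> fingen I.
Proof.
move=> fI; have [x Ix x0] := frac_neq0 fI.
have sub y : smul x O y -> I y by move=> [a Oa ->]; rewrite mulrC; apply: (fracM fI).
have [k ik] := frac_index (smul_frac x0 frac_O) fI sub.
exact: fingen_index sub ik (fingen_smul x0 O_fingen).
Qed.

Lemma big_seq_ord (A : nmodType) (g : seq F) (f : F -> A) :
  \sum_(y <- g) f y = \sum_(j < size g) f g`_j.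
Proof. by rewrite (big_nth 0) big_mkord. Qed.

(** On integral generators of [I], multiplication by [x] is an integer matrix with [x] as an
    eigenvalue, so [x] is a root of its characteristic polynomial. *)
Lemma multiplier_integral I x : fideal I -> (forall y, I y -> I (x * y)) -> O x.
Proof.
move=> fI H; have [g [ug gI gs]] := frac_fingen fI; have [y0 Iy y00] := frac_neq0 fI.
pose m := size g.
have cP (i : 'I_m) := cid (gs _ (H _ (gI _ (mem_nth 0 (ltn_ord i))))).
pose M : 'M[int]_m := \matrix_(j, i) sval (cP i) g`_j.
have Mp : (map_poly intr (char_poly M) : {poly algC}) \is monic.
  by apply: monic_map; apply: char_poly_monic.
apply: (@root_monic_Aint (map_poly intr (char_poly M))) => //; last first.
  by apply/polyOverP => i; rewrite coef_map intr_int.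
rewrite map_char_poly -eigenvalue_root_char; apply/eigenvalueP.
exists (\row_j iota g`_j).
  apply/rowP => i; rewrite !mxE -rmorphM.
  have -> : x * g`_i = \sum_(y <- g) (sval (cP i) y)%:~R * y by case: (cP i).
  rewrite big_seq_ord rmorph_sum; apply: eq_bigr => j _.
  by rewrite !mxE rmorphM rmorph_int mulrC.
apply/eqP => /rowP g0; have [c Dy] := gs _ Iy; move/eqP: y00; apply.
rewrite Dy big_seq_ord big1 // => j _.
by have := g0 j; rewrite !mxE => /eqP; rewrite fmorph_eq0 => /eqP ->; rewrite mulr0.
Qed.

(** Generators of [I] are combinations of themselves with coefficients in [B], so identity minus
    coefficient matrix kills a nonzero vector and has determinant 0. That determinant is congruent
    to 1 modulo [B]. *)
Lemma nakayama B I : fideal B -> (forall x, B x -> O x) -> fideal I ->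
  (forall x, I x -> imul B I x) -> B 1.
Proof.
move=> fB BO fI IBI; have [g [ug gI gs]] := frac_fingen fI; have [y0 Iy y00] := frac_neq0 fI.
pose m := size g.
have key z : imul B I z -> exists2 b : F -> F, (forall y, B (b y)) & z = \sum_(y <- g) b y * y.
  elim/imul_ind: z / => [|x y|x y Bx /gs[c ->]].
  - by exists (fun=> 0); [move=> _; exact: frac0|rewrite big1 // => y _; rewrite mul0r].
  - move=> [b Bb ->] [b' Bb' ->]; exists (fun z => b z + b' z); first by move=> z; apply: fracD.
    by rewrite -big_split; apply: eq_bigr => z _; rewrite mulrDl.
  - exists (fun z => (c z)%:~R * x); first by move=> z; apply: (fracM fB) => //; exact: O_int.
    by rewrite mulr_sumr; apply: eq_bigr => z _; rewrite mulrCA mulrA.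
have bP (i : 'I_m) := cid2 (key _ (IBI _ (gI _ (mem_nth 0 (ltn_ord i))))).
pose b i := s2val (bP i).
have bB i y : B (b i y) by rewrite /b; case: (bP i).
have bE (i : 'I_m) : g`_i = \sum_(j < m) b i g`_j * g`_j.
  by rewrite /b; case: (bP i) => c /= _ {1}->; rewrite big_seq_ord.
pose N : 'M[F]_m := \matrix_(i, j) ((i == j)%:R - b i g`_j).
have N0 : \det N = 0.
  apply/eqP; apply: contraT => dN.
  have uN : N \in unitmx by rewrite unitmxE unitfE.
  have : N *m (\col_j g`_j) = 0.
    apply/colP => i; rewrite !mxE; under eq_bigr do rewrite !mxE mulrBl.
    rewrite sumrB -bE (bigD1 i) //= eqxx mul1r big1 ?addr0 ?subrr // => j.
    by rewrite eq_sym => /negPf->; rewrite mul0r.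
  move=> /(congr1 (mulmx (invmx N))); rewrite mulKmx // mulmx0 => /colP g0.
  have [c Dy] := gs _ Iy; case/eqP: y00.
  by rewrite Dy big_seq_ord big1 // => j _; have := g0 j; rewrite !mxE => ->; rewrite mulr0.
(* Congruence modulo [B] restricted to integers, hence compatible with products; it passes through
   the expansion of the determinant. *)
pose Rm x y := [/\ O x, O y & B (x - y)].
have RM x y x' y' : Rm x x' -> Rm y y' -> Rm (x * y) (x' * y').
  move=> [Ox Ox' Bx] [Oy Oy' By]; split; try exact: OM.
  have -> : x * y - x' * y' = y * (x - x') + x' * (y - y') by ring.
  by apply: fracD => //; apply: fracM.
have RD x y x' y' : Rm x x' -> Rm y y' -> Rm (x + y) (x' + y').
  move=> [Ox Ox' Bx] [Oy Oy' By]; split; try exact: OD.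
  by rewrite opprD addrACA; apply: fracD.
have RO x : O x -> Rm x x by move=> Ox; split=> //; rewrite subrr; exact: frac0.
have [_ _] : Rm (\det N) (\det (1%:M : 'M[F]_m)).
  rewrite /determinant; apply: big_ind2 => [|x x' y y'|t _]; first exact/RO/O0.
    by move=> h1 h2; apply: RD.
  apply: (RM); first by apply: RO; rewrite -(rmorph_sign intr); exact: O_int.
  apply: big_ind2 => [|x x' y y'|i _]; first exact/RO/O1.
    by move=> h1 h2; apply: RM.
  rewrite !mxE; set bb := (_ == _); have Od : O bb%:R by exact: O_nat.
  split=> //; first by apply: OB => //; exact/BO.
  by rewrite addrAC subrr sub0r; apply: (subgrpN (frac_subgrp fB)).
by rewrite N0 det1 sub0r => /(subgrpN (frac_subgrp fB)); rewrite opprK.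
Qed.

Section ClassGroup.
Variables (h : nat) (rep : 'I_h -> set F).
Hypothesis rep_cover : forall I, fideal I -> exists i, exists2 x, x != 0 & rep i = smul x I.

Fixpoint ipow I k := if k is k'.+1 then imul I (ipow I k') else O.

Lemma ipow_frac I k : fideal I -> fideal (ipow I k).
Proof. by move=> fI; elim: k => [|k IH]; [exact: frac_O|exact: imul_frac]. Qed.

Lemma ipowD I k l : fideal I -> ipow I (k + l) = imul (ipow I k) (ipow I l).
Proof.
move=> fI; elim: k => [|k IH]; first by rewrite imul1 //; apply: ipow_frac.
by rewrite addSn /= IH imulA.
Qed.

                                                                                               
                                            
(** Two powers of $I$ lie in the same class, which yields $J=cI^l$ with $(IJ)I^k=I^k$. Multipliers
    of $I^k$ are integral, so $IJ\subseteq O$, and [nakayama] puts 1 in $IJ$; then $J\subseteq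
    I^{-1}$. *)
Lemma imulV I : fideal I -> imul I (iinv I) = O.
Proof.
move=> fI; have cl k := cid (rep_cover (ipow_frac k fI)).
have [k [l [c c0 E]]] : exists k l, exists2 c, c != 0 & ipow I k = smul c (ipow I (l.+1 + k)).
  have [k [l [kl E]]] : exists k l : 'I_h.+1, (k < l)%N /\ sval (cl k) = sval (cl l).
    apply: contrapT => H; suff : (#|'I_h.+1| <= #|'I_h|)%N by rewrite !card_ord ltnn.
    apply: (@leq_card _ _ (fun k : 'I_h.+1 => sval (cl k))) => k l E.
    apply/val_inj; case: (ltngtP k l) => // kl; case: H; first by exists k, l.
    by exists l, k.
  have cP k1 : exists2 x, x != 0 & rep (sval (cl k1)) = smul x (ipow I k1) by case: (cl k1).
  have [x x0 Ex] := cP k; have [y y0 Ey] := cP l.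
  exists k, (l - k.+1)%N, (x^-1 * y); first by rewrite mulf_neq0 ?invr_eq0.
  have -> : ((l - k.+1).+1 + k = l)%N by lia.
  by rewrite -smul_mul -Ey -E Ex smul_mul mulVf // smul1.
pose J := smul c (ipow I l).
have fJ : fideal J by apply/smul_frac => //; apply: ipow_frac.
have EB : imul (imul I J) (ipow I k) = ipow I k.
  by rewrite [RHS]E ipowD // [imul I J]imulC imul_smul imul_smul [imul (ipow I l) I]imulC.
have BO x : imul I J x -> O x.
  move=> Bx; apply: (@multiplier_integral (ipow I k)); first exact: ipow_frac.
  by move=> y Iy; rewrite -EB; apply: imul_mem.
have B1 : imul I J 1.
  apply: (@nakayama _ (ipow I k)) => //; [exact: imul_frac|exact: ipow_frac|by rewrite EB].
apply: set_anti => x.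
  by elim/imul_ind: x / => [|x y h1 h2|x y Ix Hy]; [exact: O0|exact: OD|rewrite mulrC; exact: Hy].
move=> Ox; rewrite -[x]mulr1; apply: (fracM (imul_frac fI (iinv_frac fI))) => //.
apply: imul_mono B1 => // y Jy z Iz; apply: BO; rewrite mulrC; exact: imul_mem.
Qed.

Lemma imulVr I : fideal I -> imul (iinv I) I = O.
Proof. by move=> fI; rewrite imulC imulV. Qed.

Lemma imul_cancel I A B : fideal I -> fideal A -> fideal B ->
  (forall x, imul I A x -> imul I B x) -> forall x, A x -> B x.
Proof.
move=> fI fA fB H x Ax.
suff : imul (iinv I) (imul I B) x by rewrite imulA imulVr // imul1.
have : imul (iinv I) (imul I A) x by rewrite imulA imulVr // imul1.
exact: imul_mono.
Qed.

Lemma imul_inj I A B : fideal I -> fideal A -> fideal B -> imul I A = imul I B -> A = B.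
Proof.
move=> fI fA fB E; apply: set_anti; apply: (imul_cancel fI) => //; by rewrite E.
Qed.

Lemma iinv_unique I J : fideal I -> fideal J -> imul I J = O -> J = iinv I.
Proof.
by move=> fI fJ E; apply: (imul_inj fI) => //; [exact: iinv_frac|rewrite E imulV].
Qed.

Lemma iinvK I : fideal I -> iinv (iinv I) = I.
Proof.
move=> fI; apply/esym/iinv_unique => //; [exact: iinv_frac|exact: imulVr].
Qed.

Lemma iinvM I J : fideal I -> fideal J -> iinv (imul I J) = imul (iinv I) (iinv J).
Proof.
move=> fI fJ; have fI' := iinv_frac fI; have fJ' := iinv_frac fJ.
apply/esym/iinv_unique; [exact: imul_frac|exact: imul_frac|].
rewrite -imulA [imul J _]imulC -[imul (imul (iinv I) _) J]imulA imulVr //.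
by rewrite [imul (iinv I) O]imulC imul1 // imulV.
Qed.

Lemma iinv_sub I J : fideal I -> fideal J -> (forall x, iinv J x -> iinv I x) -> forall x, I x -> J x.
Proof. by move=> fI fJ H x; rewrite -(iinvK fI) -(iinvK fJ); apply: iinv_anti. Qed.

Lemma iinvO : iinv O = O.
Proof. by apply/esym/iinv_unique; [exact: frac_O|exact: frac_O|rewrite imul1 //; exact: frac_O]. Qed.

End ClassGroup.
End Ideals.

(** * Norms of ideals, the number of ideals, and the tail estimate *)

Definition ixn (T : zmodType) (A B : set T) : nat :=
  if pselect (exists k, has_index A B k) is left H then sval (cid H) else 0%N.

Lemma ixn_exists (T : zmodType) (A B : set T) : (exists k, has_index A B k) -> has_index A B (ixn A B).
Proof. by move=> H; rewrite /ixn; case: pselect => // H'; case: cid. Qed.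

Lemma ixn_eq (T : zmodType) (A B : set T) k : subgrp B -> has_index A B k -> ixn A B = k.
Proof.
move=> sB ik; have H : has_index A B (ixn A B) by apply: ixn_exists; exists k.
exact: has_index_uniq H ik.
Qed.

(** Partial summation of $1/k^2$ beyond [z] against a counting function that is at most linear. *)
Lemma sum_inv_sqr (ks : seq nat) (C z : nat) : (0 < z)%N -> (forall k, k \in ks -> (z < k)%N) ->
  (forall j, (0 < j)%N -> (count (fun k => k <= j)%N ks <= C * j)%N) ->
  \sum_(k <- ks) (k%:R ^+ 2)^-1 <= (2 * C)%:R / z%:R :> algR.
Proof.
move=> z0 ksz cnt; pose S N : algR := \sum_(k <- ks | (k <= N)%N) (k%:R ^+ 2)^-1.
pose c N : algR := (count (fun k => k <= N)%N ks)%:R.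
pose C' : algR := C%:R.
have C0 : 0 <= C' by exact: ler0n.
(* The boundary term of the partial summation is carried along; the induction step is then
   $x(x^{-2}-(x+1)^{-2})\le2(x^{-1}-(x+1)^{-1})$. *)
have main N : (z <= N)%N ->
    S N - c N / (N.+1%:R) ^+ 2 <= 2 * C' * (z.+1%:R^-1 - N.+1%:R^-1).
  elim: N => [|N IH]; first by rewrite leqn0 (gtn_eqF z0).
  rewrite leq_eqVlt => /orP[/eqP <-|zN].
    have c0 : c z = 0.
      by rewrite /c (@eq_in_count _ _ pred0) ?count_pred0 // => k /ksz; case: leqP.
    have S0 : S z = 0.
      by rewrite /S big_seq_cond big1 // => k /andP[/ksz]; case: leqP.
    by rewrite c0 S0 mul0r !subrr mulr0.
  have {}IH := IH zN.
  pose D : algR := (count (pred1 N.+1) ks)%:R.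
  have cE : c N.+1 = c N + D.
    rewrite /c /D -natrD; congr _%:R; elim: (ks) => //= k t ->.
    by rewrite leq_eqVlt ltnS; case: (ltngtP k N.+1) => h; lia.
  have SE : S N.+1 = S N + D / N.+1%:R ^+ 2.
    rewrite /S /D; elim: (ks) => [|k t IHt]; first by rewrite !big_nil mul0r addr0.
    rewrite !big_cons /= leq_eqVlt ltnS; case: (ltngtP k N.+1) => h.
    - by rewrite -ltnS h orbT IHt addrA.
    - by rewrite leqNgt (ltnW h).
    - by rewrite h ltnn orbF IHt natrD mulrDl mul1r addrCA.
  have cN : c N.+1 <= C' * N.+1%:R by rewrite /c /C' -natrM ler_nat cnt.
  have x1 : 1 <= N.+1%:R :> algR by rewrite ler1n.
  have Ex : N.+2%:R = N.+1%:R + 1 :> algR by rewrite -natr1.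
  rewrite SE Ex; move: (N.+1%:R) x1 IH cN => x x1 IH cN.
  have x0 : 0 < x by lra. have x10 : 0 < x + 1 by lra.
  have P0 : 0 <= (x ^+ 2)^-1 - ((x + 1) ^+ 2)^-1.
    by rewrite subr_ge0 lef_pV2 ?posrE ?exprn_gt0 // lerXn2r // ?nnegrE; lra.
  have H1 : c N.+1 * ((x ^+ 2)^-1 - ((x + 1) ^+ 2)^-1) <= C' * x * ((x ^+ 2)^-1 - ((x + 1) ^+ 2)^-1).
    by rewrite ler_wpM2r.
  have H2 : C' * x * ((x ^+ 2)^-1 - ((x + 1) ^+ 2)^-1) <= 2 * C' * (x^-1 - (x + 1)^-1).
    rewrite -subr_ge0.
    have -> : 2 * C' * (x^-1 - (x + 1)^-1) - C' * x * ((x ^+ 2)^-1 - ((x + 1) ^+ 2)^-1) =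
        C' / (x * (x + 1) ^+ 2).
      by field; rewrite !gt_eqF.
    by rewrite divr_ge0 // mulr_ge0 ?exprn_ge0; lra.
  have H3 : (S N + D / x ^+ 2) - c N.+1 / (x + 1) ^+ 2 =
     (S N - c N / x ^+ 2) + c N.+1 * ((x ^+ 2)^-1 - ((x + 1) ^+ 2)^-1).
    by rewrite cE; field; rewrite !gt_eqF.
  rewrite H3; move: IH H1 H2.
  move: (c N.+1 * _) (S N - _) (C' * x * _) (x^-1) ((x + 1)^-1) (z.+1%:R^-1) => a1 a2 a3 a4 a5 a6 H4 H5 H6.
  have := lerD H4 (le_trans H5 H6); rewrite -mulrDr addrA subrK //.
pose N := (z + \max_(k <- ks) k)%N.
have kN k : k \in ks -> (k <= N)%N.
  by move=> kk; apply: leq_trans (leq_addl _ _); rewrite (big_rem k) //= leq_maxl.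
have -> : \sum_(k <- ks) (k%:R ^+ 2)^-1 = S N.
  by rewrite /S big_seq [in RHS]big_seq_cond; apply: eq_bigl => k; case kk: (k \in ks) => //=; rewrite kN.
have := main N (leq_addr _ _) => H.
have cN : c N / N.+1%:R ^+ 2 <= C' * N.+1%:R^-1.
  have x0 : 0 < N.+1%:R :> algR by rewrite ltr0n.
  rewrite ler_pdivrMr ?exprn_gt0 //.
  have -> : C' / N.+1%:R * N.+1%:R ^+ 2 = C' * N.+1%:R by rewrite expr2 mulrA divfK // gt_eqF.
  rewrite /C' -natrM ler_nat; apply: leq_trans (cnt N _) _; first by rewrite addn_gt0 z0.
  by rewrite leq_mul2l leqnSn orbT.
have i1 : 0 <= N.+1%:R^-1 :> algR by rewrite invr_ge0 ler0n.
have i2 : z.+1%:R^-1 <= z%:R^-1 :> algR by rewrite lef_pV2 ?posrE ?ltr0n // ler_nat.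
have -> : (2 * C)%:R / z%:R = 2 * C' * z%:R^-1 :> algR by rewrite natrM.
move: H cN; move: (S N) (c N / _) (N.+1%:R^-1) (z.+1%:R^-1) (z%:R^-1) i1 i2 => a1 a2 a3 a4 a5 i1 i2.
rewrite mulrBr => H cN.
have : 2 * C' * a4 <= 2 * C' * a5 by rewrite ler_wpM2l //; lra.
have : 0 <= C' * a3 by rewrite mulr_ge0.
lra.
Qed.

Section Norms.
Variables (F : fieldType) (iota : {rmorphism F -> algC}) (n : nat).
Variables (s : 'I_n -> {rmorphism F -> algC}) (e : 'I_n -> F) (d : nat).
Hypothesis emb : field_embeddings iota s e d.
Variables (h : nat) (rep : 'I_h -> set F).
Hypothesis rep_frac : forall i, fideal iota (rep i).
Hypothesis rep_cover : forall I, fideal iota I -> exists i, exists2 x, x != 0 & rep i = smul x I.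
Local Notation O := (integers iota).
Local Notation R := algR.
Local Notation Nm := (Nm s).
Local Notation fideal := (fideal iota).
Local Notation iinv := (iinv iota).
Implicit Types (I J A B P Q : set F) (x y z : F).

Let fO := frac_O iota.
Local Notation frac0 := (@frac0 F iota _).
Local Notation fracD := (@fracD F iota _).
Local Notation fracM := (@fracM F iota _).
Local Notation fracB := (@fracB F iota _ _ _).
Local Notation frac_subgrp := (@frac_subgrp F iota _).
Local Notation imul1 := (@imul1 F iota _).
Local Notation imul_sub := (@imul_sub F iota _ _ _).
Let imulV := imulV emb rep_cover.
Let imulVr := imulVr emb rep_cover.

Lemma ixnP I J : fideal I -> fideal J -> (forall x, I x -> J x) -> has_index J I (ixn J I).
Proof. by move=> fI fJ IJ; apply: ixn_exists; exact: (frac_index emb). Qed.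

Lemma ixn_gt0 I J : fideal I -> fideal J -> (forall x, I x -> J x) -> (0 < ixn J I)%N.
Proof. by move=> fI fJ IJ; apply: has_index_gt0 (ixnP fI fJ IJ); exact: (frac0 fJ). Qed.

Lemma ixn_mul I J K : fideal I -> fideal J -> fideal K -> (forall x, I x -> J x) -> (forall x, J x -> K x) ->
  ixn K I = (ixn K J * ixn J I)%N.
Proof.
move=> fI fJ fK IJ JK; apply: ixn_eq; first exact: frac_subgrp fI.
by apply: (@has_index_mul _ K J I); try exact: frac_subgrp; try exact: ixnP.
Qed.

Lemma ixn_principal x : x != 0 -> O x -> (ixn O (smul x O))%:R = Nm x.
Proof.
move=> x0 Ox; have [k ik <-] := index_O emb x0 Ox.
by rewrite (ixn_eq _ ik) //; apply/smul_subgrp/O_subgrp.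
Qed.

Definition is_max P := [/\ fideal P, forall x, P x -> O x, ~ P 1 &
  forall Q, fideal Q -> (forall x, Q x -> O x) -> ~ Q 1 -> (forall x, P x -> Q x) -> forall x, Q x -> P x].

Lemma exists_max I : fideal I -> (forall x, I x -> O x) -> ~ I 1 ->
  exists2 P, is_max P & forall x, I x -> P x.
Proof.
move: {2}(ixn O I) (leqnn (ixn O I)) => k; elim: k I => [|k IH] I le fI IO I1.
  by move: (ixn_gt0 fI fO IO); rewrite ltnNge le.
have [mI|] := pselect (is_max I); first by exists I.
move=> nmax.
have [Q [fQ QO Q1 IQ QI]] : exists Q, [/\ fideal Q, forall x, Q x -> O x, ~ Q 1,
    forall x, I x -> Q x & ~ forall x, Q x -> I x].
  apply: contrapT => H; apply: nmax; split=> // Q fQ QO Q1 IQ; apply: contrapT => QI.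
  by apply: H; exists Q.
have [|P mP QP] := IH Q _ fQ QO Q1; last by exists P => // x /IQ /QP.
have E := ixn_mul fI fQ fO IQ QO.
have l1 : (1 < ixn Q I)%N.
  rewrite ltn_neqAle (ixn_gt0 fI fQ IQ) andbT; apply/eqP => E1; apply: QI.
  have H := ixnP fI fQ IQ; rewrite -E1 in H; exact: has_index1 (frac_subgrp fI) IQ H.
rewrite -ltnS; apply: leq_trans le; rewrite E -{1}[ixn O Q]muln1 ltn_mul2l l1 andbT.
exact: ixn_gt0.
Qed.

(** The ideal sum, by which comaximality and greatest common divisors are expressed. *)
Definition isum I J : set F := fun z => exists x y, [/\ I x, J y & z = x + y].

Lemma isum_frac I J : fideal I -> fideal J -> fideal (isum I J).
Proof.
move=> fI fJ; split.
- by exists 0, 0; split; [exact: frac0|exact: frac0|rewrite addr0].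
- move=> _ _ [x [y [Ix Jy ->]]] [x' [y' [Ix' Jy' ->]]]; exists (x + x'), (y + y').
  by split; [exact: fracD|exact: fracD|rewrite addrACA].
- move=> r _ Or [x [y [Ix Jy ->]]]; exists (r * x), (r * y).
  by split; [exact: fracM|exact: fracM|rewrite mulrDr].
- have [x Ix x0] := frac_neq0 fI; exists x => //; exists x, 0.
  by split=> //; [exact: frac0|rewrite addr0].
- have [a [Oa a0] aI] := frac_denom fI; have [b [Ob b0] bJ] := frac_denom fJ.
  exists (a * b); first by split; [exact: OM|rewrite mulf_neq0].
  move=> _ [x [y [Ix Jy ->]]]; rewrite mulrDr; apply: OD.
    by rewrite mulrAC; apply: OM => //; exact: aI.
  by rewrite -mulrA; apply: OM => //; exact: bJ.
Qed.

Lemma smulO_frac x : x != 0 -> fideal (smul x O).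
Proof. by move=> x0; apply: smul_frac => //; exact: fO. Qed.

Lemma max_comaximal P a : is_max P -> O a -> ~ P a -> exists2 r, O r & P (1 - a * r).
Proof.
move=> [fP PO P1 Pm] Oa nPa; have a0 : a != 0 by apply/eqP => a0; apply: nPa; rewrite a0; exact: frac0.
have fQ := isum_frac fP (smulO_frac a0); set Q := isum P _ in fQ.
have PQ x : P x -> Q x by move=> Px; exists x, 0; rewrite addr0; split=> //; exact: frac0 (smulO_frac a0).
have [[p [_ [Pp [r Or ->] E]]]|nQ1] := pselect (Q 1); first by exists r; rewrite // E addrK.
case: nPa; apply: (Pm Q) => //.
  by move=> _ [p [_ [Pp [r Or ->] ->]]]; apply: OD; [exact: PO|exact: OM].
by exists 0, a; rewrite add0r; split=> //; [exact: frac0|exists 1; rewrite ?mulr1 //; exact: O1].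
Qed.

Lemma max_prime P a b : is_max P -> O a -> O b -> P (a * b) -> P a \/ P b.
Proof.
move=> mP Oa Ob Pab; have [|nPa] := pselect (P a); [by left|right].
have [r Or H] := max_comaximal mP Oa nPa; have [fP _ _ _] := mP.
have -> : b = b * (1 - a * r) + r * (a * b) by ring.
by apply: (fracD fP); apply: (fracM fP).
Qed.

Lemma max_mul_proper P J : is_max P -> fideal J -> exists2 y, J y & ~ imul P J y.
Proof.
move=> [fP PO P1 _] fJ; apply: contrapT => H; apply: P1.
apply: (imul_cancel emb rep_cover fJ fO fP) (O1 iota) => x.
rewrite [imul J O]imulC imul1 // imulC => Jx; apply: contrapT => nP; apply: H; by exists x.
Qed.

Lemma max_mul_out P J a y : is_max P -> fideal J -> O a -> ~ P a -> J y -> ~ imul P J y -> ~ imul P J (a * y).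
Proof.
move=> mP fJ Oa nPa Jy nP H; apply: nP; have [r Or Hr] := max_comaximal mP Oa nPa.
have [fP _ _ _] := mP; have fPJ := imul_frac fP fJ.
have -> : y = (1 - a * r) * y + r * (a * y) by ring.
by apply: (fracD fPJ); [exact: imul_mem|exact: fracM].
Qed.

(** If the [x] found for the earlier ideals lies in $PJ$, add $ay$ with $a$ in the other maximal
    ideals but not in $P$, and $y\in J$ outside $PJ$: this leaves $PJ$ and changes nothing modulo
    the other $QJ$. *)
Lemma avoid_max (Ps : seq (set F)) J : fideal J ->
  exists2 x, J x & forall P, P \in Ps -> is_max P -> ~ imul P J x.
Proof.
move=> fJ; elim: Ps => [|P Ps [x Jx xP]]; first by exists 0 => //; exact: frac0.
have [mP|nmP] := pselect (is_max P); last first.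
  by exists x => // Q; rewrite inE => /orP[/eqP->//|/xP].
have [xPJ|nx] := pselect (imul P J x); last first.
  by exists x => // Q; rewrite inE => /orP[/eqP->//|/xP].
have [a Oa [aP aQ]] : exists2 a, O a & ~ P a /\ forall Q, Q \in Ps -> is_max Q -> Q a.
  have : forall Q, Q \in Ps -> is_max Q -> exists2 q, Q q & ~ P q.
    move=> Q QPs mQ; apply: contrapT => H; apply: (xP Q QPs mQ).
    suff -> : Q = P by [].
    have [fP PO P1 _] := mP; have [fQ QO Q1 Qm] := mQ.
    apply: set_anti => y; first by move=> Qy; apply: contrapT => nPy; apply: H; exists y.
    by apply: Qm => // z Qz; apply: contrapT => nPz; apply: H; exists z.
  elim: (Ps) => [|Q Qs IH] H; first by exists 1; [exact: O1|split=> //; case: mP].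
  have [|a Oa [aP aQ]] := IH; first by move=> Q' Q's; apply: H; rewrite inE Q's orbT.
  have [mQ|nmQ] := pselect (is_max Q); last first.
    by exists a => //; split=> // Q'; rewrite inE => /orP[/eqP->//|/aQ].
  have [q Qq nPq] := H Q (mem_head _ _) mQ; have [fQ QO _ _] := mQ.
  exists (a * q); first by apply: OM => //; exact: QO.
  split; first by move=> /(max_prime mP Oa (QO _ Qq))[].
  move=> Q'; rewrite inE => /orP[/eqP-> _|Q's mQ']; first exact: fracM.
  by rewrite mulrC; have [fQ' _ _ _] := mQ'; apply: (fracM fQ'); [exact: QO|exact: aQ].
have [y Jy ny] := max_mul_proper mP fJ; have [fP _ _ _] := mP.
have fPJ := imul_frac fP fJ.
exists (x + a * y); first by apply: (fracD fJ) => //; apply: (fracM fJ).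
move=> Q; rewrite inE => /orP[/eqP-> _ H|QPs mQ H].
  apply: (max_mul_out mP fJ Oa aP Jy ny); rewrite -[a * y](addKr x) addrC.
  exact: (fracB fPJ).
apply: (xP Q QPs mQ); rewrite -[x](addrK (a * y)); have [fQ _ _ _] := mQ.
by apply: (fracB (imul_frac fQ fJ)) => //; apply: imul_mem => //; apply: aQ.
Qed.

                                                                                                                
(** The claim is $J=xO+NJ$. Take $x$ outside $PJ$ for every maximal $P\supseteq N$. If
    $(xO+NJ)J^{-1}$ were proper, it would lie in a maximal ideal; that ideal would contain $N$, and
    $x$ would be in its product with $J$. *)
Lemma coprime_generator N J : fideal N -> (forall x, N x -> O x) -> fideal J ->
  exists2 x, J x & forall y, J y -> exists2 r, O r & imul N J (y - x * r).
Proof.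
move=> fN NO fJ; have [r [rO rP]] := ixnP fN fO NO; set k := ixn O N in r rO rP.
(* A maximal ideal containing [N] is a union of cosets of [N], so it occurs among these finitely
   many sets. *)
pose PS (S : {set 'I_k}) : set F := fun x => exists2 i, i \in S & N (x - r i).
have [x Jx xP] := avoid_max (map PS (enum {: {set 'I_k}})) fJ.
exists x => // y Jy.
(* The choice of [x] allows 0 only if no maximal ideal contains [N], that is, if [N] is
   everything. *)
have [x0|x0] := eqVneq x 0.
  have N1 : N 1.
    apply: contrapT => N1; have [P mP NP] := exists_max fN NO N1.
    apply: (xP P) => //; last by rewrite x0; exact: imul0.
    apply/mapP; exists [set i | `[< P (r i) >]]%SET; first by rewrite mem_enum.
    have [fP PO _ _] := mP; apply: set_anti => z.
      move=> Pz; have [i [Ni _]] := rP z (PO z Pz); exists i => //; rewrite inE; apply/asboolP.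
      by rewrite -[r i](subKr z); apply: (fracB fP) => //; apply: NP.
    move=> [i]; rewrite inE => /asboolP Pi Ni; rewrite -[z](subrK (r i)).
    by apply: (fracD fP) => //; apply: NP.
  by exists 0; [exact: O0|rewrite mulr0 subr0 -[y]mul1r; apply: imul_mem].
have fNJ := imul_frac fN fJ; have fJ' := iinv_frac fJ.
have fG := isum_frac (smulO_frac x0) fNJ; set G := isum _ _ in fG.
have GJ z : G z -> J z.
  move=> [_ [w [[a Oa ->] NJw ->]]]; apply: (fracD fJ); first by rewrite mulrC; apply: (fracM fJ).
  by apply: imul_sub NJw => // a' b' Na Jb; apply: (fracM fJ) => //; exact: NO.
have fg := imul_frac fG fJ'.
have gJ : imul (imul G (iinv J)) J = G.
  by rewrite -imulA imulVr // imulC imul1.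
suff g1 : imul G (iinv J) 1.
  have : G y by rewrite -gJ -[y]mul1r; apply: imul_mem.
  by move=> [_ [w [[a Oa ->] NJw ->]]]; exists a => //; rewrite addrAC subrr add0r.
apply: contrapT => g1.
have gO z : imul G (iinv J) z -> O z.
  by apply: imul_sub => // a b /GJ Ja Hb; rewrite mulrC; exact: Hb.
have [P mP gP] := exists_max fg gO g1; have [fP PO _ _] := mP.
have NP z : N z -> P z.
  move=> Nz; apply: gP; have : imul (imul N J) (iinv J) z by rewrite -imulA imulV // imulC imul1.
  by apply: imul_mono => // w NJw; exists 0, w; rewrite add0r; split=> //; exact: frac0 (smulO_frac x0).
apply: (xP P) => //.
  apply/mapP; exists [set i | `[< P (r i) >]]%SET; first by rewrite mem_enum.
  apply: set_anti => z.
    move=> Pz; have [i [Ni _]] := rP z (PO z Pz); exists i => //; rewrite inE; apply/asboolP.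
    by rewrite -[r i](subKr z); apply: (fracB fP) => //; apply: NP.
  move=> [i]; rewrite inE => /asboolP Pi Ni; rewrite -[z](subrK (r i)).
  by apply: (fracD fP) => //; apply: NP.
have : imul (imul G (iinv J)) J x.
  rewrite gJ; exists x, 0; rewrite addr0; split=> //; last exact: frac0.
  by exists 1; rewrite ?mulr1 //; exact: O1.
exact: imul_mono.
Qed.

(** Multiplication by the generator [x] of [coprime_generator] identifies $O/N$ with $J/NJ$. *)
Lemma index_imul N J : fideal N -> (forall x, N x -> O x) -> fideal J -> ixn J (imul N J) = ixn O N.
Proof.
move=> fN NO fJ; have [x Jx xP] := coprime_generator fN NO fJ.
have fNJ := imul_frac fN fJ.
have [r [rO rP]] := ixnP fN fO NO; apply: ixn_eq; first exact: frac_subgrp fNJ.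
exists (fun i => x * r i); split=> [i|y Jy]; first by rewrite mulrC; apply: (fracM fJ).
have key t : O t -> imul N J (x * t) -> N t.
  move=> Ot H; have : imul (imul N J) (iinv J) t; last by rewrite -imulA imulV // imulC imul1.
  have : imul (smul t J) (iinv J) t.
    by rewrite imul_smul imulV //; exists 1; [exact: O1|rewrite mulr1].
  apply: imul_mono => // _ [y' /xP[a Oa Ha] ->].
  have -> : t * y' = t * (y' - x * a) + a * (x * t) by ring.
  by apply: (fracD fNJ); apply: (fracM fNJ).
have [a Oa Ha] := xP y Jy; have [i [Ni Ui]] := rP a Oa; exists i; split.
  have -> : y - x * r i = (y - x * a) + (a - r i) * x by ring.
  by apply: (fracD fNJ) => //; apply: imul_mem.
move=> j Hj; apply: Ui; apply: key; first exact: OB.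
have -> : x * (a - r j) = (y - x * r j) - (y - x * a) by ring.
exact: (fracB fNJ).
Qed.

Lemma norm_imul N J : fideal N -> (forall x, N x -> O x) -> fideal J -> (forall x, J x -> O x) ->
  ixn O (imul N J) = (ixn O N * ixn O J)%N.
Proof.
move=> fN NO fJ JO; have fNJ := imul_frac fN fJ.
have NJJ x : imul N J x -> J x.
  by apply: imul_sub => // a b Na Jb; apply: (fracM fJ) => //; exact: NO.
by rewrite (ixn_mul fNJ fJ fO NJJ JO) index_imul // mulnC.
Qed.

Lemma norm_mem I : fideal I -> (forall x, I x -> O x) -> I (ixn O I)%:R.
Proof.
by move=> fI IO; apply: has_index_kill (O_subgrp iota) (frac_subgrp fI) (ixnP fI fO IO) (O1 iota).
Qed.

Lemma smul_imulO x I : fideal I -> smul x I = imul (smul x O) I.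
Proof. by move=> fI; rewrite imul_smul imul1. Qed.

Lemma norm_smul x I : x != 0 -> O x -> fideal I -> (forall y, I y -> O y) ->
  (ixn O (smul x I))%:R = Nm x * (ixn O I)%:R.
Proof.
move=> x0 Ox fI IO; rewrite smul_imulO // norm_imul ?natrM ?ixn_principal //.
  exact: smulO_frac.
by move=> _ [a Oa ->]; apply: OM.
Qed.

Definition int_ideal I := fideal I /\ forall x, I x -> O x.

Lemma unit_of_smul_eq x y I : x != 0 -> y != 0 -> fideal I -> smul x I = smul y I -> is_unit iota (x / y).
Proof.
move=> x0 y0 fI E.
have key a b : b != 0 -> smul a I = smul b I -> O (a / b).
  move=> b0 E'; apply: (multiplier_integral emb fI) => z Iz.
  have [w Iw Dw] : smul b I (a * z) by rewrite -E'; exists z.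
  by rewrite mulrAC Dw [b * w]mulrC mulfK.
split; first by rewrite mulf_neq0 ?invr_eq0.
  exact: key.
by rewrite invf_div; apply: key.
Qed.

Lemma smul_unit u I : is_unit iota u -> fideal I -> smul u I = I.
Proof.
move=> [u0 Ou Ou'] fI; apply: set_anti => x; first by move=> [y Iy ->]; apply: (fracM fI).
by move=> Ix; exists (u^-1 * x); [exact: (fracM fI)|rewrite mulVKf].
Qed.

Lemma integral_reps : exists rep' : 'I_h -> set F, (forall i, int_ideal (rep' i)) /\
  forall I, fideal I -> exists i, exists2 x, x != 0 & rep' i = smul x I.
Proof.
have [a aP] : exists a : 'I_h -> F, forall i, [/\ O (a i), a i != 0 & forall x, rep i x -> O (a i * x)].
  have c i := cid2 (frac_denom (rep_frac i)).
  by exists (fun i => s2val (c i)) => i; case: (c i) => b [Ob b0] bI.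
exists (fun i => smul (a i) (rep i)); split=> [i|I /rep_cover[i [x x0 Ex]]]; have [Oa a0 aI] := aP i.
  by split; [exact: smul_frac|move=> _ [y Iy ->]; apply: aI].
by exists i, (a i * x); [rewrite mulf_neq0|rewrite Ex smul_mul].
Qed.

(** For a suitable representative the product $I\cdot\mathrm{rep}$ is principal, $yO$, with $N(y)$
    at most a constant times $N(I)$. The class and the $V$-orbit of $y$ determine $I$, and
    [count_orbits] bounds these orbits. *)
Lemma count_ideals : exists2 C : nat, (0 < C)%N & forall Y : R, 1 <= Y ->
  fin (fun I => int_ideal I /\ (ixn O I)%:R <= Y) /\
  (size (enump (fun I => int_ideal I /\ (ixn O I)%:R <= Y)))%:R <= C%:R * Y.
Proof.
have [rep' [rI rC]] := integral_reps; have [C HC] := count_orbits emb.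
pose W := (\sum_i ixn O (rep' i))%N.
have iO : v_invariant iota O by move=> u x /V_unit[_ Ou _] Ox; apply: OM.
have bO : bounded_denom iota O by apply: sub_bounded_denom.
exists (h * (C * W)).+1 => // Y Y1.
have [h0|h0] := posnP h.
  by exfalso; have [i _] := rC O fO; rewrite h0 in i; case: i.
have W0 : (0 < W)%N.
  rewrite /W (bigD1 (Ordinal h0)) //= addn_gt0; apply/orP; left.
  by have [f1 f2] := rI (Ordinal h0); apply: ixn_gt0.
have W1 : 1 <= W%:R :> R by rewrite ler1n.
have YW : 1 <= Y * W%:R by nra.
pose T := enump (orbits iota s O (Y * W%:R)).
have fT := fin_orbits emb (Y * W%:R) iO bO.
have cl I : exists p : 'I_h * F, fideal I -> p.2 != 0 /\ rep' p.1 = smul p.2 (iinv I).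
  have [fI|nf] := pselect (fideal I); last by exists (Ordinal h0, 0).
  by have [i [x x0 Ex]] := rC _ (iinv_frac fI); exists (i, x).
pose g I := let p := sval (cid (cl I)) in (p.1, vrep iota p.2).
pose Q p := p \in [seq (i, D) | i <- enum 'I_h, D <- T].
have gP I : int_ideal I -> exists y, [/\ y != 0, O y, imul I (rep' (g I).1) = smul y O & (g I).2 = vrep iota y].
  move=> [fI IO]; rewrite /g; case: cid => -[i y] /= /(_ fI) [y0 Ey]; exists y.
  have E : imul I (rep' i) = smul y O by rewrite Ey imulC imul_smul imulVr.
  split=> //; suff : imul I (rep' i) y.
    by apply: imul_sub => // a b /IO Oa /((rI i).2) Ob; apply: OM.
  by rewrite E; exists 1; [exact: O1|rewrite mulr1].
have gQ I : int_ideal I /\ (ixn O I)%:R <= Y -> Q (g I).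
  move=> [iI IY]; have [y [y0 Oy E Eg]] := gP I iI; have [fI IO] := iI.
  have [fr rO] := rI (g I).1.
  have NE : Nm y = (ixn O I * ixn O (rep' (g I).1))%:R.
    by rewrite -ixn_principal // -E norm_imul.
  rewrite /Q [g I]surjective_pairing; apply: allpairs_f; first by rewrite mem_enum.
  apply: enump_in => //; rewrite Eg; have yv := vrepK iota y; split.
  - by have [u Vu ->] := yv; apply: iO.
  - exact: veq_neq0 yv y0.
  - exact: vrep_id.
  - rewrite (Nm_veq emb yv) NE natrM ler_pM ?ler0n //.
    by rewrite ler_nat /W (bigD1 (g I).1) //= leq_addr.
have gI I J : int_ideal I /\ (ixn O I)%:R <= Y -> int_ideal J /\ (ixn O J)%:R <= Y -> g I = g J -> I = J.
  move=> [iI _] [iJ _] E; have [y [y0 Oy Ey Eg]] := gP I iI; have [y' [y0' Oy' Ey' Eg']] := gP J iJ.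
  have [u Vu Du] : veq iota y y' by apply/vrepP; rewrite -Eg -Eg' E.
  have [fr rO] := rI (g I).1.
  apply: (imul_inj emb rep_cover fr) => //; [by case: iI|by case: iJ|].
  by rewrite imulC Ey [RHS]imulC E Ey' Du mulrC -smul_mul (smul_unit (V_unit Vu) fO).
have fQ : fin Q by exists [seq (i, D) | i <- enum 'I_h, D <- T].
split; first exact: fin_inj fQ gQ gI.
apply: (@le_trans _ _ (size (enump Q))%:R); first by rewrite ler_nat; apply: size_enump_inj fQ gQ gI.
apply: (@le_trans _ _ (h * size T)%:R).
  rewrite ler_nat -[X in (_ <= X * _)%N](size_enum_ord h) -(size_allpairs pair).
  by apply: uniq_leq_size; [exact: enump_uniq|move=> p /enump_prop].
have := HC O (Y * W%:R) iO (fun x Ox => Ox) YW; rewrite -/T => HT.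
apply: (@le_trans _ _ (h%:R * (C%:R * (Y * W%:R)))); first by rewrite natrM ler_wpM2l ?ler0n.
rewrite (_ : _ * _ = (h * (C * W))%:R * Y); last by rewrite !natrM; ring.
by rewrite ler_wpM2r ?ler_nat //; lra.
Qed.

                                                                                                       
(** For each $M$ there are $O(X/N(M)^2)$ ideals $K$, and summing over $N(M)>z$ gives $O(X/z)$. The
    pair determines $DW$, hence $D$ up to a unit, and units modulo $V$ are finite in number. *)
Lemma tail_count : exists2 C : nat, (0 < C)%N & forall (W : set F) (z : nat) (X : R) (P : F -> Prop),
  fideal W -> (0 < z)%N -> 0 <= X ->
  (forall D, P D -> [/\ D != 0, vrep iota D = D & exists M K, [/\ int_ideal M, int_ideal K, (z < ixn O M)%N,
     (ixn O K * ixn O M ^ 2)%:R <= X & smul D W = imul K (imul M M)]]) ->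
  fin P /\ (size (enump P))%:R <= C%:R * X / z%:R.
Proof.
have [C1 C10 HC1] := count_ideals; have [l [lu lP]] := units_mod_squares emb.
exists (size l * (C1 * (2 * C1))).+1 => // W z X P fW z0 X0 HP.
have z1 : 0 < z%:R :> R by rewrite ltr0n.
pose Lb (Y : R) := enump (fun I => int_ideal I /\ (ixn O I)%:R <= Y).
pose XX : R := X + 1.
pose SM := [seq M <- Lb XX | (z < ixn O M)%N].
have XX1 : 1 <= XX by rewrite /XX; lra.
have Smem Y I : 1 <= Y -> int_ideal I -> (ixn O I)%:R <= Y -> I \in Lb Y.
  by move=> Y1 iI IY; apply: enump_in => //; case: (HC1 Y Y1).
(* The first case keeps the bound of [count_ideals], stated for levels at least 1, applicable:
   beyond it no $K$ exists. *)
pose LK M := if X < (ixn O M)%:R ^+ 2 then [::] else Lb (X / (ixn O M)%:R ^+ 2).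
pose t := [seq (M, K) | M <- SM, K <- LK M].
have wit D : exists p : set F * set F, P D -> [/\ D != 0, vrep iota D = D & [/\ int_ideal p.1, int_ideal p.2, (z < ixn O p.1)%N,
     (ixn O p.2 * ixn O p.1 ^ 2)%:R <= X & smul D W = imul p.2 (imul p.1 p.1)]].
  have [PD|nP] := pselect (P D); last by exists (set0, set0).
  by have [D0 rD [M [K H]]] := HP D PD; exists (M, K).
pose f D := sval (cid (wit D)).
have fP D : P D -> [/\ D != 0, vrep iota D = D & [/\ int_ideal (f D).1, int_ideal (f D).2, (z < ixn O (f D).1)%N,
     (ixn O (f D).2 * ixn O (f D).1 ^ 2)%:R <= X & smul D W = imul (f D).2 (imul (f D).1 (f D).1)]].
  by rewrite /f; case: cid => p Hp /Hp.
have ft D : P D -> f D \in t.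
  move=> /fP[D0 rD [iM iK zM NX E]]; rewrite [f D]surjective_pairing.
  set M := (f D).1 in iM zM NX E *; set K := (f D).2 in iK NX E *.
  have [fM MO] := iM; have [fK KO] := iK.
  have M1 : 1 <= (ixn O M)%:R :> R by rewrite ler1n; apply: ixn_gt0.
  have K1 : 1 <= (ixn O K)%:R :> R by rewrite ler1n; apply: ixn_gt0.
  move: NX; rewrite natrM natrX => NX.
  have M2 : 1 <= (ixn O M)%:R ^+ 2 :> R by rewrite exprn_ege1.
  have M20 : 0 < (ixn O M)%:R ^+ 2 :> R by lra.
  apply/allpairsPdep; exists M, K; split=> //.
    rewrite mem_filter zM; apply: Smem => //; rewrite /XX; nra.
  have MX : (ixn O M)%:R ^+ 2 <= X by nra.
  rewrite /LK ltNge MX /=; apply: Smem => //; first by rewrite ler_pdivlMr // mul1r.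
  by rewrite ler_pdivlMr.
have fib p : exists D0 : F, forall D, P D -> f D = p -> exists2 w, w \in l & D = vrep iota (w * D0).
  have [[D1 PD1 fD1]|nD] := pselect (exists2 D1, P D1 & f D1 = p); last first.
    by exists 0 => D PD fD; case: nD; exists D.
  exists D1 => D PD fD; have [D0 rD [_ _ _ _ E]] := fP D PD; have [D10 rD1 [_ _ _ _ E1]] := fP D1 PD1.
  have /lP[w wl [v uv Dv]] : is_unit iota (D / D1).
    by apply: (unit_of_smul_eq D0 D10 fW); rewrite E E1 fD fD1.
  exists w => //; rewrite -{1}rD; apply/vrepP/veq_sym; exists (v ^+ 2); first by exists v.
  have w0 : w != 0 by case: (lu w wl).
  by rewrite -Dv; field; rewrite w0 D10.
have fib_list p : exists s1 : seq F, (size s1 <= size l)%N /\ forall D, P D -> f D = p -> D \in s1.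
  have [D0 H] := fib p; exists [seq vrep iota (w * D0) | w <- l]; rewrite size_map leqnn; split=> // D PD fD.
  by have [w wl ->] := H D PD fD; apply: map_f.
have finP : fin P.
  pose s1 p := sval (cid (fib_list p)).
  have s1P p : forall D, P D -> f D = p -> D \in s1 p.
    by rewrite /s1; case: (cid (fib_list p)) => u [].
  exists (flatten (map s1 t)) => D PD; apply/flatten_mapP; exists (f D); first exact: ft.
  exact: s1P.
split=> //.
have szt : (size (enump P) <= \sum_(p <- t) size l)%N.
  apply: (size_enump_fibre finP ft) => p _; have [s1 [sz H]] := fib_list p.
  apply: leq_trans sz; apply: uniq_leq_size; first exact: enump_uniq.
  by move=> D /enump_prop[PD fD]; apply: H.
have st : (size t)%:R <= \sum_(M <- SM) C1%:R * X * ((ixn O M)%:R ^+ 2)^-1 :> R.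
  rewrite /t size_allpairs_dep sumnE big_map natr_sum; apply: ler_sum => M _.
  rewrite /LK; case: ifP => [_|/negbT]; first by rewrite !mulr_ge0 ?invr_ge0 ?exprn_ge0 ?ler0n.
  rewrite -leNgt => MX; have [M0|M0] := posnP (ixn O M).
    have [_ H] := HC1 1 (lexx _); rewrite M0 expr0n /= invr0 !mulr0.
    rewrite /Lb (_ : enump _ = [::]) //; apply/nilP; rewrite /nilp -leqn0 leqNgt -has_predT.
    apply/hasPn => I /enump_prop[[fI IO]]; rewrite lern0.
    by rewrite gtn_eqF // ixn_gt0.
  have M20 : 0 < (ixn O M)%:R ^+ 2 :> R by rewrite exprn_gt0 // ltr0n.
  by rewrite -mulrA; apply: (HC1 _ _).2; rewrite ler_pdivlMr // mul1r.
have sumM : \sum_(M <- SM) ((ixn O M)%:R ^+ 2)^-1 <= (2 * C1)%:R / z%:R :> R.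
  rewrite -(big_map (fun M => ixn O M) xpredT (fun k => (k%:R ^+ 2)^-1)); apply: sum_inv_sqr => //.
    by move=> k /mapP[M]; rewrite mem_filter => /andP[zM _ ->].
  move=> j j0; rewrite count_map -(ler_nat R) natrM.
  apply: le_trans (HC1 j%:R _).2; rewrite ?ler1n // ler_nat -size_filter.
  apply: uniq_leq_size; first by rewrite !filter_uniq ?enump_uniq.
  move=> M; rewrite mem_filter => /andP[/= Mj]; rewrite mem_filter => /andP[_ /enump_prop[iM _]].
  by apply: Smem; rewrite ?ler1n ?ler_nat.
apply: (@le_trans _ _ ((size l)%:R * (size t)%:R)).
  by rewrite -natrM ler_nat; apply: leq_trans szt _; rewrite big_const_seq count_predT iter_addn_0.
rewrite -mulr_sumr in st.
apply: (@le_trans _ _ ((size l)%:R * (C1%:R * X * ((2 * C1)%:R / z%:R)))).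
  rewrite ler_wpM2l ?ler0n //; apply: le_trans st _.
  by rewrite ler_wpM2l // mulr_ge0 ?ler0n.
rewrite (_ : (size l)%:R * _ = (size l * (C1 * (2 * C1)))%:R * X / z%:R); last by rewrite !natrM; ring.
by rewrite ler_wpM2r ?invr_ge0 ?ler0n // ler_wpM2r // ler_nat.
Qed.

End Norms.

(** * Integrality of roots of monic quadratic polynomials *)

Lemma Aint_integral (x : algC) : x \in Aint <-> integralOver (intr : int -> algC) x.
Proof.
split=> [xA|[p mp px]].
  have /floorpP[p Dp] : minCpoly x \is a polyOver Num.int by exact: xA.
  exists p; last by rewrite -Dp root_minCpoly.
  have := minCpoly_monic x; rewrite Dp !monicE lead_coef_map_inj //; last exact: intr_inj.
  by move=> /eqP E; apply/eqP/(@intr_inj algC).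
apply: (@root_monic_Aint (map_poly intr p)) => //; first exact: monic_map.
by apply/polyOverP => i; rewrite coef_map intr_int.
Qed.

Lemma Aint_quadratic (x t r : algC) : t \in Aint -> r \in Aint -> x ^+ 2 - t * x + r = 0 -> x \in Aint.
Proof.
move=> /Aint_integral tA /Aint_integral rA E; apply/Aint_integral.
pose p : {poly algC} := 'X^2 + (r%:P - t%:P * 'X).
have sz : (size (r%:P - t%:P * 'X : {poly algC})%R < size ('X^2 : {poly algC})%R)%N.
  rewrite size_polyXn ltnS (leq_trans (size_polyD _ _)) // geq_max size_polyN.
  rewrite (leq_trans (size_polyC_leq1 _)) //= mulrC.
  have [->|t0] := eqVneq t 0; first by rewrite mulr0 size_poly0.
  by rewrite -commr_polyX size_mulX ?polyC_eq0 // size_polyC t0.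
apply: (@integral_root_monic _ _ _ _ p).
- by rewrite monicE lead_coefDl // lead_coefXn.
- rewrite /root /p hornerD hornerXn hornerD hornerN hornerM !hornerC hornerX.
  by apply/eqP; rewrite -[RHS]E; ring.
- apply/integral_poly => i; rewrite coefD coefXn coefB coefC coefCM coefX.
  apply: integral_add; first exact: integral_nat.
  apply: integral_sub; first by case: (i == 0)%N => //; exact: integral0.
  by apply: integral_mul => //; exact: integral_nat.
Qed.

                                                       

(** * The ideal attached to D, and the sieve for its value *)

Section Alpha.
Variables (F : fieldType) (iota : {rmorphism F -> algC}) (n : nat).
Variables (s : 'I_n -> {rmorphism F -> algC}) (e : 'I_n -> F) (d : nat).
Hypothesis emb : field_embeddings iota s e d.
Variables (h : nat) (rep : 'I_h -> set F).
Hypothesis rep_cover : forall I, fideal iota I -> exists i, exists2 x, x != 0 & rep i = smul x I.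
Local Notation O := (integers iota).
Local Notation R := algR.
Local Notation Nm := (Nm s).
Local Notation V := (unit_square iota).
Local Notation fideal := (fideal iota).
Local Notation iinv := (iinv iota).
Local Notation int_ideal := (int_ideal iota).
Local Notation frac0 := (@frac0 F iota _).
Local Notation fracD := (@fracD F iota _).
Local Notation fracM := (@fracM F iota _).
Local Notation fracB := (@fracB F iota _ _ _).
Local Notation frac_subgrp := (@frac_subgrp F iota _).
Local Notation imul1 := (@imul1 F iota _).
Local Notation imul_sub := (@imul_sub F iota _ _ _).
Implicit Types (I J A B P Q : set F) (x y D r t : F).
Let fO := frac_O iota.
Let imulV := imulV emb rep_cover.
Let imulVr := imulVr emb rep_cover.

Let two0 : 2 != 0 :> F. Proof. by rewrite (natF_eq0 iota). Qed.
Let four0 : 4 != 0 :> F. Proof. by rewrite (natF_eq0 iota). Qed.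

Lemma O_quadratic x t r : O t -> O r -> x ^+ 2 - t * x + r = 0 -> O x.
Proof.
move=> Ot Or E; apply: (@Aint_quadratic _ (iota t) (iota r)) => //.
by rewrite -rmorphXn -rmorphM -rmorphB -rmorphD E rmorph0.
Qed.

Lemma O_sqr x : O (x ^+ 2) -> O x.
Proof. by move=> Ox; apply: (@O_quadratic _ 0 (- x ^+ 2)); [exact: O0|exact: ON|ring]. Qed.

                                                                                                 
(** These are the $r$ for which some $(t+r\sqrt D)/2$, $t\in O$, is integral: the doubled $\sqrt
    D$-coordinates of the integers of $K(\sqrt D)$. Only trace and norm occur, so the definition
    stays inside $K$ and makes sense for square [D] as well. *)
Definition al D : set F := fun r => exists2 t, O t & O ((t ^+ 2 - r ^+ 2 * D) / 4).

(** The two conjugates are the roots of $x^2-tx+(t^2-r^2D)/4$. Integrality of both is visibly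
    additive in $(t,r)$, which [alD] exploits. *)
Lemma al_integral D r t : O t -> O ((t ^+ 2 - r ^+ 2 * D) / 4) <->
  O t /\ (iota t + iota r * sqrtC (iota D)) / 2 \in Aint /\ (iota t - iota r * sqrtC (iota D)) / 2 \in Aint.
Proof.
move=> Ot; set th := sqrtC (iota D); have th2 : th ^+ 2 = iota D by rewrite sqrtCK.
have E : iota ((t ^+ 2 - r ^+ 2 * D) / 4) = ((iota t + iota r * th) / 2) * ((iota t - iota r * th) / 2).
  rewrite (fmorph_div iota) (rmorph_nat iota) (rmorphB iota) (rmorphXn iota _ t) (rmorphM iota (r ^+ 2)) (rmorphXn iota _ r) -th2.
  by field.
split=> [H|[_ [h1 h2]]]; last by rewrite /integers E rpredM.
by split=> //; split; apply: (Aint_quadratic Ot H); rewrite E; field.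
Qed.

Lemma al0 D : al D 0.
Proof. by exists 0; [exact: O0|rewrite !expr0n mul0r subrr mul0r; exact: O0]. Qed.

Lemma alD D r r' : al D r -> al D r' -> al D (r + r').
Proof.
move=> [t Ot H] [t' Ot' H']; exists (t + t'); first exact: OD.
have [_ [h1 h2]] := (al_integral D r Ot).1 H; have [_ [h1' h2']] := (al_integral D r' Ot').1 H'.
apply/(al_integral D (r + r') (OD Ot Ot')); split; first exact: OD.
rewrite !rmorphD; split.
  rewrite (_ : _ / 2 = (iota t + iota r * sqrtC (iota D)) / 2 + (iota t' + iota r' * sqrtC (iota D)) / 2).
    by rewrite rpredD.
  by ring.
rewrite (_ : _ / 2 = (iota t - iota r * sqrtC (iota D)) / 2 + (iota t' - iota r' * sqrtC (iota D)) / 2).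
  by rewrite rpredD.
by ring.
Qed.

Lemma alM D a r : O a -> al D r -> al D (a * r).
Proof.
move=> Oa [t Ot H]; exists (a * t); first exact: OM.
have -> : ((a * t) ^+ 2 - (a * r) ^+ 2 * D) / 4 = a * a * ((t ^+ 2 - r ^+ 2 * D) / 4) by ring.
by apply: OM => //; apply: OM.
Qed.

Lemma al_sqr D r : al D r -> O (r ^+ 2 * D).
Proof.
move=> [t Ot H]; have -> : r ^+ 2 * D = t * t - 4 * ((t ^+ 2 - r ^+ 2 * D) / 4) by field.
by apply: OB; apply: OM => //; exact: O_nat.
Qed.

Lemma al_frac D : D != 0 -> fideal (al D).
Proof.
move=> D0; have [k k0 Ok] := O_clear iota D; have kF : k%:R != 0 :> F by rewrite (natF_eq0 iota) -lt0n.
have kO : O k%:R by exact: O_nat.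
split; [exact: al0|exact: alD|exact: alM| |].
- exists (2 * k%:R); last by rewrite mulf_neq0.
  exists 0; first exact: O0.
  have -> : (0 ^+ 2 - (2 * k%:R) ^+ 2 * D) / 4 = - (k%:R * (k%:R * D)) by field.
  by apply: ON; apply: OM.
- exists (k%:R * D); first by rewrite mulf_neq0.
  move=> r /al_sqr H; apply: O_sqr.
  have -> : (k%:R * D * r) ^+ 2 = k%:R * (k%:R * D) * (r ^+ 2 * D) by ring.
  by do 2 apply: OM => //.
Qed.

Lemma al_smul k D : k != 0 -> al (k ^+ 2 * D) = smul k^-1 (al D).
Proof.
move=> k0; apply: set_anti => r.
  move=> [t Ot H]; exists (k * r); last by rewrite mulKf.
  by exists t => //; rewrite exprMn mulrC in H *; move: H; rewrite -!mulrA mulrC; congr O; ring.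
move=> [r' [t Ot H] ->]; exists t => //.
by have -> : (k^-1 * r') ^+ 2 * (k ^+ 2 * D) = r' ^+ 2 * D by field.
Qed.

Lemma al_V u D : V u -> al (u * D) = al D.
Proof.
move=> [v [v0 Ov Ov'] ->]; rewrite al_smul //; apply: set_anti => r.
  by move=> [a Ha ->]; apply: alM.
by move=> Hr; exists (v * r); [exact: alM|rewrite mulKf].
Qed.

(** For products, $(xyD)^2=(x^2D)(y^2D)$ is integral, and an element with integral square is
    integral. *)
Lemma al_mul I D : (forall r, I r -> al D r) -> forall a, imul I I a -> O (a * D).
Proof.
move=> ID a; elim/imul_ind: a / => [|x y|x y /ID /al_sqr hx /ID /al_sqr hy].
- by rewrite mul0r; exact: O0.
- by rewrite mulrDl; apply: OD.
- apply: O_sqr; have -> : (x * y * D) ^+ 2 = (x ^+ 2 * D) * (y ^+ 2 * D) by ring.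
  exact: OM.
Qed.

Definition small (z : nat) B I := exists2 k : nat, (0 < k <= z)%N & forall x, B x -> I (k%:R * x).

                                                                          
(** An approximation to $\mathrm{al}\,D=I$: only enlargements of [I] whose quotient by [I] is killed
    by some $k\le z$ are excluded, so that membership becomes periodic in [D]. *)
Definition sieve_set (z : nat) I : set F := fun D => (forall r, I r -> al D r) /\
  forall B, fideal B -> (forall x, I x -> B x) -> small z B I -> (forall r, B r -> al D r) ->
  forall x, B x -> I x.

Lemma sieve_V z I : v_invariant iota (sieve_set z I).
Proof. by move=> u D Vu; rewrite /sieve_set al_V. Qed.

Lemma sieve_denom z I : fideal I -> bounded_denom iota (sieve_set z I).
Proof.
move=> fI; have [a Ia a0] := frac_neq0 fI; have [k k0 Ok] := O_clear iota (a ^- 2).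
exists k => // D [/(_ a Ia) /al_sqr H _].
have -> : k%:R * D = k%:R * a ^- 2 * (a ^+ 2 * D) by rewrite -mulrA mulKf // expf_neq0.
exact: OM.
Qed.

(** For $k\le z$, $k^2$ divides $(z!)^2$; the 4 cancels the denominator in [al]. *)
Definition modulus (z : nat) := (4 * (z`! * z`!))%N.

Lemma modulus_small z k r : (0 < k <= z)%N -> exists2 c : nat, (modulus z)%:R * r ^+ 2 = 4 * (c%:R * (k%:R * r) ^+ 2) & True.
Proof.
move=> kz; have /dvdnP[q Eq] : (k %| z`!)%N by apply: dvdn_fact.
exists (q * q)%N => //; rewrite /modulus Eq !natrM; ring.
Qed.

(** The translation changes $(t^2-r^2D)/4$ by an integer multiple of $(kr)^2y$, which is integral as
    $kr\in I$ and $y\in I^{-2}$. *)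
Lemma al_translate z I B D y : small z B I -> fideal I -> imul (iinv I) (iinv I) y ->
  (forall r, B r -> al D r) -> forall r, B r -> al (D + (modulus z)%:R * y) r.
Proof.
move=> [k kz kB] fI Jy BD r Br; have [t Ot H] := BD r Br; exists t => //.
have [c E _] := modulus_small r kz.
have -> : (t ^+ 2 - r ^+ 2 * (D + (modulus z)%:R * y)) / 4 = (t ^+ 2 - r ^+ 2 * D) / 4 - c%:R * ((k%:R * r) ^+ 2 * y).
  rewrite [r ^+ 2 * (D + _)]mulrDr [r ^+ 2 * (_ * y)]mulrCA mulrA E.
  by field.
apply: OB => //; apply: OM; first exact: O_nat.
have Ik := kB r Br; move: (k%:R * r) Ik => w Iw.
elim/imul_ind: y / Jy => [|x y|x y Hx Hy].
- by rewrite mulr0; exact: O0.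
- by rewrite mulrDr; apply: OD.
- have -> : w ^+ 2 * (x * y) = (x * w) * (y * w) by ring.
  by apply: OM; [exact: Hx|exact: Hy].
Qed.

Lemma sieve_periodic z I D y : (0 < z)%N -> fideal I -> imul (iinv I) (iinv I) y ->
  sieve_set z I D -> sieve_set z I (D + (modulus z)%:R * y).
Proof.
move=> z0 fI Jy [ID maxD]; have sI : small z I I by exists 1%N => // x; rewrite mul1r.
have fJ := imul_frac (iinv_frac fI) (iinv_frac fI).
split; first exact: al_translate Jy ID.
move=> B fB IB sB BD; apply: maxD => // r Br.
have Jy' : imul (iinv I) (iinv I) (- y) by apply: (subgrpN (frac_subgrp fJ)).
by have := al_translate sB fI Jy' BD Br; rewrite mulrN addrK.
Qed.

Section Coprime.
Variables (I : set F) (z : nat) (a b : F).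
Hypothesis z0 : (0 < z)%N.
Hypothesis iI : int_ideal I.
Hypothesis Ia : I a.
Hypothesis Ob : O b.
Hypothesis E1 : 1 = a + (modulus z)%:R * b.

Let fI := iI.1.
Let IO := iI.2.
Let m : F := (modulus z)%:R.
Let J := imul (iinv I) (iinv I).
Let fJ : fideal J := imul_frac (iinv_frac fI) (iinv_frac fI).
Let Oa : O a := IO Ia.
Let Om : O m. Proof. exact: O_nat. Qed.

Let sq1 : 1 = a ^+ 2 + m * (2 * a * b + m * b ^+ 2).
Proof. by rewrite -{1}[1](expr1n _ 2) {1}E1 -/m; ring. Qed.

(** From $1=a+mb$ one gets 1 as $a^2$ plus $m$ times an integer. So $r^2D$ is $(ar)^2D$, with $ar\in
    IB$, up to a multiple of $mr^2$ that remains integral after division by 4. *)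
Lemma coprime_al B D : O D -> (forall x, O x -> B x) -> small z B O ->
  (forall r, imul I B r -> al D r) -> forall r, B r -> al D r.
Proof.
move=> OD_ subOB [k kz kB] H r Br; have [t Ot Ht] := H (a * r) (imul_mem Ia Br).
exists t => //; have [c E _] := modulus_small r kz.
have -> : (t ^+ 2 - r ^+ 2 * D) / 4 = (t ^+ 2 - (a * r) ^+ 2 * D) / 4 - c%:R * (k%:R * r) ^+ 2 * (2 * a * b + m * b ^+ 2) * D.
  have -> : r ^+ 2 * D = (a * r) ^+ 2 * D + m * r ^+ 2 * (2 * a * b + m * b ^+ 2) * D.
    by rewrite -{1}[r ^+ 2]mul1r {1}sq1; ring.
  by rewrite {1}/m E; field.
have Okr : O (k%:R * r) by exact: kB.
apply: OB => //; apply: OM => //; apply: OM.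
  by apply: OM; [exact: O_nat|apply: OM].
by apply: OD; [apply: OM => //; apply: OM => //; exact: O_nat|apply: OM => //; apply: OM].
Qed.

Lemma sub_imul B x : imul I B x -> fideal B -> B x.
Proof. by move=> H fB; apply: imul_sub H => // u v Iu Bv; apply: (fracM fB) => //; exact: IO. Qed.

(** The enlargements $B$ of $O$ correspond to the enlargements $IB$ of $I$, and [coprime_al] passes
    from $IB$ back to $B$. *)
Lemma coprime_sieve D : O D -> sieve_set z I D <-> sieve_set z O D.
Proof.
move=> OD_; have sO : small z O O by exists 1%N => // x; rewrite mul1r.
split=> -[h1 h2]; split.
- apply: (coprime_al OD_) => // r.
  by rewrite imulC imul1 //; exact: h1.
- move=> B fB OB sB BD; have fIB := imul_frac fI fB.
  apply: (imul_cancel emb rep_cover fI) => // x; rewrite [imul I O]imulC imul1 //.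
  apply: h2 => //.
  + by move=> y Iy; rewrite -[y]mulr1; apply: imul_mem => //; apply: OB; exact: O1.
  + have [k kz kB] := sB; exists k => // y; elim/imul_ind: y / => [|u v|u v Iu Bv].
    * by rewrite mulr0; exact: (frac0 fI).
    * by rewrite mulrDr; apply: (fracD fI).
    * by rewrite mulrCA mulrC; apply: (fracM fI) => //; exact: kB.
  + by move=> r H; apply: BD; apply: sub_imul H fB.
- by move=> r /IO; exact: h1.
- move=> B fB IB [k kz kB] BD; pose B' := imul (iinv I) B.
  have fB' : fideal B' by apply: imul_frac => //; exact: iinv_frac.
  have EB : imul I B' = B by rewrite /B' imulA imulV // imul1.
  have OB' x : O x -> B' x by rewrite -(imulVr fI); apply: imul_mono.
  have sB' : small z B' O.
    exists k => // y; elim/imul_ind: y / => [|u v|u v Hu Bv].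
    + by rewrite mulr0; exact: O0.
    + by rewrite mulrDr; apply: OD.
    + by rewrite mulrCA; apply: Hu; exact: kB.
  have B'D : forall r, B' r -> al D r by apply: (coprime_al OD_ OB' sB'); rewrite EB.
  have B'O := h2 B' fB' OB' sB' B'D.
  move=> x; rewrite -EB => H; rewrite -(imul1 fI) imulC.
  exact: imul_mono H.
Qed.

Lemma sieve_sub_J D : sieve_set z I D -> J D.
Proof.
move=> [ID _]; rewrite /J -(iinvM emb rep_cover fI fI) => x Hx; rewrite mulrC.
exact: al_mul ID _ Hx.
Qed.

Lemma O_sub_J x : O x -> J x.
Proof.
move=> Ox; rewrite /J -(iinvM emb rep_cover fI fI) => y Hy; apply: OM => //.
apply: imul_sub Hy => // u v /IO Ou /IO Ov; exact: OM.
Qed.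

(** The translations are $mr_i$ with $r_i$ representing $I^{-2}/O$. Each element of the sieve set of
    $I$ lies in $I^{-2}$ and can be made integral by one of them; periodicity keeps it in the set,
    and [coprime_sieve] replaces $I$ by $O$. *)
Lemma sieve_translates : exists vs : seq F, [/\ uniq vs, size vs = ixn O (imul I I),
  forall x, sieve_set z I x <-> exists2 v, v \in vs & sieve_set z O (x - v) /\ O (x - v) &
  forall x v v', v \in vs -> v' \in vs -> O (x - v) -> O (x - v') -> v = v'].
Proof.
have fII := imul_frac fI fI.
have IIO x : imul I I x -> O x by apply: imul_sub => // u v /IO Ou /IO Ov; exact: OM.
have EJ : J = iinv (imul I I) by rewrite (iinvM emb rep_cover).
have dE : ixn J O = ixn O (imul I I).
  rewrite -(index_imul emb rep_cover fII IIO fJ) [X in imul _ X]EJ imulV //.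
have [r [rJ rP]] := ixnP emb fO fJ O_sub_J.
have m0 : m != 0 by rewrite (natF_eq0 iota) -lt0n /modulus !muln_gt0 !fact_gt0.
have rI i i' : O (r i - r i') -> i = i'.
  move=> H; have [c [_ Uc]] := rP _ (rJ i).
  by rewrite -(Uc i) ?subrr; [exact: Uc|exact: O0].
have mJ w : J w -> O (m * w) -> O w.
  move=> Jw Om'; rewrite -[w]mul1r sq1 mulrDl; apply: OD.
    move: Jw; rewrite EJ => /(_ (a ^+ 2)); rewrite mulrC; apply.
    by rewrite expr2; apply: imul_mem.
  rewrite mulrAC; apply: OM => //; apply: OD.
    by apply: OM => //; apply: OM => //; exact: O_nat.
  by apply: OM => //; apply: OM.
exists [seq m * r i | i <- enum 'I_(ixn J O)]; split.
- rewrite map_inj_uniq ?enum_uniq // => i i' /(mulfI m0) E; apply: rI.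
  by rewrite E subrr; exact: O0.
- by rewrite size_map size_enum_ord.
- move=> x; split=> [Gx|[_ /mapP[i _ ->] [Gx Ox]]].
    have Jx := sieve_sub_J Gx; have [ID _] := Gx.
    have Oax : O (a ^+ 2 * x) by exact/al_sqr/ID.
    pose y := (2 * a * b + m * b ^+ 2) * x.
    have Oc : O (2 * a * b + m * b ^+ 2).
      apply: OD; first by apply: OM => //; apply: OM => //; exact: O_nat.
      by apply: OM => //; apply: OM.
    have Jy : J y by apply: (fracM fJ).
    (* The term $a^2x$ is integral because $a\in I\subseteq\mathrm{al}\,x$; the rest is $m$ times an
       element of $I^{-2}$. *)
    have Ex : x = a ^+ 2 * x + m * y by rewrite -{1}[x]mul1r sq1 /y; ring.
    have [i [Oi _]] := rP y Jy.
    have Ov : O (x - m * r i).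
      rewrite {1}Ex (_ : _ - _ = a ^+ 2 * x + m * (y - r i)); last by ring.
      by apply: OD => //; apply: OM.
    exists (m * r i); first by apply/mapP; exists i; rewrite ?mem_enum.
    split=> //; apply/coprime_sieve => //.
    have Jr : J (- r i) by apply: (subgrpN (frac_subgrp fJ)).
    by have := sieve_periodic z0 fI Jr Gx; rewrite mulrN.
  have {Gx} Gx : sieve_set z I (x - m * r i) by apply/coprime_sieve.
  by have := sieve_periodic z0 fI (rJ i) Gx; rewrite subrK.
- move=> x _ _ /mapP[i _ ->] /mapP[i' _ ->] h1 h2; rewrite (rI i i') //.
  apply: mJ; first exact: (fracB fJ).
  have -> : m * (r i - r i') = (x - m * r i') - (x - m * r i) by ring.
  exact: OB.
Qed.

End Coprime.

(** [coprime_generator] gives $I^{-1}=xO+mI^{-1}$; multiplying by $I$, $O=xI+mO$. *)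
Lemma coprime_rep I (m : nat) : fideal I -> (0 < m)%N -> exists2 x, x != 0 &
  int_ideal (smul x I) /\ exists a b, [/\ smul x I a, O b & 1 = a + m%:R * b].
Proof.
move=> fI m0; have fJ := iinv_frac fI; have mF : m%:R != 0 :> F by rewrite (natF_eq0 iota) -lt0n.
have fN := smulO_frac iota mF.
have NO x : smul m%:R O x -> O x by move=> [c Oc ->]; apply: OM => //; exact: O_nat.
have fNJ := imul_frac fN fJ.
have [x [Jx x0 xP]] : exists x, [/\ iinv I x, x != 0 &
    forall y, iinv I y -> exists2 r, O r & imul (smul m%:R O) (iinv I) (y - x * r)].
  have [x Jx xP] := coprime_generator emb rep_cover fN NO fJ.
  (* A generator 0 means $I^{-1}=mI^{-1}$, and then any nonzero element of $mI^{-1}$ serves. *)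
  have [x0|] := eqVneq x 0; last by exists x.
  have [w Jw w0] := frac_neq0 fNJ; exists w; split=> //.
    by apply: imul_sub Jw => // u v /NO Ou Hv; apply: (fracM fJ).
  move=> y /xP[r Or]; rewrite x0 mul0r subr0 => H; exists 1; first exact: O1.
  by rewrite mulr1; apply: (fracB fNJ).
exists x => //; split.
  by split; [exact: smul_frac|move=> _ [y Iy ->]; exact: Jx].
have : imul I (iinv I) 1 by rewrite imulV //; exact: O1.
suff gen w : imul I (iinv I) w -> exists a b, [/\ smul x I a, O b & w = a + m%:R * b] by apply: gen.
elim/imul_ind: w / => [|u v|u v Iu /xP[r Or Hr]].
- exists 0, 0; rewrite mulr0 addr0; split=> //; last exact: O0.
  by exists 0; [exact: (frac0 fI)|rewrite mulr0].
- move=> [a [b [[a' Ia' ->] Ob ->]]] [c [d' [[c' Ic' ->] Od ->]]]; exists (x * (a' + c')), (b + d').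
  by split; [exists (a' + c') => //; exact: (fracD fI)|exact: OD|ring].
- have [b Ob Eb] : smul m%:R O (u * (v - x * r)).
    have : imul I (imul (smul m%:R O) (iinv I)) (u * (v - x * r)) by apply: imul_mem.
    by rewrite imul_smul imul1 // [imul I _]imulC imul_smul imulVr.
  exists (x * (r * u)), b; split=> //; first by exists (r * u) => //; apply: (fracM fI).
  by rewrite -Eb; ring.
Qed.

(** The norm of $DI^2$; for $I=\mathrm{al}\,D$ this is the norm of the relative discriminant. *)
Definition dnorm I D := ixn O (smul D (imul I I)).

Lemma dnormE I D : dnorm I D = ixn O (smul D (imul I I)).
Proof. by []. Qed.

Lemma norm_smul_gen D I : D != 0 -> fideal I -> (forall x, I x -> O x) -> (forall x, smul D I x -> O x) ->
  (ixn O (smul D I))%:R = Nm D * (ixn O I)%:R.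
Proof.
move=> D0 fI IO DO; have [k k0 Ok] := O_clear iota D.
have kF : k%:R != 0 :> F by rewrite (natF_eq0 iota) -lt0n.
have kD0 : k%:R * D != 0 by rewrite mulf_neq0.
have N0 : Nm k%:R != 0 by rewrite gt_eqF // Nm_gt0.
apply: (mulfI N0); rewrite mulrA -NmM -(norm_smul emb rep_cover kD0 Ok fI IO) -smul_mul.
by rewrite (norm_smul emb rep_cover kF) //; [exact: O_nat|exact: smul_frac].
Qed.

Lemma al_int D I : D != 0 -> fideal I -> (forall r, I r -> al D r) -> int_ideal (smul D (imul I I)).
Proof.
move=> D0 fI ID; split; first by apply: smul_frac => //; apply: imul_frac.
by move=> _ [x Hx ->]; rewrite mulrC; apply: al_mul ID _ Hx.
Qed.

(** With $B=\mathrm{al}\,D$ and $M=IB^{-1}$, $DI^2=(DB^2)M^2$. If $N(M)\le z$, then $N(M)B\subseteq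
    MB=I$ makes $B$ one of the excluded enlargements, so $B=I$. *)
Lemma sieve_tail z I D : fideal I -> sieve_set z I D -> D != 0 -> al D <> I ->
  exists M K, [/\ int_ideal M, int_ideal K, (z < ixn O M)%N,
   (ixn O K * ixn O M ^ 2)%N = dnorm I D & smul D (imul I I) = imul K (imul M M)].
Proof.
move=> fI [ID maxD] D0 ne; have fB := al_frac D0; set B := al D in ID maxD ne fB.
have fB' := iinv_frac fB.
pose M := imul I (iinv B); have fM : fideal M by apply: imul_frac.
have MO x : M x -> O x.
  by rewrite -(imulV fB); apply: imul_mono.
have MB : imul M B = I by rewrite /M -imulA imulVr // imulC imul1.
have [fK KO] : int_ideal (smul D (imul B B)) by apply: al_int.
have E : smul D (imul I I) = imul (smul D (imul B B)) (imul M M).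
  have ACA A1 A2 : imul (imul A1 A2) (imul A1 A2) = imul (imul A1 A1) (imul A2 A2).
    by rewrite -!imulA; congr (imul A1 _); rewrite !imulA (imulC A2).
  by rewrite imul_smul [imul (imul B B) _]imulC -ACA MB.
exists M, (smul D (imul B B)); split=> //.
  rewrite ltnNge; apply/negP => Mz; apply: ne; apply: set_anti => //.
  apply: maxD => //; exists (ixn O M); first by rewrite Mz andbT; apply: (ixn_gt0 emb).
  by move=> x Bx; rewrite -MB; apply: imul_mem => //; apply: (norm_mem emb).
have fMM := imul_frac fM fM.
have MMO x : imul M M x -> O x by apply: imul_sub => // u v /MO Ou /MO Ov; exact: OM.
by rewrite /dnorm E (norm_imul emb rep_cover fK KO fMM MMO) (norm_imul emb rep_cover fM MO fM MO) mulnn.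
Qed.

End Alpha.

                              

(** * Orbit counts for a fixed ideal: independence of the ideal, and a lower bound *)

Section Counting.
Variables (F : fieldType) (iota : {rmorphism F -> algC}) (n : nat).
Variables (s : 'I_n -> {rmorphism F -> algC}) (e : 'I_n -> F) (d : nat).
Hypothesis emb : field_embeddings iota s e d.
Variables (h : nat) (rep : 'I_h -> set F).
Hypothesis rep_frac : forall i, fideal iota (rep i).
Hypothesis rep_cover : forall I, fideal iota I -> exists i, exists2 x, x != 0 & rep i = smul x I.
Local Notation O := (integers iota).
Local Notation R := algR.
Local Notation Nm := (Nm s).
Local Notation nrm := (nrm s).
Local Notation absv := (absv s).
Local Notation veq := (veq iota).
Local Notation vrep := (vrep iota).
Local Notation fideal := (fideal iota).
Local Notation iinv := (iinv iota).
Local Notation int_ideal := (int_ideal iota).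
Local Notation al := (al iota).
Local Notation orbits := (orbits iota s).
Local Notation Bsum := (Bsum iota s).
Local Notation dnorm := (dnorm iota).
Local Notation sieve_set := (sieve_set iota).
Local Notation imul1 := (@imul1 F iota _).
Local Notation imul_sub := (@imul_sub F iota _ _ _).
Implicit Types (I J A B P Q : set F) (x y D r t : F) (X Y : R) (z : nat).
Let n0 : (0 < n)%N := emb_dim_gt0 emb.
Let fO := frac_O iota.
Let imulV := imulV emb rep_cover.

                                                                     
(** One [D] per $V$-orbit with [al D] exactly [I]; for nonsquare [D] these stand for the fields with
    Steinitz module [I], ordered by discriminant. [BM] is the corresponding Riesz mean. *)
Definition Mred I X : F -> Prop := fun D => [/\ D != 0, al D = I, vrep D = D & (dnorm I D)%:R <= X].
Definition Mc I X : nat := size (enump (Mred I X)).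
Definition BM I X : R := \sum_(D <- enump (Mred I X)) (X - (dnorm I D)%:R).

Lemma dnorm_int I D : D != 0 -> int_ideal I -> (forall r, I r -> al D r) ->
  (dnorm I D)%:R = (ixn O (imul I I))%:R * Nm D.
Proof.
move=> D0 [fI IO] ID; rewrite mulrC; apply: (norm_smul_gen emb rep_cover) => //.
- exact: imul_frac.
- by apply: imul_sub => // u v /IO Ou /IO Ov; apply: OM.
- by have [] := al_int D0 fI ID.
Qed.

Lemma norm_sq_gt0 I : int_ideal I -> 0 < (ixn O (imul I I))%:R :> R.
Proof.
move=> [fI IO]; rewrite ltr0n; apply: (ixn_gt0 emb) => //; first exact: imul_frac.
by apply: imul_sub => // u v /IO Ou /IO Ov; apply: OM.
Qed.

Lemma Mred_sieve z I X D : int_ideal I -> Mred I X D ->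
  orbits (sieve_set z I) (X / (ixn O (imul I I))%:R) D.
Proof.
move=> iI [D0 aD rD NX]; have ID r : I r -> al D r by rewrite aD.
split=> //; first by split=> // B _ _ _; rewrite aD.
by rewrite ler_pdivlMr ?norm_sq_gt0 // mulrC -dnorm_int.
Qed.

Lemma fin_Mred_int I X : int_ideal I -> fin (Mred I X).
Proof.
move=> iI; have [fI IO] := iI.
apply: (fin_sub (fin_orbits emb (X / (ixn O (imul I I))%:R) (sieve_V (z := 1) (I := I)) (sieve_denom 1 fI))).
by move=> D; apply: Mred_sieve.
Qed.

(** The difference is the sum over sieved [D] with [al D] different from [I]; by [sieve_tail] and
    [tail_count] there are $O(X/z)$ of them, each weighing at most $X$. The constant is uniform in
    [z] and [I]. *)
Lemma sieve_BM : exists C : nat, forall z I X (c : R), (0 < z)%N -> int_ideal I -> 0 <= X ->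
  c = (ixn O (imul I I))%:R ->
  0 <= c * Bsum (sieve_set z I) (X / c) - BM I X <= C%:R / z%:R * X ^+ 2.
Proof.
have [C C0 HC] := tail_count emb rep_frac rep_cover; exists C => z I X _ z0 iI X0 ->; set c : R := (ixn _ _)%:R.
have [fI IO] := iI; have c0 : 0 < c by exact: norm_sq_gt0.
pose G := sieve_set z I.
have fG : fin (orbits G (X / c)) by exact: (fin_orbits emb (X / c) (sieve_V (z := z) (I := I)) (sieve_denom z fI)).
pose f D : R := X - c * Nm D.
pose P D := orbits G (X / c) D /\ al D <> I.
have E1 : c * Bsum G (X / c) = \sum_(D <- enump (orbits G (X / c))) f D.
  rewrite !BsumE mulr_sumr; apply: eq_bigr => D _.
  by rewrite /f mulrBr mulrCA divff ?mulr1 // gt_eqF.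
have E2 : BM I X = \sum_(D <- enump (orbits G (X / c))) (if `[< al D = I >] then f D else 0).
  rewrite -(big_enump_sub (P := Mred I X)) //.
  - rewrite /BM [LHS]big_seq [RHS]big_seq; apply: eq_bigr => D /enump_prop[D0 aD rD NX].
    case: asboolP => // _; rewrite /f dnorm_int // => r; by rewrite aD.
  - by move=> D; apply: Mred_sieve.
  - move=> D [[ID _] D0 rD NX] nM; case: asboolP => // aD; case: nM; split=> //.
    by rewrite dnorm_int // mulrC -ler_pdivlMr.
have E3 : c * Bsum G (X / c) - BM I X = \sum_(D <- enump P) f D.
  rewrite E1 E2 -sumrB (eq_bigr (fun D => if `[< al D = I >] then 0 else f D)); last first.
    by move=> D _; case: asboolP => _; rewrite ?subrr ?subr0.
  rewrite -(big_enump_sub (P := P)) //.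
  - rewrite [LHS]big_seq [RHS]big_seq; apply: eq_bigr => D /enump_prop[_ aD].
    by case: asboolP.
  - by move=> D [].
  - by move=> D oD nP; case: asboolP => // aD; case: nP.
have fb D : P D -> 0 <= f D <= X.
  move=> [[_ _ _ NX] _]; rewrite /f gerBl mulr_ge0 ?Nm_ge0 ?(ltW c0) // andbT subr_ge0.
  by rewrite mulrC -ler_pdivlMr.
rewrite E3; apply/andP; split.
  by rewrite big_seq; apply: sumr_ge0 => D /enump_prop /fb /andP[].
apply: (@le_trans _ _ (\sum_(D <- enump P) X)).
  by rewrite [X in X <= _]big_seq [X in _ <= X]big_seq; apply: ler_sum => D /enump_prop /fb /andP[].
rewrite big_const_seq count_predT iter_addr_0 -[X *+ _]mulr_natl expr2 mulrA ler_wpM2r //.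
have [|_] := HC (imul I I) z X P (imul_frac fI fI) z0 X0; last by rewrite mulrAC.
move=> D [[GD D0 rD NX] aD]; split=> //.
have [M [K [iM iK zM NE E]]] := sieve_tail emb rep_cover fI GD D0 aD.
exists M, K; split=> //; rewrite NE dnorm_int //; last by case: GD.
by rewrite mulrC -ler_pdivlMr.
Qed.

Lemma dnorm_veq I D D' : fideal I -> veq D D' -> dnorm I D' = dnorm I D.
Proof.
move=> fI [u /V_unit uu ->]; rewrite !dnormE mulrC -smul_mul.
by rewrite (smul_unit uu (imul_frac fI fI)).
Qed.

Lemma dnorm_smul I x D : x != 0 -> dnorm (smul x I) (x^-1 ^+ 2 * D) = dnorm I D.
Proof.
move=> x0; rewrite !dnormE imul_smul [imul I _]imulC imul_smul !smul_mul.
by congr (ixn _ (smul _ _)); field.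
Qed.

(** The bijection is $D\mapsto x^{-2}D$, which multiplies [al D] by $x$ and leaves $DI^2$
    unchanged. *)
Lemma Mred_smul I x X : x != 0 -> fideal I -> fin (Mred I X) ->
  perm_eq (enump (Mred (smul x I) X)) [seq vrep (x^-1 ^+ 2 * D) | D <- enump (Mred I X)].
Proof.
move=> x0 fI fM; have xi0 := invr_neq0 x0; have fxI := smul_frac x0 fI.
have inj x' D D' : x' != 0 -> vrep D = D -> vrep D' = D' -> vrep (x' ^+ 2 * D) = vrep (x' ^+ 2 * D') -> D = D'.
  move=> x'0 rD rD' /vrepP[u Vu E]; rewrite -rD -rD'; apply/vrepP; exists u => //.
  by apply: (mulfI (expf_neq0 2 x'0)); rewrite E; ring.
have tr I1 x1 D : x1 != 0 -> fideal I1 -> Mred I1 X D -> Mred (smul x1 I1) X (vrep (x1^-1 ^+ 2 * D)).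
  move=> x10 fI1 [D0 aD rD NX]; have yv := vrepK iota (x1^-1 ^+ 2 * D); split.
  - by apply: veq_neq0 yv _; rewrite mulf_neq0 // expf_neq0 // invr_eq0.
  - by have [u Vu ->] := yv; rewrite al_V // al_smul ?invr_eq0 // invrK aD.
  - exact: vrep_id.
  - by rewrite (dnorm_veq (smul_frac x10 fI1) yv) dnorm_smul.
have bk D : Mred (smul x I) X D -> exists2 D', Mred I X D' & D = vrep (x^-1 ^+ 2 * D').
  move=> H; exists (vrep (x ^+ 2 * D)).
    by have := tr _ _ D xi0 fxI H; rewrite smul_mul mulVf // smul1 invrK.
  have [_ _ rD _] := H; rewrite -{1}rD; apply/vrepP.
  have [u Vu ->] := vrepK iota (x ^+ 2 * D); exists u => //.
  by field.
have fM' : fin (Mred (smul x I) X).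
  by apply: fin_sub (fin_img (fun D => vrep (x^-1 ^+ 2 * D)) fM) _ => D /bk[D' HD' ->]; exists D'.
apply: uniq_perm; first exact: enump_uniq.
  rewrite map_inj_in_uniq ?enump_uniq // => D D' /enump_prop[_ _ rD _] /enump_prop[_ _ rD' _].
  exact: inj.
move=> D; rewrite mem_enump //; apply/asboolP/mapP.
  by move=> /bk[D' HD' ->]; exists D' => //; apply: enump_in.
by move=> [D' /enump_prop HD' ->]; apply: tr.
Qed.

Lemma fin_Mred I X : fideal I -> fin (Mred I X).
Proof.
move=> fI; have [a [Oa a0] aI] := frac_denom fI.
have iaI : int_ideal (smul a I) by split; [exact: smul_frac|move=> _ [y Iy ->]; exact: aI].
have fM := fin_Mred_int X iaI.
apply: (fin_inj (f := fun D => vrep (a^-1 ^+ 2 * D)) fM).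
  move=> D [D0 aD rD NX]; have yv := vrepK iota (a^-1 ^+ 2 * D); split.
  - by apply: veq_neq0 yv _; rewrite mulf_neq0 // expf_neq0 // invr_eq0.
  - by have [u Vu ->] := yv; rewrite al_V // al_smul ?invr_eq0 // invrK aD.
  - exact: vrep_id.
  - by rewrite (dnorm_veq (smul_frac a0 fI) yv) dnorm_smul.
move=> D D' [_ _ rD _] [_ _ rD' _] /vrepP[u Vu E]; rewrite -rD -rD'; apply/vrepP; exists u => //.
by apply: (mulfI (expf_neq0 2 (invr_neq0 a0))); rewrite E; ring.
Qed.

Lemma BM_smul I x X : x != 0 -> fideal I -> BM (smul x I) X = BM I X.
Proof.
move=> x0 fI; rewrite /BM (perm_big _ (Mred_smul x0 fI (fin_Mred X fI))) big_map.
apply: eq_bigr => D _; congr (_ - _%:R).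
by rewrite (dnorm_veq (smul_frac x0 fI) (vrepK iota _)) dnorm_smul.
Qed.

Lemma Mc_smul I x X : x != 0 -> fideal I -> Mc (smul x I) X = Mc I X.
Proof.
by move=> x0 fI; rewrite /Mc (perm_size (Mred_smul x0 fI (fin_Mred X fI))) size_map.
Qed.

Lemma sieve_O_sub z D : sieve_set z O D -> O D.
Proof. by move=> [/(_ 1 (O1 _)) /al_sqr + _]; rewrite expr1n mul1r. Qed.

Lemma modulus_gt0 z : (0 < modulus z)%N.
Proof. by rewrite /modulus !muln_gt0 !fact_gt0. Qed.

Lemma sieve_O_periodic z D y : (0 < z)%N -> sieve_set z O D -> O y -> sieve_set z O (D + (modulus z)%:R * y).
Proof.
move=> z0 GD Oy; apply: sieve_periodic => //.
by rewrite (iinvO emb rep_cover) imul1.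
Qed.

Lemma int_O : int_ideal O. Proof. by split. Qed.

Lemma norm_OO : ixn O (imul O O) = 1%N.
Proof.
rewrite imul1 //; apply: ixn_eq; first exact: O_subgrp.
exists (fun=> 0); split=> [i|x Ox]; first exact: O0.
by exists ord0; rewrite /unique subr0; split=> // i _; rewrite (ord1 i).
Qed.

(** Fix a large [z] and replace [I] by an ideal of its class prime to the modulus, $c=N(I^2)$. Up to
    small errors the mean for [I] is $c$ times that of its sieve set at $X/c$, hence $c^2$ times
    that of the sieve set of [O] at $X/c$, hence the latter at $X$ by [Bsum_regular]. *)
Lemma BM_compare I (eps : R) : fideal I -> 0 < eps -> exists X0 : R, forall X, X0 <= X ->
  `|BM I X - BM O X| <= eps * X ^+ 2.
Proof.
move=> fI eps0; have [C HC] := sieve_BM.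
have [z z0 Hz] := natural_bound (4 * C%:R / eps).
have zR : 0 < z%:R :> R by rewrite ltr0n.
have Cz : C%:R / z%:R <= eps / 4.
  rewrite ler_pdivrMr // mulrAC ler_pdivlMr // [X in _ <= X]mulrC -ler_pdivrMr //.
  by rewrite [_ * 4]mulrC.
have [x x0 [iI [a [b [Ia Ob E1]]]]] := coprime_rep emb rep_cover fI (modulus_gt0 z).
have [vs [uvs szv vP vU]] := sieve_translates emb rep_cover z0 iI Ia Ob E1.
set I' := smul x I in iI Ia vP szv; have [fI' IO'] := iI.
have [c Ec] : exists c : R, c = (ixn O (imul I' I'))%:R by exists (ixn O (imul I' I'))%:R.
have c0 : 0 < c by rewrite Ec; apply: norm_sq_gt0.
pose G0 := sieve_set z O; pose G := sieve_set z I'.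
have iG0 : v_invariant iota G0 by exact: sieve_V.
have GP y : G y <-> exists2 v, v \in vs & G0 (y - v).
  split=> [/vP[v vv [H _]]|[v vv H]]; first by exists v.
  by apply/vP; exists v => //; split=> //; apply: sieve_O_sub H.
have vU' y v v' : v \in vs -> v' \in vs -> G0 (y - v) -> G0 (y - v') -> v = v'.
  by move=> h1 h2 /sieve_O_sub h3 /sieve_O_sub h4; apply: (vU y).
have c2 : 0 < c ^+ 2 by rewrite exprn_gt0.
have e1 : 0 < eps / 8 * c by rewrite mulr_gt0 // divr_gt0.
have e2 : 0 < eps / 8 / c ^+ 2 by rewrite !divr_gt0.
have [X1 H1] := Bsum_translates emb uvs iG0 (sieve_V (z := z) (I := I')) (sieve_denom z fI') (@sieve_O_sub z) GP vU' e1.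
have ci : 0 < c^-1 by rewrite invr_gt0.
have perG0 y w : G0 y -> O w -> G0 (y + (modulus z)%:R * w) by exact: sieve_O_periodic.
have [X2 H2] := Bsum_regular emb (modulus_gt0 z) iG0 (@sieve_O_sub z) perG0 ci e2.
exists (Num.max 0 (Num.max (c * X1) X2)) => X; rewrite !ge_max => /andP[Xge0 /andP[HX1 HX2]].
have h1 := HC z I' X c z0 iI Xge0 Ec; rewrite BM_smul // in h1.
have h2 := HC z O X _ z0 int_O Xge0 erefl; rewrite norm_OO mul1r divr1 in h2.
have X1c : X1 <= X / c by rewrite ler_pdivlMr // mulrC.
have h3 := H1 _ X1c; rewrite szv -Ec -/G in h3.
have h4 := H2 X HX2; rewrite [c^-1 * X]mulrC in h4.
have h5 : `|c * Bsum G (X / c) - c ^+ 2 * Bsum G0 (X / c)| <= eps / 8 * X ^+ 2.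
  rewrite (_ : _ - _ = c * (Bsum G (X / c) - c * Bsum G0 (X / c))); last by ring.
  rewrite normrM (gtr0_norm c0).
  have := ler_wpM2l (ltW c0) h3; rewrite (_ : c * (eps / 8 * c * _) = eps / 8 * X ^+ 2) //.
  by field; rewrite gt_eqF.
have h6 : `|c ^+ 2 * Bsum G0 (X / c) - Bsum G0 X| <= eps / 8 * X ^+ 2.
  rewrite (_ : _ - _ = c ^+ 2 * (Bsum G0 (X / c) - c^-1 ^+ 2 * Bsum G0 X)); last by field; rewrite gt_eqF.
  rewrite normrM (gtr0_norm c2).
  have := ler_wpM2l (ltW c2) h4; rewrite (_ : c ^+ 2 * (eps / 8 / _ * _) = eps / 8 * X ^+ 2) //.
  by field; rewrite gt_eqF.
have h7 : C%:R / z%:R * X ^+ 2 <= eps / 4 * X ^+ 2 by rewrite ler_wpM2r ?exprn_ge0.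
move: h1 h2 h5 h6 h7; rewrite !ler_norml -/G -/G0.
move: (c * Bsum G (X / c)) (c ^+ 2 * Bsum G0 (X / c)) (Bsum G0 X) (BM I X) (BM O X) (C%:R / z%:R * X ^+ 2) (X ^+ 2) (exprn_ge0 2 Xge0).
move: (eps) eps0 => ep ep0; clear -ep0.
move=> a1 a2 a3 a4 a5 a6 a7 a70 /andP[p1 p2] /andP[p3 p4] /andP[p5 p6] /andP[p7 p8] p9.
have : 0 <= ep * a7 by rewrite mulr_ge0 // ltW.
by move=> q; apply/andP; split; lra.
Qed.

Lemma BM_regular (c eps : R) : 0 < c -> 0 < eps -> exists X0 : R, forall X, X0 <= X ->
  `|BM O (c * X) - c ^+ 2 * BM O X| <= eps * X ^+ 2.
Proof.
move=> c0 eps0; have [C HC] := sieve_BM; have c2 : 0 < c ^+ 2 by rewrite exprn_gt0.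
have [z z0 Hz] := natural_bound (2 * C%:R * c ^+ 2 / eps).
have zR : 0 < z%:R :> R by rewrite ltr0n.
have Cz : C%:R / z%:R * c ^+ 2 <= eps / 2.
  rewrite mulrAC ler_pdivrMr // mulrAC ler_pdivlMr // [X in _ <= X]mulrC -ler_pdivrMr //.
  by rewrite (_ : C%:R * c ^+ 2 * 2 = 2 * C%:R * c ^+ 2) //; ring.
have iG0 : v_invariant iota (sieve_set z O) by exact: sieve_V.
have perG0 y w : sieve_set z O y -> O w -> sieve_set z O (y + (modulus z)%:R * w) by exact: sieve_O_periodic.
have e2 : 0 < eps / 2 by rewrite divr_gt0.
have [X1 H1] := Bsum_regular emb (modulus_gt0 z) iG0 (@sieve_O_sub z) perG0 c0 e2.
exists (Num.max 0 X1) => X; rewrite ge_max => /andP[Xge0 /H1 {}H1].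
have cX0 : 0 <= c * X by rewrite mulr_ge0 // ltW.
have h1 := HC z O X _ z0 int_O Xge0 erefl; rewrite norm_OO mul1r divr1 in h1.
have h2 := HC z O (c * X) _ z0 int_O cX0 erefl; rewrite norm_OO mul1r divr1 in h2.
have h3 : C%:R / z%:R * c ^+ 2 * X ^+ 2 <= eps / 2 * X ^+ 2 by rewrite ler_wpM2r ?exprn_ge0.
have h4 : c ^+ 2 * (Bsum (sieve_set z O) X - BM O X) <= c ^+ 2 * (C%:R / z%:R * X ^+ 2).
  by case/andP: h1 => _ h1r; rewrite ler_wpM2l // ltW.
have h5 : 0 <= c ^+ 2 * (Bsum (sieve_set z O) X - BM O X).
  by case/andP: h1 => h1l _; rewrite mulr_ge0 // ltW.
move: h2 h3 H1 h4 h5; rewrite exprMn !ler_norml !mulrBr.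
rewrite (_ : c ^+ 2 * (C%:R / z%:R * X ^+ 2) = C%:R / z%:R * c ^+ 2 * X ^+ 2); last by ring.
rewrite (_ : C%:R / z%:R * (c ^+ 2 * X ^+ 2) = C%:R / z%:R * c ^+ 2 * X ^+ 2); last by ring.
rewrite (_ : eps / 2 * X ^+ 2 = eps * X ^+ 2 / 2); last by ring.
move: (Bsum _ (c * X)) (c ^+ 2 * Bsum _ X) (BM O (c * X)) (c ^+ 2 * BM O X) (C%:R / z%:R * c ^+ 2 * X ^+ 2) (eps * X ^+ 2).
move=> a1 a2 a3 a4 a5 a6 /andP[p1 p2] p3 /andP[p4 p5] p6 p7.
by apply/andP; split; lra.
Qed.

Lemma BM_bound : exists2 K : R, 0 <= K & forall X, 1 <= X -> BM O X <= K * X ^+ 2.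
Proof.
have [C HC] := sieve_BM; have [K K0 HK] := Bsum_bound emb; exists K => // X X1.
have X0 : 0 <= X by lra.
have h1 := HC 1%N O X _ isT int_O X0 erefl; rewrite norm_OO mul1r divr1 in h1.
have h2 := HK (sieve_set 1 O) X (sieve_V (z := 1) (I := O)) (@sieve_O_sub 1) X1.
by case/andP: h1 => h1 _; apply: le_trans h2; rewrite -subr_ge0.
Qed.

Lemma BM_ge0 I X : 0 <= BM I X.
Proof. by rewrite /BM big_seq; apply: sumr_ge0 => D /enump_prop[_ _ _]; rewrite subr_ge0. Qed.

Lemma BM_pos I X Y : fideal I -> X <= Y ->
  BM I X = \sum_(D <- enump (Mred I Y)) pos (X - (dnorm I D)%:R).
Proof.
move=> fI XY; rewrite -(big_enump_sub (P := Mred I X)) //; first last.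
- move=> D [D0 aD rD DY] nM; apply: pos_neg; rewrite subr_le0 ltW // ltNge; apply/negP => DX.
  by apply: nM.
- by move=> D [D0 aD rD DX]; split=> //; apply: le_trans XY.
- exact: fin_Mred.
rewrite /BM [LHS]big_seq [RHS]big_seq; apply: eq_bigr => D /enump_prop[_ _ _ DX].
by rewrite pos_id // subr_ge0.
Qed.

Lemma Mc_sum I X Y : fideal I -> X <= Y ->
  (Mc I X)%:R = \sum_(D <- enump (Mred I Y)) (if (dnorm I D)%:R <= X then 1 else 0) :> R.
Proof.
move=> fI XY; rewrite -(big_enump_sub (P := Mred I X)) //; first last.
- by move=> D [D0 aD rD DY] nM; case: ifP => // DX; case: nM.
- by move=> D [D0 aD rD DX]; split=> //; apply: le_trans XY.
- exact: fin_Mred.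
rewrite big_seq (eq_bigr (fun=> 1)); last by move=> D /enump_prop[_ _ _ ->].
by rewrite -big_seq big_const_seq count_predT iter_addr_0.
Qed.

(** [BM] is the integral of the increasing function [Mc], so its increments to the right and to the
    left enclose [Mc]. *)
Lemma Mc_upper I X (t : R) : fideal I -> 0 <= t -> (Mc I X)%:R * t <= BM I (X + t) - BM I X.
Proof.
move=> fI t0; have XY : X <= X + t by lra.
rewrite (BM_pos fI XY) (BM_pos fI (lexx (X + t))) (Mc_sum fI XY) mulr_suml -sumrB.
apply: ler_sum => D _; move: (dnorm I D)%:R => k.
case: ifP => [kX|/negbT]; first by rewrite mul1r !pos_id ?subr_ge0; lra.
rewrite -ltNge => kX; rewrite mul0r (@pos_neg (X - k)); last by lra.
by rewrite subr0 pos_ge0.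
Qed.

Lemma Mc_lower I X (t : R) : fideal I -> 0 <= t -> BM I X - BM I (X - t) <= (Mc I X)%:R * t.
Proof.
move=> fI t0; have XY : X - t <= X by lra.
rewrite (BM_pos fI XY) (BM_pos fI (lexx X)) (Mc_sum fI (lexx X)) mulr_suml -sumrB.
apply: ler_sum => D _; move: (dnorm I D)%:R => k.
case: ifP => [kX|/negbT].
  by rewrite mul1r (@pos_id (X - k)) ?subr_ge0 //; have := pos_ge (X - t - k); lra.
rewrite -ltNge => kX; rewrite mul0r (@pos_neg (X - k)); last by lra.
by have := pos_ge0 (X - t - k); lra.
Qed.

                                                                                                  
                                                  
(** A Tauberian step: [BM I] is close to [BM O], which is asymptotically homogeneous of degree 2. So
    its increments over $\eta X$ on either side of $X$ are $2\eta\,\mathrm{BM}(X)$ up to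
    $\eta^2\mathrm{BM}(X)$ and small errors. *)
Lemma Mc_asymp I (eps : R) : fideal I -> 0 < eps -> exists X0 : R, forall X, X0 <= X ->
  `|(Mc I X)%:R * X - 2 * BM O X| <= eps * X ^+ 2.
Proof.
move=> fI eps0; have [K K0 HK] := BM_bound.
(* [eta] is small enough for the second-order term $\eta^2\mathrm{BM}$ to use half of the allowance
   $\eta\epsilon X^2$; the approximation errors, with constant $\epsilon\eta/16$, use the rest. *)
have [eta [eta0 eta1 eta2]] : exists eta : R, [/\ 0 < eta, eta <= 1 / 2 & eta * (K + 1) <= eps / 2].
  have k1 : 0 < K + 1 by lra.
  exists (Num.min (1 / 2) (eps / 2 / (K + 1))); split.
  - by rewrite lt_min !divr_gt0.
  - by rewrite ge_min lexx.
  - by rewrite -ler_pdivlMr // ge_min lexx orbT.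
have e1 : 0 < eps * eta / 16 by rewrite divr_gt0 // mulr_gt0.
have cp : 0 < 1 + eta by lra. have cm : 0 < 1 - eta by lra.
have [X1 H1] := BM_compare fI e1.
have [X2 H2] := BM_regular cp e1; have [X3 H3] := BM_regular cm e1.
exists (Num.max 1 (Num.max (2 * Num.max 0 X1) (Num.max X2 X3))) => X.
rewrite !ge_max => /andP[Xge1 /andP[HX1 /andP[HX2 HX3]]].
have HX1' : X1 <= X / 2.
  have : X1 <= Num.max 0 X1 by rewrite le_max lexx orbT.
  lra.
have c1 := H1 X _; have c2 := H1 ((1 + eta) * X) _; have c3 := H1 ((1 - eta) * X) _.
have {}c1 := c1 ltac:(lra); have {}c2 := c2 ltac:(nra); have {}c3 := c3 ltac:(nra).
have r2 := H2 X HX2; have r3 := H3 X HX3.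
have X0 : 0 <= X by lra.
have eX : 0 <= eta * X by rewrite mulr_ge0 // ltW.
have u := Mc_upper X fI eX; have l := Mc_lower X fI eX.
rewrite (_ : X + eta * X = (1 + eta) * X) in u; last by ring.
rewrite (_ : X - eta * X = (1 - eta) * X) in l; last by ring.
have B0 := BM_ge0 O X; have BK := HK X Xge1.
have E2 : 0 <= eps * eta / 16 * X ^+ 2 by rewrite mulr_ge0 ?exprn_ge0 // ltW.
have c2' : eps * eta / 16 * ((1 + eta) * X) ^+ 2 <= 4 * (eps * eta / 16 * X ^+ 2).
  have -> : eps * eta / 16 * ((1 + eta) * X) ^+ 2 = (1 + eta) ^+ 2 * (eps * eta / 16 * X ^+ 2) by ring.
  by rewrite ler_wpM2r //; nra.
have c3' : eps * eta / 16 * ((1 - eta) * X) ^+ 2 <= eps * eta / 16 * X ^+ 2.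
  have -> : eps * eta / 16 * ((1 - eta) * X) ^+ 2 = (1 - eta) ^+ 2 * (eps * eta / 16 * X ^+ 2) by ring.
  by rewrite -[X in _ <= X]mul1r ler_wpM2r //; nra.
have K2 : eta * BM O X <= eps / 2 * X ^+ 2.
  apply: le_trans (ler_wpM2l (ltW eta0) BK) _; rewrite mulrA ler_wpM2r ?exprn_ge0 //.
  by have := eta0; nra.
have e2B : eta ^+ 2 * BM O X <= eta * (eps / 2 * X ^+ 2).
  by rewrite expr2 -mulrA ler_wpM2l // ltW.
suff : `|(Mc I X)%:R * (eta * X) - 2 * eta * BM O X| <= eta * (eps * X ^+ 2).
  rewrite (_ : _ - _ = eta * ((Mc I X)%:R * X - 2 * BM O X)); last by ring.
  by rewrite normrM (gtr0_norm eta0) ler_pM2l.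
move: c1 c2 c3 r2 r3; rewrite !ler_norml => /andP[p1 p2] /andP[p3 p4] /andP[p5 p6] /andP[p7 p8] /andP[p9 p10].
have q1 : (1 + eta) ^+ 2 * BM O X = BM O X + 2 * eta * BM O X + eta ^+ 2 * BM O X by ring.
have q2 : (1 - eta) ^+ 2 * BM O X = BM O X - 2 * eta * BM O X + eta ^+ 2 * BM O X by ring.
rewrite q1 in p7 p8; rewrite q2 in p9 p10.
have q3 : eta * (eps / 2 * X ^+ 2) = 8 * (eps * eta / 16 * X ^+ 2) by field.
have q4 : eta * (eps * X ^+ 2) = 16 * (eps * eta / 16 * X ^+ 2) by field.
rewrite q3 in e2B; rewrite q4.
have e2B0 : 0 <= eta ^+ 2 * BM O X by rewrite mulr_ge0 ?exprn_ge0 // ltW.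
move: u l p1 p2 p3 p4 p5 p6 p7 p8 p9 p10 c2' c3' e2B e2B0 E2.
move: (eps * eta / 16 * X ^+ 2) (eps * eta / 16 * _ ^+ 2) (eps * eta / 16 * _ ^+ 2) (eta ^+ 2 * BM O X) (2 * eta * BM O X) ((Mc I X)%:R * (eta * X)).
move: (BM I ((1 + eta) * X)) (BM I ((1 - eta) * X)) (BM I X) (BM O ((1 + eta) * X)) (BM O ((1 - eta) * X)) (BM O X).
clear.
move=> a1 a2 a3 a4 a5 a6 b1 b2 b3 b4 b5 b6 *.
by apply/andP; split; lra.
Qed.

Lemma Mc_compare I J (eps : R) : fideal I -> fideal J -> 0 < eps -> exists X0 : R, forall X, X0 <= X ->
  `|(Mc I X)%:R - (Mc J X)%:R| <= eps * X.
Proof.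
move=> fI fJ eps0; have e2 : 0 < eps / 2 by rewrite divr_gt0.
have [X1 H1] := Mc_asymp fI e2; have [X2 H2] := Mc_asymp fJ e2.
exists (Num.max 1 (Num.max X1 X2)) => X; rewrite !ge_max => /andP[Xge1 /andP[/H1 {}H1 /H2 {}H2]].
have X0 : 0 < X by lra.
rewrite -(ler_pM2r X0) -[X in _ * X <= _](gtr0_norm X0) -normrM mulrBl.
rewrite (_ : _ - _ = ((Mc I X)%:R * X - 2 * BM O X) - ((Mc J X)%:R * X - 2 * BM O X)); last by ring.
apply: le_trans (ler_normB _ _) _.
have -> : eps * X * X = eps / 2 * X ^+ 2 + eps / 2 * X ^+ 2 by field.
exact: lerD.
Qed.

(** A box of $(m+1)^n$ integers, with $m^n$ proportional to [X], shifted by a large integer so that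
    all its points are balanced; by [V_proper] each orbit meets it in boundedly many points. *)
Lemma count_orbits_lower : exists2 K : nat, (0 < K)%N & exists X0 : R, forall X, X0 <= X ->
  X <= K%:R * (size (enump (orbits O X)))%:R.
Proof.
have [E E0 HE] := natural_bound (\sum_i nrm (e i)).
pose B : R := (3 * n)%:R ^+ n.
have fB := V_proper emb B; set PB := (fun u => _) in fB.
pose Bl := enump PB.
have iO : v_invariant iota O by move=> u x /V_unit[_ Ou _] Ox; apply: OM.
have bO : bounded_denom iota O by apply: sub_bounded_denom.
exists ((3 * E) ^ n * (size Bl).+1)%N; first by rewrite muln_gt0 expn_gt0 muln_gt0 E0.
exists ((3 * E)%:R ^+ n) => X HX.
have E3 : 0 < (3 * E)%:R ^+ n :> R by rewrite exprn_gt0 // ltr0n muln_gt0 E0.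
have Z1 : 1 <= X / (3 * E)%:R ^+ n by rewrite ler_pdivlMr // mul1r.
have [m /andP[mZ Zm]] := nat_root n0 (le_trans ler01 Z1).
have m0 : (0 < m)%N.
  by rewrite lt0n; apply: contraTneq Zm => ->; rewrite -leNgt expr1n.
(* The shift $2Em$ dominates the box part, which is at most $w=Em$ at each place; so every absolute
   value lies between $w$ and $3w$. *)
pose f (g : {ffun 'I_n -> 'I_m.+1}) : F := (2 * E * m)%:R + \sum_i ((g i : nat)%:Z)%:~R * e i.
have fI : injective f.
  move=> g g' /addrI /(coord_inj emb) H; apply/ffunP => i; apply/val_inj.
  by have /= [] := congr1 (@^~ i) H.
have fO' g : O (f g).
  apply: OD; first exact: O_nat.
  apply: subgrp_sum => [|i _]; first exact: O_subgrp.
  by apply: OM; [exact: O_int|exact: emb_basis_int emb _].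
pose w : R := E%:R * m%:R.
have w0 : 0 < w by rewrite mulr_gt0 // ltr0n.
have fa g j : w <= absv j (f g) <= 3 * w.
  set y := \sum_i ((g i : nat)%:Z)%:~R * e i.
  have yw : absv j y <= w.
    apply: le_trans (absv_le_nrm s j y) _; apply: le_trans (nrm_sum _ _ _ _) _.
    apply: (@le_trans _ _ (\sum_i m%:R * nrm (e i))); last first.
      by rewrite -mulr_sumr /w mulrC ler_wpM2r ?ler0n.
    apply: ler_sum => i _; rewrite nrm_int ler_wpM2r ?nrm_ge0 //.
    by rewrite -[m%:R]/(m%:Z%:~R) ler_int ger0_norm // lez_nat -ltnS.
  have kE : absv j (2 * E * m)%:R = 2 * w by rewrite absv_nat !natrM -mulrA.
  have h1 := absvD s j (2 * E * m)%:R y; rewrite kE -/(f g) in h1.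
  have h2 : 2 * w <= absv j (f g) + absv j y.
    rewrite -kE -(absvN s j y); apply: le_trans (absvD s j _ _); by rewrite addrK.
  by apply/andP; split; lra.
have f0 g : f g != 0.
  rewrite -(absv_eq0 s (Ordinal n0)) gt_eqF //.
  by case/andP: (fa g (Ordinal n0)) => + _; apply: lt_le_trans.
have Nf g : w ^+ n <= Nm (f g) <= (3 * w) ^+ n.
  have PE (x : R) : x ^+ n = \prod_(j < n) x by rewrite prodr_const card_ord.
  rewrite NmE !PE; apply/andP; split.
    by apply: ler_prod => j _; rewrite (ltW w0); case/andP: (fa g j).
  by apply: ler_prod => j _; rewrite absv_ge0; case/andP: (fa g j).
have wX : (3 * w) ^+ n <= X.
  have -> : 3 * w = (3 * E)%:R * m%:R by rewrite /w natrM mulrA.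
  by rewrite exprMn mulrC -ler_pdivlMr.
have nf g : nrm (f g) ^+ n <= B * Nm (f g).
  apply: (@le_trans _ _ ((n%:R * (3 * w)) ^+ n)).
    rewrite lerXn2r // ?nnegrE ?nrm_ge0 // ?mulr_ge0 ?ler0n ?(ltW w0) //.
    apply: (@le_trans _ _ (\sum_(j < n) 3 * w)); first by apply: ler_sum => j _; case/andP: (fa g j).
    by rewrite sumr_const card_ord -[X in X <= _]mulr_natl.
  have -> : n%:R * (3 * w) = (3 * n)%:R * w by rewrite natrM; ring.
  rewrite exprMn ler_wpM2l ?exprn_ge0 ?ler0n //.
  by case/andP: (Nf g).
have fX := fin_orbits emb X iO bO.
pose T := enump (orbits O X).
pose Q x := x \in codom f.
have fQ : fin Q by exists (codom f).
have szQ : ((m.+1 ^ n)%N <= size (enump Q))%N.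
  have -> : (m.+1 ^ n = size (codom f))%N by rewrite size_codom card_ffun !card_ord.
  apply: uniq_leq_size; first by apply/injectiveP.
  by move=> x xf; apply: enump_in.
have le : (size (enump Q) <= \sum_(D <- T) size Bl)%N.
  apply: (size_enump_fibre (f := vrep) fQ).
    move=> _ /codomP[g ->]; have yv := vrepK iota (f g); apply: enump_in => //; split.
    - exact: invariant_veq iO yv (fO' g).
    - exact: veq_neq0 yv (f0 g).
    - exact: vrep_id.
    - by rewrite (Nm_veq emb yv); apply: le_trans wX; case/andP: (Nf g).
  move=> D _; have [[x0 [/codomP[g0 Eg0] xD]]|nx] := pselect (exists x, Q x /\ vrep x = D); last first.
    rewrite (_ : enump _ = [::]) //; apply/nilP; rewrite /nilp -leqn0 leqNgt -has_predT.
    by apply/hasPn => x /enump_prop H; case: nx; exists x.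
  apply: (@leq_trans (size [seq u * x0 | u <- Bl])); last by rewrite size_map.
  apply: uniq_leq_size; first exact: enump_uniq.
  move=> y /enump_prop[/codomP[g Eg] yD].
  have [u Vu Ey] : veq x0 y by apply/vrepP; rewrite xD yD.
  apply/mapP; exists u => //; apply: enump_in => //; split=> //.
  exists x0; rewrite -Ey Eg0; split; [exact: f0|exact: nf|].
  have -> : Nm (f g0) = Nm y by rewrite Ey NmM (Nm_V emb Vu) mul1r Eg0.
  by rewrite Eg.
have final : ((m.+1 ^ n)%N <= size T * (size Bl).+1)%N.
  apply: leq_trans (leq_trans szQ le) _; rewrite big_const_seq count_predT iter_addn_0 mulnC.
  by rewrite leq_mul2l leqnSn orbT.
have : X < (3 * E)%:R ^+ n * m.+1%:R ^+ n by rewrite mulrC -ltr_pdivrMr.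
move=> /ltW h1; apply: le_trans h1 _; rewrite -!natrX -!natrM ler_nat -mulnA leq_mul2l.
by rewrite [((size Bl).+1 * _)%N]mulnC final orbT.
Qed.

(** For integral $D$ put $M=\mathrm{al}(4D)^{-1}$, so that $4D\,O=K M^2$ with $K,M$ integral. By
    [tail_count] most $D$ have $N(M)\le z$; the finitely many such $M$ split them into fibres, each
    embedding by $D\mapsto4D$ in the set counted for $M^{-1}$. *)
Lemma total_lower : exists2 K : nat, (0 < K)%N & exists X0 : R, forall X, X0 <= X ->
  X <= K%:R * (\sum_i Mc (rep i) X)%:R.
Proof.
have [K1 K10 [X1 H1]] := count_orbits_lower.
have [C C0 HC] := tail_count emb rep_frac rep_cover.
have [W [W0 WE]] : exists W : R, 0 < W /\ W = 4 ^+ n by exists (4 ^+ n); rewrite exprn_gt0.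
(* With this [z] the orbits with $N(M)>z$ are at most half of those supplied by
   [count_orbits_lower]; [W] is the norm of 4. *)
have [z z0 Hz] := natural_bound (2 * K1%:R * C%:R * W).
have zR : 0 < z%:R :> R by rewrite ltr0n.
have z1 : 1 <= z%:R :> R by rewrite ler1n.
have four0 : 4 != 0 :> F by rewrite (natF_eq0 iota).
have [C1 _ HCI] := count_ideals emb rep_frac rep_cover.
have [fMs _] := HCI _ z1.
pose Ms := enump (fun I => int_ideal I /\ (ixn O I)%:R <= z%:R :> R).
have iO : v_invariant iota O by move=> u x /V_unit[_ Ou _] Ox; apply: OM.
have bO : bounded_denom iota O by apply: sub_bounded_denom.
have [K K0 HK] := natural_bound (2 * K1%:R * W * (size Ms)%:R).
exists K => //; exists (Num.max W (W * X1)) => Y; rewrite ge_max => /andP[YW YX1].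
have [X EX] : exists X, Y = W * X by exists (Y / W); rewrite mulrCA divff ?mulr1 // gt_eqF.
have X1X : X1 <= X by move: YX1; rewrite EX ler_pM2l.
have Xge1 : 1 <= X by move: YW; rewrite EX -{1}[W]mulr1 ler_pM2l.
have X0 : 0 <= X by lra.
have fX := fin_orbits emb X iO bO.
(* The factor 4 puts 1 in [al (4 * D)], which makes its inverse an integral ideal. *)
pose M D := iinv (al (4 * D)).
have MP D : O D -> D != 0 -> [/\ fideal (al (4 * D)), int_ideal (M D), int_ideal (smul (4 * D) (imul (al (4 * D)) (al (4 * D)))) &
    smul (4 * D) O = imul (smul (4 * D) (imul (al (4 * D)) (al (4 * D)))) (imul (M D) (M D))].
  move=> OD D0; have D40 : 4 * D != 0 by rewrite mulf_neq0.
  have fA := al_frac iota D40; set A := al (4 * D) in fA *.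
  have A1 : A 1.
    exists 0; first exact: O0.
    have -> : (0 ^+ 2 - 1 ^+ 2 * (4 * D)) / 4 = - D by field.
    exact: ON.
  have fM : fideal (M D) by exact: iinv_frac.
  split=> //; first by split=> // x /(_ 1 A1); rewrite mulr1.
    exact: al_int.
  rewrite imul_smul; congr (smul _ _); rewrite imulA -[imul (imul A A) (M D)]imulA [imul A (M D)]imulV //.
  by rewrite [imul A O]imulC imul1 // imulV.
have NE D : O D -> D != 0 -> (ixn O (smul (4 * D) (imul (al (4 * D)) (al (4 * D)))) * ixn O (M D) ^ 2)%:R = W * Nm D.
  move=> OD D0; have [fA [fM MO] [fK KO] E] := MP D OD D0; have fMM := imul_frac fM fM.
  have MMO x : imul (M D) (M D) x -> O x by apply: imul_sub => // u v /MO Ou /MO Ov; exact: OM.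
  rewrite WE -(Nm_nat s) -NmM -(ixn_principal emb) ?mulf_neq0 //; last by apply: OM => //; exact: O_nat.
  by rewrite E (norm_imul emb rep_cover fK KO fMM MMO) (norm_imul emb rep_cover fM MO fM MO) mulnn.
pose P1 D := orbits O X D /\ (z < ixn O (M D))%N.
pose P2 D := orbits O X D /\ ~ (z < ixn O (M D))%N.
have fP2 : fin P2 by apply: fin_sub fX _ => D [].
have [fP1 t1] : fin P1 /\ (size (enump P1))%:R <= C%:R * Y / z%:R.
  apply: (HC (smul 4 O)) => //; first exact: smulO_frac.
    by rewrite EX mulr_ge0 // ltW.
  move=> D [[OD D0 rD NX] zM]; split=> //; have [fA iM iK E] := MP D OD D0.
  exists (M D), (smul (4 * D) (imul (al (4 * D)) (al (4 * D)))); split=> //.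
    by rewrite NE // EX ler_pM2l.
  by rewrite smul_mul mulrC.
have split12 : (size (enump (orbits O X)) <= size (enump P1) + size (enump P2))%N.
  rewrite -size_cat; apply: uniq_leq_size; first exact: enump_uniq.
  move=> D /enump_prop oD; rewrite mem_cat; have [zM|zM] := boolP (z < ixn O (M D))%N.
    by apply/orP; left; apply: enump_in.
  by apply/orP; right; apply: enump_in => //; split=> //; apply/negP.
pose S := (\sum_i Mc (rep i) Y)%N.
(* On a fibre [al (4 * D)] is one fixed ideal, whose count equals that of the representative of its
   class. *)
have t2 : (size (enump P2) <= \sum_(I <- Ms) S)%N.
  apply: (size_enump_fibre (f := M) fP2).
    move=> D [[OD D0 rD NX] zM]; have [_ iM _ _] := MP D OD D0.
    by apply: enump_in => //; split=> //; rewrite ler_nat leqNgt; apply/negP.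
  move=> I _; have [fI|nfI] := pselect (fideal I); last first.
    rewrite (_ : enump _ = [::]) //; apply/nilP; rewrite /nilp -leqn0 leqNgt -has_predT.
    apply/hasPn => D /enump_prop [[[OD D0 _ _] _] E]; case: nfI; rewrite -E.
    by have [_ [] ] := MP D OD D0.
  have fJ := iinv_frac fI; have [i [x x0 Ei]] := rep_cover fJ.
  apply: (@leq_trans (Mc (iinv I) Y)); last first.
    by rewrite -(Mc_smul Y x0 fJ) -Ei /S (bigD1 i) //= leq_addr.
  apply: (@size_enump_inj _ _ _ _ (fun D => vrep (4 * D))).
  - exact: fin_Mred.
  - move=> D [[[OD D0 rD NX] zM] ED]; have yv := vrepK iota (4 * D).
    have [fA iM [fK KO] E] := MP D OD D0.
    have EA : al (4 * D) = iinv I by rewrite -ED (iinvK emb rep_cover).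
    split.
    + by apply: veq_neq0 yv _; rewrite mulf_neq0.
    + by have [u Vu ->] := yv; rewrite al_V.
    + exact: vrep_id.
    + rewrite (dnorm_veq fJ yv) !dnormE -EA.
      apply: (@le_trans _ _ (W * Nm D)); last by rewrite EX ler_pM2l.
      rewrite -NE // ler_nat leq_pmulr // expn_gt0; apply/orP; left.
      by have [f1 f2] := iM; apply: (ixn_gt0 emb).
  - move=> D D' [[[_ _ rD _] _] _] [[[_ _ rD' _] _] _] /vrepP[u Vu E].
    rewrite -rD -rD'; apply/vrepP; exists u => //.
    by apply: (mulfI four0); rewrite E; ring.
have h1 := H1 X X1X.
have h2 : (size (enump (orbits O X)))%:R <= C%:R * Y / z%:R + (size Ms)%:R * S%:R :> R.
  apply: (@le_trans _ _ ((size (enump P1))%:R + (size (enump P2))%:R)); first by rewrite -natrD ler_nat.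
  apply: lerD => //; rewrite -natrM ler_nat; apply: leq_trans t2 _.
  by rewrite big_const_seq count_predT iter_addn_0 mulnC.
have h3 : K1%:R * (C%:R * Y / z%:R) <= X / 2.
  rewrite !mulrA ler_pdivrMr // EX.
  have -> : K1%:R * C%:R * (W * X) = (2 * K1%:R * C%:R * W) * (X / 2) by field.
  by rewrite mulrC ler_wpM2l // divr_ge0.
have h4 : X <= X / 2 + K1%:R * ((size Ms)%:R * S%:R).
  apply: le_trans h1 _; apply: le_trans (ler_wpM2l (ler0n _ K1) h2) _.
  by rewrite mulrDr lerD2r.
have h5 : W * X <= (2 * K1%:R * W * (size Ms)%:R) * S%:R.
  have -> : 2 * K1%:R * W * (size Ms)%:R * S%:R = W * (2 * (K1%:R * ((size Ms)%:R * S%:R))) by ring.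
  rewrite ler_pM2l //; move: h4; move: (K1%:R * _) => q; lra.
by rewrite {1}EX; apply: le_trans h5 _; rewrite ler_wpM2r ?ler0n.
Qed.

End Counting.

                                                          

(** * From subfields of the algebraic numbers to an abstract field, and square-root fields *)

Definition image (F : fieldType) (iota : F -> algC) (A : set F) : cset := fun x => exists2 y, A y & x = iota y.

Section Subfield.
Variables (K : cset).
Hypothesis subK : is_subfield K.

Lemma subfieldD x y : K x -> K y -> K (x + y).
Proof.
case: subK => K0 _ KB _ _ Kx Ky; rewrite -[y]opprK; apply: (KB) => //.
by rewrite -sub0r; apply: (KB).
Qed.

Lemma subfieldX x k : K x -> K (x ^+ k).
Proof.
case: subK => _ K1 _ KM _ Kx; elim: k => [|k IH]; first by rewrite expr0.
by rewrite exprS; apply: (KM).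
Qed.

Lemma subfield_sum k (f : 'I_k -> algC) : (forall i, K (f i)) -> K (\sum_i f i).
Proof.
move=> Kf; apply: (big_ind K) => //; first by case: subK.
exact: subfieldD.
Qed.

Lemma subfield_nat k : K k%:R.
Proof.
case: subK => K0 K1 _ _ _; elim: k => [|k IH] //; rewrite -addn1 natrD; exact: subfieldD.
Qed.

Lemma subfield_int (k : int) : K k%:~R.
Proof.
case: subK => K0 _ KB _ _; case: k => k; first exact: subfield_nat.
by rewrite NegzE rmorphN /= -sub0r; apply: (KB) => //; exact: subfield_nat.
Qed.

Lemma subfield_rat (q : rat) : K (ratr q).
Proof.
case: subK => _ _ _ KM KV; rewrite /ratr; apply: (KM); first exact: subfield_int.
by apply: (KV); [exact: subfield_int|rewrite intr_eq0 denq_neq0].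
Qed.

Lemma subfield_horner (p : {poly rat}) x : K x -> K (pQtoC p).[x].
Proof.
move=> Kx; rewrite horner_coef; apply: subfield_sum => i.
case: subK => _ _ _ KM _; rewrite coef_map /=; apply: (KM); first exact: subfield_rat.
exact: subfieldX.
Qed.

End Subfield.

(** A primitive element scaled to be an algebraic integer generates an abstract copy of [K], and its
    powers supply the integral family. *)
Lemma number_field_image (K : cset) : number_field K ->
  exists (F : fieldExtType rat) (iota : {rmorphism F -> algC}),
    K = image iota setT /\ exists n s e d, @field_embeddings F iota n s e d.
Proof.
move=> [subK [m [e [Ke eK]]]].
have [z [a Dz] [ps Dps]] := algC_PET (codom e).
have [k k0 kz] := Aint_scale z.
have kC : k%:~R != 0 :> algC by rewrite intr_eq0.
have [F [iota [s1 Ds1 gen1]]] := num_field_exists [:: k%:~R * z].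
case: s1 Ds1 gen1 => [|w [|//]] //= [Dw] gen1.
have gen x : exists p : {poly rat}, iota x = (pQtoC p).[iota w].
  have : x \in <<1; w>>%VS by rewrite -adjoin_seq1 gen1 memvf.
  case/Fadjoin_polyP => p p1 ->.
  have [q Dq] : exists q : {poly rat}, p = map_poly (in_alg F) q.
    have [c Ec] := choice (fun i => vlineP _ _ (polyOverP p1 i)).
    exists (\poly_(i < size p) c i).
    apply/polyP => i; rewrite coef_map coef_poly /=; case: ltnP => [ip|/(nth_default 0) ->].
      by rewrite -Ec.
    by rewrite scale0r.
  exists q; rewrite Dq -horner_map -map_poly_comp; congr (_.[_]).
  by apply: eq_map_poly => c /=; rewrite -in_algE -[LHS]/((iota \o in_alg F) c) fmorph_eq_rat.
exists F, iota; split; last by apply: field_embeddings_exist gen _; rewrite Dw.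
have Kz : K z.
  rewrite Dz; apply: subfield_sum => // i; rewrite -mulr_natl.
  have [_ _ _ KM _] := subK; apply: (KM); first exact: subfield_nat.
  have : (codom e)`_i \in codom e by rewrite mem_nth.
  by case/codomP => j ->.
have zw : iota (k%:~R^-1 * w) = z by rewrite rmorphM fmorphV rmorph_int Dw mulKf.
apply: set_anti => x.
  move=> /eK[c ->].
  have eE i : exists y, e i = iota y.
    have : e i \in codom e by exact: codom_f.
    rewrite Dps => /mapP[p _ ->]; exists (map_poly ratr p).[k%:~R^-1 * w].
    rewrite -horner_map -map_poly_comp zw; congr (_.[_]).
    by apply: eq_map_poly => b /=; rewrite fmorph_rat.
  have [y yE] := choice eE; exists (\sum_i ratr (c i) * y i) => //.
  by rewrite rmorph_sum; apply: eq_bigr => i _; rewrite yE rmorphM fmorph_rat.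
move=> [y _ ->]; have [p ->] := gen y; apply: subfield_horner => //.
rewrite Dw; have [_ _ _ KM _] := subK; apply: (KM) => //; exact: subfield_int.
Qed.

Section Image.
Variables (F : fieldType) (iota : {rmorphism F -> algC}).
Local Notation O := (integers iota).
Local Notation im := (image iota).
Local Notation K := (im setT).
Local Notation fideal := (fideal iota).
Implicit Types (I J A B : set F) (x y D r t : F).

Definition preimage (I : cset) : set F := fun y => I (iota y).

Lemma image_K x : K (iota x). Proof. by exists x. Qed.

Lemma imageE A x : im A (iota x) <-> A x.
Proof. by split=> [[y Ay /(fmorph_inj iota) ->]|Ax] //; exists x. Qed.

Lemma image_O x : ring_of_int K (iota x) <-> O x.
Proof. by split=> [[]|Ox] //; split=> //; exact: image_K. Qed.

Lemma image_preimage (I : cset) : (forall x : algC, I x -> K x) -> im (preimage I) = I.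
Proof.
move=> IK; apply: set_anti => x; first by move=> [y Iy ->].
by move=> Ix; have [y _ E] := IK _ Ix; exists y; rewrite // /preimage -E.
Qed.

Lemma frac_ideal_image A : fideal A -> frac_ideal K (im A).
Proof.
case=> A0 AD AM [x Ax x0] [c [Oc c0] Ac]; split.
- by move=> _ [y _ ->]; exact: image_K.
- split; first by exists 0; rewrite ?rmorph0.
  by move=> _ _ [y Ay ->] [z Az ->]; exists (y + z); [exact: AD|rewrite rmorphD].
- by move=> _ _ [[r _ ->] Or] [y Ay ->]; exists (r * y); [exact: AM|rewrite rmorphM].
- by exists (iota x); rewrite fmorph_eq0; split=> //; exists x.
- exists (iota c); split; first exact/image_O; rewrite fmorph_eq0; split=> // _ [y Ay ->].
  by rewrite -rmorphM; apply/image_O; exact: Ac.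
Qed.

Lemma frac_ideal_imageP (I : cset) : frac_ideal K I -> exists2 A, fideal A & I = im A.
Proof.
case=> IK [I0 ID] IM [x [Ix x0]] [c [Oc [c0 Ic]]].
exists (preimage I); last by rewrite image_preimage.
have [c' _ Ec] := Oc.1; have [x' _ Ex] := IK x Ix; split.
- by rewrite /preimage rmorph0.
- by move=> y z Iy Iz; rewrite /preimage rmorphD; apply: ID.
- by move=> r y Or Iy; rewrite /preimage rmorphM; apply: IM => //; exact/image_O.
- by exists x'; rewrite /preimage -?Ex // -(fmorph_eq0 iota) -Ex.
- exists c'; first by rewrite -(fmorph_eq0 iota) -Ec; split=> //; apply/image_O; rewrite -Ec.
  by move=> y Iy; apply/image_O; rewrite rmorphM -Ec; apply: Ic.
Qed.

Lemma ideal_equiv_image A B : ideal_equiv K (im A) (im B) <-> exists2 x, x != 0 & B = smul x A.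
Proof.
split=> [[_ [[x _ ->] x0 H]]|[x x0 ->]].
  exists x; first by rewrite -(fmorph_eq0 iota).
  apply: set_ext => y; split.
    move=> By; have [|_ [[a Aa ->]]] := (H (iota y)).1; first by exists y.
    by rewrite -rmorphM => /(fmorph_inj iota) ->; exists a.
  move=> [a Aa ->]; apply/imageE; apply/H; exists (iota a); split; first by exists a.
  by rewrite rmorphM.
exists (iota x); rewrite fmorph_eq0; split=> //; first exact: image_K.
move=> y; split=> [[_ [a Aa ->] ->]|[_ [[a Aa ->] ->]]].
  by exists (iota a); split; [exists a|rewrite rmorphM].
by exists (x * a); [exists a|rewrite rmorphM].
Qed.

Lemma class_number_image h : class_number K h -> exists rep : 'I_h -> set F,
  [/\ (forall i, fideal (rep i)),
      (forall A, fideal A -> exists i, exists2 x, x != 0 & rep i = smul x A) &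
      (forall i j x, x != 0 -> rep j = smul x (rep i) -> i = j)].
Proof.
move=> [rep [repf repi repc]].
have H i : exists A, fideal A /\ rep i = im A.
  by have [A fA E] := frac_ideal_imageP (repf i); exists A.
have [rep' HR] := choice H; exists rep'; split.
- by move=> i; case: (HR i).
- move=> A /frac_ideal_image /repc[i]; have [_ ->] := HR i.
  by move=> /ideal_equiv_image ?; exists i.
- move=> i j x x0 E; apply: repi; have [_ ->] := HR i; have [_ ->] := HR j.
  by apply/ideal_equiv_image; exists x.
Qed.

Lemma ideal_norm_image A k : ideal_norm_is K (im A) k <-> has_index O A k.
Proof.
split=> [[r [rO rP]]|[r [rO rP]]].
  have H i : exists x, r i = iota x by have [[x _ ->] _] := rO i; exists x.
  have [r' E] := choice H; exists r'; split=> [i|x Ox]; first by apply/image_O; rewrite -E.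
  have [|i [Ai iU]] := rP (iota x); first exact/image_O.
  exists i; split=> [|j Aj]; first by apply/imageE; rewrite rmorphB -E.
  by apply: iU; rewrite E -rmorphB; apply/imageE.
exists (fun i => iota (r i)); split=> [i|_ [[x _ ->] Ox]]; first exact/image_O.
have [i [Ai iU]] := rP x Ox; exists i; split=> [|j]; first by rewrite -rmorphB; apply/imageE.
by rewrite -rmorphB => /imageE; exact: iU.
Qed.

Let two0 : 2 != 0 :> F. Proof. by rewrite (natF_eq0 iota). Qed.

Definition nonsquare D := forall k : F, D <> k ^+ 2.

Definition sqrt_field D : cset := fun u : algC => exists p q, u = iota p + iota q * sqrtC (iota D).

Local Notation th D := (sqrtC (iota D)).

Lemma sqrt_sqr D : th D ^+ 2 = iota D. Proof. exact: sqrtCK. Qed.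

Lemma sqrt_notin D k : nonsquare D -> th D <> iota k.
Proof.
by move=> nD E; apply: (nD k); apply: (fmorph_inj iota); rewrite rmorphXn -E sqrt_sqr.
Qed.

Lemma coord_inj2 D p q p' q' : nonsquare D ->
  iota p + iota q * th D = iota p' + iota q' * th D -> p = p' /\ q = q'.
Proof.
move=> nD E; have E' : iota (p - p') = iota (q' - q) * th D.
  transitivity (iota p + iota q * th D - iota p' - iota q * th D); first by rewrite rmorphB; ring.
  by rewrite E rmorphB; ring.
have [qq|qq] := eqVneq q q'.
  split=> //; apply: (fmorph_inj iota); apply/eqP; rewrite -subr_eq0 -rmorphB E' qq subrr.
  by rewrite rmorph0 mul0r.
case: (@sqrt_notin D ((p - p') / (q' - q)) nD); rewrite fmorph_div E' mulrC mulKf //.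
by rewrite fmorph_eq0 subr_eq0 eq_sym.
Qed.

Lemma nonsquare_neq0 D : nonsquare D -> D != 0.
Proof. by move=> nD; apply/eqP => D0; apply: (nD 0); rewrite expr0n. Qed.

Lemma quad_ext_sqrt D : nonsquare D -> quad_ext K (sqrt_field D).
Proof.
move=> nD; have t2 := sqrt_sqr D; split.
- split.
  + by exists 0, 0; rewrite rmorph0 mul0r addr0.
  + by exists 1, 0; rewrite rmorph0 mul0r addr0 rmorph1.
  + by move=> _ _ [p [q ->]] [p' [q' ->]]; exists (p - p'), (q - q'); rewrite !rmorphB; ring.
  + move=> _ _ [p [q ->]] [p' [q' ->]]; exists (p * p' + q * q' * D), (p * q' + q * p').
    by move: (th D) t2 => y t2; rewrite !(rmorphD, rmorphM) -t2; ring.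
  + move=> _ [p [q ->]] nz; pose N := p ^+ 2 - q ^+ 2 * D.
    have N0 : N != 0.
      apply/eqP => N0; have [q0|q0] := eqVneq q 0.
        move: N0; rewrite /N q0 expr0n mul0r subr0 => /eqP; rewrite expf_eq0 /= => /eqP p0.
        by move: nz; rewrite p0 q0 rmorph0 mul0r addr0 eqxx.
      apply: (nD (p / q)); rewrite expr_div_n; move/eqP: N0; rewrite subr_eq0 => /eqP ->.
      by rewrite mulrC mulKf // expf_neq0.
    exists (p / N), (- q / N).
    have E : (iota p + iota q * th D) * (iota p - iota q * th D) = iota N.
      by move: (th D) t2 => y t2; rewrite /N rmorphB (rmorphM iota (q ^+ 2)) !(rmorphXn iota) -t2; ring.
    apply: (mulfI nz); rewrite divff // !fmorph_div rmorphN.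
    have -> : iota p / iota N + - iota q / iota N * th D = (iota p - iota q * th D) / iota N by ring.
    by rewrite mulrA E divff // fmorph_eq0.
- by move=> _ [x _ ->]; exists x, 0; rewrite rmorph0 mul0r addr0.
- exists 1, (th D); split.
  + by exists 1, 0; rewrite rmorph0 mul0r addr0 rmorph1.
  + by exists 0, 1; rewrite rmorph0 rmorph1 mul1r add0r.
  + move=> _ [p [q ->]]; exists (iota p), (iota q); rewrite mulr1; split=> //; try exact: image_K.
    by move=> _ _ [p' _ ->] [q' _ ->]; rewrite mulr1 => /(coord_inj2 nD)[-> ->].
Qed.

Lemma sqrt_unique D (y : algC) : y ^+ 2 = iota D -> y = th D \/ y = - th D.
Proof.
move=> E; have : (y - th D) * (y + th D) == 0 by rewrite -subr_sqr sqrt_sqr E subrr.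
rewrite mulf_eq0 subr_eq0 addr_eq0 => /orP[/eqP->|/eqP->]; by [left|right].
Qed.

(** Pick $w\in L$ outside $K$. Comparing coordinates, 1 and $w$ span $L$ as $a$ and $b$ do; then
    complete the square in $w^2=p+qw$. *)
Lemma quad_extP (L : cset) : quad_ext K L -> exists2 D, nonsquare D & L = sqrt_field D.
Proof.
move=> [[L0 L1 LB LM LV] KL [a [b [La Lb LU]]]].
have LD (x y : algC) : L x -> L y -> L (x + y).
  by move=> Lx Ly; rewrite -[y]opprK -[- y]sub0r; apply: (LB) => //; apply: (LB).
have Li x : L (iota x) by apply: KL; exact: image_K.
(* If $L=K$, the relation $0=b\cdot a+(-a)\cdot b$ and uniqueness of coordinates force $a=b=0$, and
   1 could not be expressed. *)
have [w Lw wK] : exists2 w, L w & ~ K w.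
  apply: contrapT => H.
  have LK (x : algC) : L x -> K x by move=> Lx; apply: contrapT => nK; apply: H; exists x.
  have [k1 [k2 [_ _ _ U]]] := LU 0 L0.
  have [a0 b0] : 0 = k1 /\ 0 = k2 by apply: U; [exists 0; rewrite ?rmorph0..|rewrite !mul0r addr0].
  have [ka kb] : b = k1 /\ - a = k2.
    apply: U; [exact: LK| |by ring].
    by have [a' _ ->] := LK _ La; exists (- a'); rewrite ?rmorphN.
  have [c1 [c2 [_ _ E _]]] := LU 1 L1.
  have b0' : b = 0 by rewrite ka -a0.
  have a0' : a = 0 by apply: oppr_inj; rewrite kb -b0 oppr0.
  by move: E; rewrite a0' b0' !mulr0 addr0 => /eqP; rewrite oner_eq0.
have [_ [_ [[k1 _ ->] [k2 _ ->] E1 _]]] := LU 1 L1.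
have [_ [_ [[l1 _ ->] [l2 _ ->] Ew _]]] := LU w Lw.
have det0 : k1 * l2 - k2 * l1 != 0.
  apply/eqP => d0; have d0' : iota k1 * iota l2 = iota k2 * iota l1.
    by apply/eqP; rewrite -subr_eq0 -!rmorphM -rmorphB d0 rmorph0.
  have F1 : iota k1 * w = iota l1.
    rewrite Ew -[RHS]mulr1 E1; apply/eqP; rewrite -subr_eq0; apply/eqP.
    have -> : iota k1 * (iota l1 * a + iota l2 * b) - iota l1 * (iota k1 * a + iota k2 * b) =
      (iota k1 * iota l2 - iota k2 * iota l1) * b by ring.
    by rewrite d0' subrr mul0r.
  have F2 : iota k2 * w = iota l2.
    rewrite Ew -[RHS]mulr1 E1; apply/eqP; rewrite -subr_eq0; apply/eqP.
    have -> : iota k2 * (iota l1 * a + iota l2 * b) - iota l2 * (iota k1 * a + iota k2 * b) =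
      - (iota k1 * iota l2 - iota k2 * iota l1) * a by ring.
    by rewrite d0' subrr oppr0 mul0r.
  have [k10|k10] := eqVneq k1 0; last first.
    by apply: wK; exists (l1 / k1); rewrite // fmorph_div -F1 mulrC mulKf // fmorph_eq0.
  have [k20|k20] := eqVneq k2 0.
    by move: E1; rewrite k10 k20 rmorph0 !mul0r addr0 => /eqP; rewrite oner_eq0.
  by apply: wK; exists (l2 / k2); rewrite // fmorph_div -F2 mulrC mulKf // fmorph_eq0.
have [de Ede] : exists de, de = k1 * l2 - k2 * l1 by exists (k1 * l2 - k2 * l1).
have de0 : iota de != 0 by rewrite fmorph_eq0 Ede.
have Eb : b = (iota k1 * w - iota l1) / iota de.
  apply: (mulIf de0); rewrite divfK // Ede rmorphB !rmorphM.
  by rewrite -[X in _ = _ - X]mulr1 E1 Ew; ring.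
have Ea : a = (iota l2 - iota k2 * w) / iota de.
  apply: (mulIf de0); rewrite divfK // Ede rmorphB !rmorphM.
  by rewrite -[X in _ = X - _]mulr1 E1 Ew; ring.
have Lspan (x : algC) : L x -> exists p q, x = iota p + iota q * w.
  move=> /LU[_ [_ [[c1 _ ->] [c2 _ ->] -> _]]].
  exists ((c1 * l2 - c2 * l1) / de), ((c2 * k1 - c1 * k2) / de).
  by rewrite !fmorph_div !rmorphB !rmorphM Ea Eb; ring.
have [p [q Ew2]] := Lspan _ (LM _ _ Lw Lw).
pose D := p + q ^+ 2 / 4.
have E2 : (w - iota (q / 2)) ^+ 2 = iota D.
  rewrite sqrrB expr2 Ew2 /D rmorphD !fmorph_div rmorphXn !rmorph_nat.
  by field.
have nD : nonsquare D.
  move=> k E; move: E2; rewrite E rmorphXn => /eqP; rewrite eqf_sqr => /orP[] /eqP H.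
    by apply: wK; exists (k + q / 2); rewrite // rmorphD -H subrK.
  by apply: wK; exists (- k + q / 2); rewrite // rmorphD rmorphN -H subrK.
(* [sqrtC] returns one of the two roots, so a sign may intervene. *)
have [sg [sg1 Esg]] : exists sg : F, sg ^+ 2 = 1 /\ w - iota (q / 2) = iota sg * th D.
  have [H|H] := sqrt_unique E2; first by exists 1; rewrite expr1n rmorph1 mul1r.
  by exists (-1); rewrite sqrrN expr1n rmorphN rmorph1 mulN1r.
exists D => //; apply: set_anti => x.
  move=> /Lspan[p' [q' ->]]; exists (p' + q' * (q / 2)), (q' * sg).
  rewrite [in RHS]rmorphD !(rmorphM iota q') -[X in _ = _ + X]mulrA -Esg; ring.
move=> [p' [q' ->]]; apply: LD => //; apply: (LM) => //.
have -> : th D = iota sg * (w - iota (q / 2)) by rewrite Esg mulrA -rmorphM -expr2 sg1 rmorph1 mul1r.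
by apply: (LM) => //; apply: (LB).
Qed.

(** Squaring $\sqrt{D'}=p+q\sqrt D$ and comparing coordinates gives $2pq=0$; $q=0$ would make $D'$ a
    square. *)
Lemma sqrt_field_eq D D' : nonsquare D -> nonsquare D' ->
  sqrt_field D = sqrt_field D' <-> exists2 k, k != 0 & D' = k ^+ 2 * D.
Proof.
move=> nD nD'; split=> [E|[k k0 E]].
  have : sqrt_field D' (th D') by exists 0, 1; rewrite rmorph0 rmorph1 mul1r add0r.
  rewrite -E => -[p [q Eth]].
  have : iota D' + iota 0 * th D = iota (p ^+ 2 + q ^+ 2 * D) + iota (2 * p * q) * th D.
    rewrite rmorph0 mul0r addr0 -(sqrt_sqr D') Eth; move: (th D) (sqrt_sqr D) => y t2.
    rewrite !(rmorphD, rmorphM, rmorph1) -t2.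
    by ring.
  move=> /(coord_inj2 nD)[E1 /esym /eqP]; rewrite !mulf_eq0 (negPf two0) /= => /orP[]/eqP H.
    move: E1; rewrite H expr0n add0r => E1; exists q => //; apply/eqP => q0.
    by apply: (nD' 0); rewrite E1 q0 !expr0n mul0r.
  by case: (nD' p); rewrite E1 H expr0n mul0r addr0.
have H : (iota k * th D) ^+ 2 = iota D' by rewrite exprMn sqrt_sqr E rmorphM rmorphXn.
have ik0 : iota k != 0 by rewrite fmorph_eq0.
have [sg [sg1 Esg]] : exists sg : F, sg ^+ 2 = 1 /\ iota k * th D = iota sg * th D'.
  have [{}H|{}H] := sqrt_unique H; first by exists 1; rewrite expr1n rmorph1 mul1r.
  by exists (-1); rewrite sqrrN expr1n rmorphN rmorph1 mulN1r.
have E1 : th D = iota (sg / k) * th D'.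
  by rewrite fmorph_div -mulrAC -Esg mulrAC divff // mul1r.
have E2 : th D' = iota (sg * k) * th D.
  by rewrite rmorphM -mulrA Esg mulrA -rmorphM -expr2 sg1 rmorph1 mul1r.
apply: set_anti => _ [p [q ->]].
  by exists p, (q * (sg / k)); rewrite E1 (rmorphM iota q) mulrA.
by exists p, (q * (sg * k)); rewrite E2 (rmorphM iota q) mulrA.
Qed.

End Image.

(** * Integers, discriminant and Steinitz class of a quadratic extension *)

Section QuadraticIntegers.
Variables (F : fieldType) (iota : {rmorphism F -> algC}) (D : F).
Hypothesis nD : nonsquare D.
Local Notation O := (integers iota).
Local Notation im := (image iota).
Local Notation K := (im setT).
Local Notation fideal := (fideal iota).
Local Notation al := (al iota).
Local Notation L := (sqrt_field iota D).
Local Notation th := (sqrtC (iota D)).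
Implicit Types (I J A B : set F) (x y r t p q : F).

Let two0 : 2 != 0 :> F. Proof. by rewrite (natF_eq0 iota). Qed.
Let four0 : 4 != 0 :> F. Proof. by rewrite (natF_eq0 iota). Qed.
Let D0 : D != 0. Proof. exact: nonsquare_neq0. Qed.
Let th2 : th ^+ 2 = iota D. Proof. exact: sqrt_sqr. Qed.

Definition elt p q : algC := iota p + iota q * th.

Lemma elt_inj p q p' q' : elt p q = elt p' q' -> p = p' /\ q = q'.
Proof. exact: coord_inj2. Qed.

Lemma eltD p q p' q' : elt p q + elt p' q' = elt (p + p') (q + q').
Proof. by rewrite /elt !rmorphD; ring. Qed.

Lemma eltM p q p' q' : elt p q * elt p' q' = elt (p * p' + q * q' * D) (p * q' + q * p').
Proof. by rewrite /elt; move: th th2 => y y2; rewrite !(rmorphD, rmorphM) -y2; ring. Qed.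

Lemma eltZ x p q : iota x * elt p q = elt (x * p) (x * q).
Proof. by rewrite /elt !rmorphM; ring. Qed.

Lemma horner_conj (G : {poly F}) p q : exists A B : F,
  (map_poly iota G).[elt p q] = elt A B /\ (map_poly iota G).[elt p (- q)] = elt A (- B).
Proof.
elim/poly_ind: G => [|G c [A [B [E1 E2]]]].
  by exists 0, 0; rewrite rmorph0 !horner0 /elt oppr0 rmorph0 mul0r addr0.
exists (A * p + B * q * D + c), (A * q + B * p).
rewrite !rmorphD !rmorphM /= map_polyX map_polyC /= !hornerMXaddC E1 E2 !eltM.
have -> : iota c = elt c 0 by rewrite /elt rmorph0 mul0r addr0.
by rewrite !eltD; split; congr elt; ring.
Qed.

(** The minimal polynomial has rational coefficients, so it takes conjugate values at conjugate
    elements. *)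
Lemma elt_conj_int p q : elt p q \in Aint -> elt p (- q) \in Aint.
Proof.
move=> xA; have [g [Dg mg] rg] := minCpolyP (elt p q).
apply: (@root_monic_Aint (map_poly ratr g)); rewrite ?map_monic //; last by rewrite -Dg; exact: xA.
have E w : (map_poly ratr g).[w] = (map_poly iota (map_poly ratr g)).[w] :> algC.
  by rewrite -map_poly_comp; congr (_.[_]); apply: eq_map_poly => a /=; rewrite fmorph_rat.
have [A [B [E1 E2]]] := horner_conj (map_poly ratr g) p q.
have : root (map_poly ratr g) (elt p q) by rewrite rg.
rewrite /root E E1 E E2 => /eqP; have -> : 0 = elt 0 0 by rewrite /elt !rmorph0 mul0r addr0.
by move=> /elt_inj[-> ->]; rewrite oppr0.
Qed.

Lemma elt_int p q : elt p q \in Aint <-> O (2 * p) /\ O (p ^+ 2 - q ^+ 2 * D).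
Proof.
have E1 : elt p q + elt p (- q) = iota (2 * p).
  by rewrite /elt rmorphN rmorphM rmorph_nat; ring.
have E2 : elt p q * elt p (- q) = iota (p ^+ 2 - q ^+ 2 * D).
  have z : p * - q + q * p = 0 by ring.
  by rewrite eltM z /elt rmorph0 mul0r addr0; congr (iota _); ring.
split=> [xA|[Op Oq]].
  by have cA := elt_conj_int xA; rewrite /integers -E1 -E2 rpredD // rpredM.
by apply: (Aint_quadratic Op Oq); rewrite -E1 -E2; ring.
Qed.

Lemma elt_int_F p : elt p 0 \in Aint <-> O p.
Proof. by rewrite /elt rmorph0 mul0r addr0. Qed.

Lemma al_elt r : al D r <-> exists p, elt p (r / 2) \in Aint.
Proof.
split=> [[t Ot H]|[p /elt_int[O2 H]]].
  exists (t / 2); apply/elt_int; split; first by rewrite mulrC divfK.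
  have -> : (t / 2) ^+ 2 - (r / 2) ^+ 2 * D = (t ^+ 2 - r ^+ 2 * D) / 4 by field; rewrite four0.
  exact: H.
exists (2 * p) => //.
have -> : ((2 * p) ^+ 2 - r ^+ 2 * D) / 4 = p ^+ 2 - (r / 2) ^+ 2 * D by field; rewrite two0.
exact: H.
Qed.

Lemma elt_al p q : elt p q \in Aint -> al D (2 * q).
Proof. by move=> H; apply/al_elt; exists p; rewrite [2 * q]mulrC mulfK. Qed.

Lemma elt_int_O x p q : O x -> elt p q \in Aint -> elt (x * p) (x * q) \in Aint.
Proof. by move=> Ox H; rewrite -eltZ rpredM. Qed.

(** Up to the factor 2 this is the determinant of two integers; it is the $\sqrt D$-coordinate of
    the first times the conjugate of the second, again an integer. *)
Lemma elt_wedge p q p' q' : elt p q \in Aint -> elt p' q' \in Aint -> al D (2 * (q * p' - p * q')).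
Proof.
move=> H /elt_conj_int H'; have : elt p q * elt p' (- q') \in Aint by rewrite rpredM.
rewrite eltM => /elt_al; congr (al D _); ring.
Qed.

Lemma ring_of_intL u : ring_of_int L u <-> exists p q, u = elt p q /\ elt p q \in Aint.
Proof.
split=> [[[p [q ->]] uA]|[p [q [-> uA]]]]; first by exists p, q.
by split=> //; exists p, q.
Qed.

Lemma coord_fun : exists c : algC -> F * F, forall p q, c (elt p q) = (p, q).
Proof.
have H (u : algC) : exists pq : F * F, forall p q, u = elt p q -> pq = (p, q).
  have [[p [q E]]|n] := pselect (exists p q, u = elt p q).
    by exists (p, q) => p' q'; rewrite E => /elt_inj[-> ->].
  by exists (0, 0) => p q E; case: n; exists p, q.
by have [c Hc] := choice H; exists c => p q; exact: Hc.
Qed.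

Lemma conj_exists : exists tau, nontriv_K_emb K L tau /\ forall p q, tau (elt p q) = elt p (- q).
Proof.
have [c cE] := coord_fun; exists (fun u => elt (c u).1 (- (c u).2)).
have tE p q : elt (c (elt p q)).1 (- (c (elt p q)).2) = elt p (- q) by rewrite cE.
split=> //; split.
- by move=> _ _ [p [q ->]] [p' [q' ->]]; rewrite (eltD p q) !tE eltD; congr elt; ring.
- by move=> _ _ [p [q ->]] [p' [q' ->]]; rewrite (eltM p q) !tE eltM; congr elt; ring.
- move=> _ [x _ ->]; have -> : iota x = elt x 0 by rewrite /elt rmorph0 mul0r addr0.
  by rewrite tE oppr0.
- exists (elt 0 1); split; first by exists 0, 1.
  rewrite tE; apply/eqP => /elt_inj[_ /eqP]; rewrite eq_sym -subr_eq0 opprK.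
  by rewrite (negPf two0).
Qed.

Lemma conj_unique tau : nontriv_K_emb K L tau -> forall p q, tau (elt p q) = elt p (- q).
Proof.
move=> [tD tM tK [u [[p0 [q0 ->]] nu]]].
have Lx x : L (iota x) by exists x, 0; rewrite rmorph0 mul0r addr0.
have Lth : L th by exists 0, 1; rewrite rmorph0 rmorph1 mul1r add0r.
have Lq q : L (iota q * th) by exists 0, q; rewrite rmorph0 add0r.
have tE p q : tau (elt p q) = iota p + iota q * tau th.
  by rewrite tD // tM // (tK _ (image_K iota p)) (tK _ (image_K iota q)).
have : tau th ^+ 2 = iota D by rewrite expr2 -tM // -expr2 th2 tK //; exact: image_K.
case/sqrt_unique => E; last by move=> p q; rewrite tE E /elt rmorphN mulrN mulNr.
by case/eqP: nu; rewrite -/(elt _ _) tE E.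
Qed.

(** The discriminant of a pair is $c^2D$ with $c$ its wedge. Conversely $c\in\mathrm{al}\,D$ arises
    from the pair 1, $p+(c/2)\sqrt D$. *)
Lemma disc_eltP u : disc_elt K L u <-> exists2 c, al D c & u = iota (c ^+ 2 * D).
Proof.
split.
  move=> [b1 [b2 [tau [/ring_of_intL[p [q [-> h1]]] /ring_of_intL[p' [q' [-> h2]]] /conj_unique tE ->]]]].
  exists (2 * (q * p' - p * q')); first exact: elt_wedge.
  rewrite !tE !eltM /elt; move: th th2 => y y2.
  by rewrite !(rmorphM, rmorphD, rmorphN, rmorphXn, rmorphB, rmorph_nat, rmorph1) -y2; ring.
move=> [c /al_elt[p h] ->]; have [tau [nt tE]] := conj_exists.
exists 1, (elt p (c / 2)), tau; split=> //.
- have -> : 1 = elt 1 0 by rewrite /elt rmorph0 mul0r addr0 rmorph1.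
  by apply/ring_of_intL; exists 1, 0; split=> //; apply/elt_int_F; exact: O1.
- by apply/ring_of_intL; exists p, (c / 2).
- have -> : 1 = elt 1 0 by rewrite /elt rmorph0 mul0r addr0 rmorph1.
  rewrite !tE !eltM /elt; move: th th2 => y y2.
  by rewrite !(rmorphM, rmorphD, rmorphN, rmorphXn, rmorphB, rmorph_nat, rmorph1, rmorph0, fmorphV) -y2; field.
Qed.

Variables (n : nat) (s : 'I_n -> {rmorphism F -> algC}) (e : 'I_n -> F) (d : nat).
Hypothesis emb : field_embeddings iota s e d.
Variables (h : nat) (rep : 'I_h -> set F).
Hypothesis rep_cover : forall I, fideal I -> exists i, exists2 x, x != 0 & rep i = smul x I.
Local Notation I := (al D).

Let fI : fideal I. Proof. exact: al_frac. Qed.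

                                                                                            
                                                            
(** The discriminant is generated by the squares $u^2D$, and inverses are compared instead of the
    ideals: if $yu^2D$ and $yv^2D$ are integral, so is $(yDuv)^2$, hence $yDuv$. Thus the mixed
    products add nothing. *)
Lemma rel_discE : rel_disc K L = im (smul D (imul I I)).
Proof.
pose J : set F := preimage iota (rel_disc K L).
have fII := imul_frac fI fI; have fDII := smul_frac D0 fII.
have JK u : rel_disc K L u -> im (smul D (imul I I)) u.
  move=> [k [c [w [Oc dw ->]]]]; apply: (big_ind (im (smul D (imul I I)))).
  - by exists 0; [exact: (frac0 fDII)|rewrite rmorph0].
  - by move=> _ _ [x Hx ->] [y Hy ->]; exists (x + y); [exact: (fracD fDII)|rewrite rmorphD].
  - move=> i _; have [[a _ ->] Oa] := Oc i; have [b Ib ->] := (disc_eltP _).1 (dw i).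
    exists (a * (b ^+ 2 * D)); last by rewrite (rmorphM iota a).
    apply: (fracM fDII) => //; exists (b * b); [exact: imul_mem|by ring].
have JDI x : J x -> smul D (imul I I) x by move=> /JK /imageE.
have Jsq b : I b -> J (b ^+ 2 * D).
  move=> Ib; exists 1%N, (fun _ => 1), (fun _ => iota (b ^+ 2 * D)); split.
  - by move=> _; rewrite -(rmorph1 iota); apply/image_O; exact: O1.
  - by move=> _; apply/disc_eltP; exists b.
  - by rewrite big_ord1 mul1r.
have fJ : fideal J.
  split.
  - by exists 0%N, (fun _ => 0), (fun _ => 0); split; [case|case|rewrite big_ord0 rmorph0].
  - move=> x y [k [c [w [Oc dw Ex]]]] [k' [c' [w' [Oc' dw' Ey]]]].
    exists (k + k')%N, (fun i => match fintype.split i with inl a => c a | inr b => c' b end),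
      (fun i => match fintype.split i with inl a => w a | inr b => w' b end); split.
    + by move=> i; case: fintype.split.
    + by move=> i; case: fintype.split.
    + rewrite rmorphD Ex Ey big_split_ord /=; congr (_ + _); apply: eq_bigr => i _.
        by rewrite (unsplitK (inl i)).
      by rewrite (unsplitK (inr i)).
  - move=> r x Or [k [c [w [Oc dw Ex]]]]; exists k, (fun i => iota r * c i), w; split=> //.
      move=> i; have [[a _ ->] Oa] := Oc i; rewrite -rmorphM; apply/image_O; exact: OM.
    by rewrite rmorphM Ex mulr_sumr; apply: eq_bigr => i _; rewrite mulrA.
  - have [b Ib b0] := frac_neq0 fI; exists (b ^+ 2 * D); first exact: Jsq.
    by rewrite mulf_neq0 // expf_neq0.
  - have [c [Oc c0] Hc] := frac_denom fDII; exists c => // x /JDI; exact: Hc.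
apply: set_anti => // _ [x Hx ->]; apply: (iinv_sub emb rep_cover fDII fJ) Hx.
move=> y Hy _ [z Hz ->]; elim/imul_ind: z / Hz => [|u v|u v Iu Iv].
- by rewrite !mulr0; exact: O0.
- by rewrite !mulrDr; exact: OD.
- apply: O_sqr; have -> : (y * (D * (u * v))) ^+ 2 = (y * (u ^+ 2 * D)) * (y * (v ^+ 2 * D)) by ring.
  by apply: OM; apply: Hy; exact: Jsq.
Qed.

Lemma disc_norm_leP X : disc_norm_le K L X <-> (dnorm iota I D <= X)%N.
Proof.
have fII := imul_frac fI fI; have fDII := smul_frac D0 fII.
have [_ sub] := al_int D0 fI (fun r Hr => Hr).
have ix := ixnP emb fDII (frac_O iota) sub.
rewrite /disc_norm_le rel_discE; split.
  move=> [k [/ideal_norm_image Hk kX]].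
  by rewrite /dnorm (ixn_eq (frac_subgrp fDII) Hk).
by move=> H; exists (dnorm iota I D); split=> //; apply/ideal_norm_image.
Qed.

(** [I] is invertible, hence projective: writing 1 as a sum of $a_ib_i$ with $a_i\in I$, $b_i\in
    I^{-1}$ and lifting each $a_i$ to an integer of $L$ gives a section $r\mapsto(rT+r\sqrt
    D)/2$. *)
Lemma splitting : exists T, forall r, I r -> elt (r * T / 2) (r / 2) \in Aint.
Proof.
have H1 : imul I (iinv iota I) 1 by rewrite (imulV emb rep_cover fI); exact: O1.
suff H x : imul I (iinv iota I) x -> exists T, forall r, I r -> elt (r * T / 2) (r * x / 2) \in Aint.
  by have [T HT] := H 1 H1; exists T => r /HT; rewrite mulr1.
elim/imul_ind: x / => [|x y [T1 {}H1] [T2 H2]|a b /al_elt[p hp] hb].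
- by exists 0 => r _; rewrite !mulr0 mul0r; apply/elt_int_F; exact: O0.
- exists (T1 + T2) => r Ir; have := rpredD (H1 r Ir) (H2 r Ir).
  by rewrite eltD; congr (elt _ _ \in Aint); ring.
- exists (2 * b * p) => r Ir; have := elt_int_O (hb r Ir) hp.
  by congr (elt _ _ \in Aint); field.
Qed.

(** Removing the section of [splitting] from $p+q\sqrt D$, where $r=2q$, leaves $p-qT$ as the
    component in $O$. *)
Lemma steinitz_al : steinitz_is K L (im I).
Proof.
exists (im I); split; first exact: frac_ideal_image.
  by apply/ideal_equiv_image; exists 1; rewrite ?oner_eq0 // smul1.
have [T HT] := splitting; have [c cE] := coord_fun.
pose phi u := (iota ((c u).1 - (c u).2 * T), iota (2 * (c u).2)).
have pE p q : phi (elt p q) = (iota (p - q * T), iota (2 * q)) by rewrite /phi cE.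
exists phi; split.
- move=> _ /ring_of_intL[p [q [-> xA]]]; rewrite pE /=; split; last by exists (2 * q); rewrite // ; exact: elt_al xA.
  apply/image_O; apply/elt_int_F; have := HT _ (elt_al xA) => h2.
  have := rpredB xA h2; congr (_ \in Aint).
  rewrite (_ : elt _ (2 * q / 2) = - elt (- (q * T)) (- q)); last by rewrite /elt !rmorphN mulNr -opprD opprK; congr (iota _ + iota _ * _); field.
  by rewrite opprK eltD; congr elt; ring.
- move=> _ _ /ring_of_intL[p [q [-> _]]] /ring_of_intL[p' [q' [-> _]]]; rewrite eltD !pE /=.
  by congr (_, _); rewrite -rmorphD; congr (iota _); ring.
- move=> _ _ [[x _ ->] _] /ring_of_intL[p [q [-> _]]]; rewrite eltZ !pE /=.
  by congr (_, _); rewrite -rmorphM; congr (iota _); ring.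
- move=> _ _ /ring_of_intL[p [q [-> _]]] /ring_of_intL[p' [q' [-> _]]]; rewrite !pE.
  move=> [/(fmorph_inj iota) E1 /(fmorph_inj iota) /(mulfI two0) E2].
  by rewrite E2 in E1 *; move: E1 => /addIr ->.
- move=> _ _ [[x _ ->] Ox] [r Ir ->]; exists (elt (x + r * T / 2) (r / 2)); split.
    apply/ring_of_intL; exists (x + r * T / 2), (r / 2); split=> //.
    have -> : elt (x + r * T / 2) (r / 2) = elt x 0 + elt (r * T / 2) (r / 2) by rewrite eltD add0r.
    by rewrite rpredD ?HT //; apply/elt_int_F.
  by rewrite pE; congr (iota _, iota _); field.
Qed.

(** The class does not depend on the decomposition, by the second exterior power: if $O_L\cong
    O\oplus A$, the wedges of pairs of integers form both [I] and a multiple $kA$. *)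
Lemma steinitzP C : fideal C -> steinitz_is K L (im C) <-> exists2 k, k != 0 & C = smul k I.
Proof.
move=> fC; split; last first.
  move=> [k k0 EC]; have [a [fa ea Hphi]] := steinitz_al; exists a; split=> //.
  have [A fA Ea] := frac_ideal_imageP fa; rewrite {}Ea in fa ea Hphi *.
  have [x x0 Ex] := (ideal_equiv_image _ _ _).1 ea.
  apply/ideal_equiv_image; exists (k * x); first by rewrite mulf_neq0.
  by rewrite EC Ex smul_mul.
move=> [a [fa ea [phi [phiI phiD phiM phiinj phisurj]]]].
have [A fA Ea] := frac_ideal_imageP fa; rewrite {}Ea in fa ea phiI phisurj.
have [x x0 Ex] := (ideal_equiv_image _ _ _).1 ea.
suff [k k0 EI] : exists2 k, k != 0 & I = smul k A.
  exists (x / k); first by rewrite mulf_neq0 // invr_eq0.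
  by rewrite Ex EI smul_mul divfK.
have OK1 : ring_of_int K 1 by rewrite -(rmorph1 iota); apply/image_O; exact: O1.
have OK0 : ring_of_int K 0 by rewrite -(rmorph0 iota); apply/image_O; exact: O0.
have a0 : im A 0 by exists 0; [exact: (frac0 fA)|rewrite rmorph0].
have [v [Lv Ev]] := phisurj _ _ OK1 a0.
have [y0 Ay0 y00] := frac_neq0 fA.
have [w [Lw Ew]] := phisurj 0 (iota y0) OK0 ltac:(by exists y0).
have LDD u u' : ring_of_int L u -> ring_of_int L u' -> ring_of_int L (u + u').
  move=> /ring_of_intL[p [q [-> h1]]] /ring_of_intL[p' [q' [-> h2]]]; apply/ring_of_intL.
  by exists (p + p'), (q + q'); rewrite -eltD rpredD.
have LMM b u : O b -> ring_of_int L u -> ring_of_int L (iota b * u).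
  move=> Ob /ring_of_intL[p [q [-> h1]]]; apply/ring_of_intL.
  by exists (b * p), (b * q); rewrite -eltZ rpredM.
(* The isomorphism is linear over $O$ only; clearing the denominator of $y/y_0$ extends linearity to
   this quotient. *)
have wE y u : A y -> ring_of_int L u -> phi u = (0, iota y) -> u = iota (y / y0) * w.
  move=> Ay Lu Eu; have [k kN Ok] := O_clear iota (y / y0).
  have Ok' : O k%:R by exact: O_nat.
  have kF : k%:R != 0 :> F by rewrite (natF_eq0 iota) -lt0n.
  have : iota k%:R * u = iota (k%:R * (y / y0)) * w.
    apply: phiinj; [exact: LMM|exact: LMM|].
    rewrite !phiM //; try exact/image_O.
    rewrite Eu Ew /= !mulr0 -!rmorphM; congr (_, iota _); by field.
  rewrite rmorphM -mulrA => /mulfI; apply; by rewrite fmorph_eq0.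
have [p1 [q1 [E1 A1]]] := (ring_of_intL v).1 Lv.
have [p2 [q2 [E2 A2]]] := (ring_of_intL w).1 Lw.
(* The wedge of the preimages $v$ of $(1,0)$ and $w$ of $(0,y_0)$, divided by $y_0$. *)
pose k := 2 * (q1 * p2 - p1 * q2) / y0.
have dec r : I r -> exists2 y, A y & r = k * y.
  move=> /al_elt[p hp].
  have gen p' q' : elt p' q' \in Aint -> exists b y, [/\ O b, A y & elt p' q' = iota b * v + iota (y / y0) * w].
    move=> H; have LH : ring_of_int L (elt p' q') by apply/ring_of_intL; exists p', q'.
    have [Hb Hy] := phiI _ LH; have [[b _ Eb] Ob] := Hb; have [y Ay Ey] := Hy.
    have {}Ob : O b by apply/image_O; rewrite -Eb.
    have [u [Lu Eu]] := phisurj 0 (iota y) OK0 ltac:(by exists y).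
    exists b, y; split=> //; rewrite -(wE _ _ Ay Lu Eu); apply: phiinj => //.
      by apply: LDD => //; exact: LMM.
    rewrite (phiD _ _ (LMM _ _ Ob Lv) Lu) (phiM _ _ ((image_O iota b).2 Ob) Lv).
    by rewrite Ev Eu /= mulr1 mulr0 addr0 add0r -Eb -Ey; case: (phi _).
  have [b [y [Ob Ay E]]] := gen _ _ hp.
  have [b' [y' [Ob' Ay' E']]] := gen 1 0 ltac:(by apply/elt_int_F; exact: O1).
  rewrite E1 E2 !eltZ eltD in E; have [F1 F2] := elt_inj E.
  rewrite E1 E2 !eltZ eltD in E'; have [F1' F2'] := elt_inj E'.
  exists (b * y' - b' * y); first by apply: (fracB fA); exact: (fracM fA).
  transitivity (2 * ((r / 2) * 1 - p * 0)); first by field.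
  transitivity (2 * ((b * q1 + y / y0 * q2) * (b' * p1 + y' / y0 * p2) - (b * p1 + y / y0 * p2) * (b' * q1 + y' / y0 * q2))).
    by rewrite -F1 -F2 -F1' -F2'.
  by rewrite /k; field.
have inc y : A y -> I (k * y).
  move=> Ay; have [u [Lu Eu]] := phisurj 0 (iota y) OK0 ltac:(by exists y).
  have Eu' := wE _ _ Ay Lu Eu; have [_ uA] := Lu.
  rewrite Eu' E2 eltZ in uA; rewrite E1 in Lv; have [_ vA] := Lv.
  have := elt_wedge vA uA; congr (I _); rewrite /k; field; exact: y00.
exists k.
  have [r Ir r0] := frac_neq0 fI; have [y Ay E] := dec r Ir.
  by apply: contraNneq r0 => k0; rewrite E k0 mul0r.
apply: set_anti => r; first by move=> /dec[y Ay ->]; exists y.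
by move=> [y Ay ->]; exact: inc.
Qed.

End QuadraticIntegers.

(** * Counting fields through orbit representatives, and the limit *)

Lemma count_is_list (T : eqType) (S : T -> Prop) (g : T -> cset) (P : cset -> Prop) :
  fin S -> (forall x, S x -> P (g x)) -> (forall x y, S x -> S y -> g x = g y -> x = y) ->
  (forall L, P L -> exists2 x, S x & L = g x) -> count_is P (size (enump S)).
Proof.
move=> fS SP gI gS; exists (fun i => g (tnth (in_tuple (enump S)) i)); split.
- by move=> i; apply: SP; apply: enump_prop; exact: mem_tnth.
- move=> i j /set_ext E; have {E} : tnth (in_tuple (enump S)) i = tnth (in_tuple (enump S)) j.
    by apply: gI E; apply: enump_prop; exact: mem_tnth.
  by apply: tuple_uniqP; exact: enump_uniq.
- move=> L /gS[x Sx ->]; have /tnthP[i Ei] : x \in in_tuple (enump S) by exact: enump_in.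
  by exists i => y; rewrite -Ei.
Qed.

(** Double counting: by disjointness each element of the union satisfies exactly one of the
    predicates. *)
Lemma size_enump_disjoint (T : eqType) h (S : 'I_h -> T -> Prop) :
  (forall i, fin (S i)) -> (forall i j x, S i x -> S j x -> i = j) ->
  fin (fun x => exists i, S i x) /\
  size (enump (fun x => exists i, S i x)) = (\sum_i size (enump (S i)))%N.
Proof.
move=> fS dS; set U := fun x => _.
have fU : fin U.
  exists (flatten [seq enump (S i) | i <- enum 'I_h]) => x [i Si].
  apply/flattenP; exists (enump (S i)); last exact: enump_in.
  by apply: map_f; rewrite mem_enum.
split=> //.
have E (x : T) : U x -> (\sum_i (`[< S i x >] : nat) = 1)%N.
  move=> [i Si]; rewrite (bigD1 i) //= big1 ?addn0; first by rewrite asboolT.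
  by move=> j ji; rewrite asboolF // => Sj; rewrite (dS j i x) ?eqxx in ji.
have -> : size (enump U) = (\sum_(x <- enump U) \sum_i (`[< S i x >] : nat))%N.
  rewrite big_seq (eq_bigr (fun=> 1%N)); last by move=> x /enump_prop /E.
  by rewrite -big_seq; rewrite sum1_size.
rewrite exchange_big; apply: eq_bigr => i _.
rewrite -(@big_enump_sub _ nat (S i) U) //; first last.
- by move=> x _ nS; rewrite asboolF.
- by move=> x Si; exists i.
rewrite big_seq (eq_bigr (fun=> 1%N)); last by move=> x /enump_prop Si; rewrite asboolT.
by rewrite -big_seq; exact: sum1_size.
Qed.

Section Density.
Variables (F : fieldType) (iota : {rmorphism F -> algC}) (n : nat).
Variables (s : 'I_n -> {rmorphism F -> algC}) (e : 'I_n -> F) (d : nat).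
Hypothesis emb : field_embeddings iota s e d.
Variables (h : nat) (rep : 'I_h -> set F).
Hypothesis rep_frac : forall i, fideal iota (rep i).
Hypothesis rep_cover : forall I, fideal iota I -> exists i, exists2 x, x != 0 & rep i = smul x I.
Hypothesis rep_inj : forall i j x, x != 0 -> rep j = smul x (rep i) -> i = j.
Local Notation R := algR.
Local Notation K := (image iota setT).
Local Notation im := (image iota).
Local Notation fideal := (fideal iota).
Local Notation al := (al iota).
Local Notation vrep := (vrep iota).
Implicit Types (I J A B C : set F) (x y D k : F).

Definition quad_reps A (X : nat) D := Mred iota A X%:R D /\ nonsquare D.
Definition quad_count A X := size (enump (quad_reps A X)).

Lemma fin_quad_reps A X : fideal A -> fin (quad_reps A X).
Proof. by move=> fA; apply: fin_sub (fin_Mred emb rep_cover X%:R fA) _ => D []. Qed.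

(** Since $\mathrm{al}(k^2D)=k^{-1}\mathrm{al}\,D$ and both ideals are [A], $k$ is a unit, so [D]
    and [D'] lie in the same $V$-orbit. *)
Lemma Mred_square_class A X D D' k : fideal A -> k != 0 -> D' = k ^+ 2 * D ->
  Mred iota A X D -> Mred iota A X D' -> D = D'.
Proof.
move=> fA k0 E [D0 aD rD _] [_ aD' rD' _]; rewrite -rD -rD'; apply/vrepP.
exists (k ^+ 2) => //; exists k => //.
have ki0 : k^-1 != 0 by rewrite invr_eq0.
have := unit_of_smul_eq emb (oner_neq0 _) ki0 fA; rewrite invrK mul1r; apply.
by rewrite smul1 -{1}aD' E al_smul // aD.
Qed.

(** Two square values of [D] with the same ideal differ by a square factor, so by
    [Mred_square_class] they coincide: squares cost at most one orbit. *)
Lemma quad_count_bounds A X : fideal A ->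
  (quad_count A X <= Mc iota A X%:R)%N /\ (Mc iota A X%:R <= (quad_count A X).+1)%N.
Proof.
move=> fA; have fM := fin_Mred emb rep_cover X%:R fA; have fQ := fin_quad_reps X fA.
split; first by apply: size_enump_sub => // D [].
have [[D0 [M0 [k0 E0]]]|nsq] := pselect (exists D, Mred iota A X%:R D /\ exists k, D = k ^+ 2); last first.
  apply: leqW; apply: size_enump_sub => // D MD; split=> // k E; apply: nsq.
  by exists D; split=> //; exists k.
apply: (@uniq_leq_size _ _ (D0 :: enump (quad_reps A X))); first exact: enump_uniq.
move=> D /enump_prop MD; rewrite in_cons; have [[k E]|nk] := pselect (exists k, D = k ^+ 2).
  have k00 : k0 != 0 by apply: contraPneq M0 => k00 -[]; rewrite E0 k00 expr0n eqxx.
  have k0' : k != 0 by apply: contraPneq MD => k0' -[]; rewrite E k0' expr0n eqxx.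
  apply/orP; left; apply/eqP; apply/esym; apply: (@Mred_square_class A X%:R D0 D (k / k0)) => //.
    by rewrite mulf_neq0 // invr_eq0.
  by rewrite E E0 expr_div_n divfK // expf_neq0.
by apply/orP; right; apply: enump_in => //; split=> // k E; apply: nk; exists k.
Qed.

Lemma quad_reps_ext A X D : fideal A -> quad_reps A X D ->
  [/\ quad_ext K (sqrt_field iota D), disc_norm_le K (sqrt_field iota D) X & al D = A].
Proof.
move=> fA [[D0 aD _ NX] nD]; split=> //; first exact: quad_ext_sqrt.
by apply/(disc_norm_leP nD emb rep_cover); rewrite aD -(ler_nat R).
Qed.

(** Replacing $D$ by $k^{-2}D$ keeps the field and moves [al D] to [A] itself; then the
    representative of the $V$-orbit is taken. *)
Lemma quad_ext_reps A X D k : fideal A -> nonsquare D -> k != 0 -> A = smul k (al D) ->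
  disc_norm_le K (sqrt_field iota D) X ->
  exists2 D', quad_reps A X D' & sqrt_field iota D = sqrt_field iota D'.
Proof.
move=> fA nD k0 EA dX; pose D1 := (k^-1) ^+ 2 * D.
have ki0 : k^-1 != 0 by rewrite invr_eq0.
have a1 : al D1 = A by rewrite al_smul // invrK.
have [u [v [v0 Ov Ov'] Eu] E] := vrepK iota D1.
have [c c0 Ec] : exists2 c, c != 0 & vrep D1 = c ^+ 2 * D.
  by exists (v / k); [rewrite mulf_neq0|rewrite E Eu /D1; ring].
have nD' : nonsquare (vrep D1).
  by move=> w Ew; apply: (nD (w / c)); rewrite expr_div_n -Ew Ec mulrC mulKf // expf_neq0.
have EL : sqrt_field iota D = sqrt_field iota (vrep D1) by apply/(sqrt_field_eq iota nD nD'); exists c.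
have aD' : al (vrep D1) = A.
  by rewrite E al_V //; exists v.
exists (vrep D1) => //; split=> //; split=> //.
- exact: nonsquare_neq0.
- exact: vrep_id.
- by move: dX; rewrite EL => /(disc_norm_leP nD' emb rep_cover); rewrite aD' ler_nat.
Qed.

Lemma sqrt_field_inj A X D D' : fideal A -> quad_reps A X D -> quad_reps A X D' ->
  sqrt_field iota D = sqrt_field iota D' -> D = D'.
Proof.
move=> fA [MD nD] [MD' nD'] /(sqrt_field_eq iota nD nD')[k k0 E].
exact: Mred_square_class fA k0 E MD MD'.
Qed.

Lemma quad_count_class C X : fideal C ->
  count_is (fun L => [/\ quad_ext K L, disc_norm_le K L X & steinitz_is K L (im C)]) (quad_count C X).
Proof.
move=> fC; apply: (@count_is_list _ _ (sqrt_field iota)); first exact: fin_quad_reps.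
- move=> D SD; have [qD dD aD] := quad_reps_ext fC SD; have [_ nD] := SD; split=> //.
  by apply/(steinitzP nD emb rep_cover fC); exists 1; rewrite ?oner_neq0 // smul1.
- by move=> D D'; exact: sqrt_field_inj.
- move=> L [/quad_extP[D nD ->] dX /(steinitzP nD emb rep_cover fC)[k k0 EC]].
  exact: quad_ext_reps EC dX.
Qed.

Lemma quad_count_total X :
  count_is (fun L => quad_ext K L /\ disc_norm_le K L X) (\sum_i quad_count (rep i) X)%N.
Proof.
have [|i j D [[_ aD _ _] _] [[_ aD' _ _] _]|fU <-] := size_enump_disjoint (S := fun i => quad_reps (rep i) X).
- by move=> i; exact: fin_quad_reps.
- by apply: (rep_inj (oner_neq0 _)); rewrite smul1 -aD -aD'.
apply: (@count_is_list _ _ (sqrt_field iota)) => //.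
- by move=> D [i SD]; have [qD dD aD] := quad_reps_ext (rep_frac i) SD.
- move=> D D' [i SD] [j SD'] E.
  have [[_ aD _ _] nD] := SD; have [[_ aD' _ _] nD'] := SD'.
  have [k k0 Ek] := (sqrt_field_eq iota nD nD').1 E.
  have ij : i = j.
    apply: (@rep_inj _ _ k^-1); first by rewrite invr_eq0.
    by rewrite -aD' Ek al_smul // aD.
  by rewrite -ij in SD'; exact: sqrt_field_inj SD SD' E.
- move=> L [/quad_extP[D nD ->] dX].
  have [i [k k0 Ei]] := rep_cover (al_frac iota (nonsquare_neq0 nD)).
  have [D' SD' E] := quad_ext_reps (rep_frac i) nD k0 Ei dX.
  by exists D' => //; exists i.
Qed.

Lemma class_count_gt0 : (0 < h)%N.
Proof. by have [i _] := rep_cover (frac_O iota); apply: leq_ltn_trans (ltn_ord i). Qed.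

Lemma quad_count_compare C (eps : R) : fideal C -> 0 < eps -> exists X0 : R, forall X : nat, X0 <= X%:R ->
  forall i, `|(quad_count C X)%:R - (quad_count (rep i) X)%:R| <= eps * X%:R.
Proof.
move=> fC eps0; have e2 : 0 < eps / 2 by rewrite divr_gt0.
have [|i|X1 H1] := @uniform_threshold _ (enum 'I_h) (fun i X0 => forall X : nat, X0 <= X%:R ->
    `|(Mc iota C X%:R)%:R - (Mc iota (rep i) X%:R)%:R| <= eps / 2 * X%:R :> R).
- by move=> i X Y H XY Z YZ; apply: H; apply: le_trans XY YZ.
- have [X0 H0] := Mc_compare emb rep_frac rep_cover fC (rep_frac i) e2.
  by exists X0 => X; exact: H0.
(* The second bound makes $\epsilon X/2$ at least 1, which absorbs the orbit of squares. *)
exists (Num.max X1 (2 / eps)) => X; rewrite ge_max => /andP[X1X HX] i.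
have X2 : 1 <= eps / 2 * X%:R by rewrite mulrAC ler_pdivlMr // mul1r mulrC -ler_pdivrMr.
have {}H1 := H1 i; rewrite mem_enum in H1; have {}H1 := H1 isT X X1X.
have [a1 a2] := quad_count_bounds X fC; have [b1 b2] := quad_count_bounds X (rep_frac i).
have S1 (a b : nat) : (a <= b.+1)%N -> a%:R <= b%:R + 1 :> R by rewrite -(ler_nat R) -natr1.
move: a1 (S1 _ _ a2) b1 (S1 _ _ b2); rewrite -!(ler_nat R).
move: H1 X2; rewrite !ler_norml (_ : eps * X%:R = eps / 2 * X%:R + eps / 2 * X%:R); last by field.
move: (eps / 2 * X%:R) (Mc _ _ _)%:R (Mc _ _ _)%:R (quad_count _ _)%:R (quad_count _ _)%:R.
clear => a b c x y /andP[h1 h2] *; apply/andP; split; lra.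
Qed.

Lemma quad_total_lower : exists2 k : nat, (0 < k)%N & exists X0 : R, forall X : nat, X0 <= X%:R ->
  X%:R <= k%:R * (\sum_i quad_count (rep i) X)%:R :> R.
Proof.
have [k k0 [X0 H0]] := total_lower emb rep_frac rep_cover.
exists (2 * k)%N; first by rewrite muln_gt0.
exists (Num.max X0 (2 * k%:R * h%:R)) => X; rewrite ge_max => /andP[/H0 {}H0 HX].
have le : (\sum_i Mc iota (rep i) X%:R <= \sum_i quad_count (rep i) X + h)%N.
  apply: (@leq_trans (\sum_i (quad_count (rep i) X).+1)).
    by apply: leq_sum => i _; case: (quad_count_bounds X (rep_frac i)).
  have -> : (\sum_i (quad_count (rep i) X).+1 = \sum_i (quad_count (rep i) X + 1))%N.
    by apply: eq_bigr => i _; rewrite addn1.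
  by rewrite big_split /= sum1_card card_ord.
move: le; rewrite -(ler_nat R) natrD => /(ler_wpM2l (ler0n R k)).
rewrite mulrDr natrM; move: H0 HX.
move: (k%:R * (\sum_i Mc _ _ _)%:R) => a; rewrite -!mulrA.
move: (k%:R * (\sum_i _)%:R) (k%:R * h%:R) X%:R.
by move=> b c x *; lra.
Qed.

(** With $M$ the count for [C] and $N$ the total, $hM-N$ is the sum over the classes of $M$ minus
    their counts, hence at most $h\delta X$ in absolute value; dividing by $hN$ with $N\ge X/k$
    leaves $\delta k$, which is half of [eps]. *)
Lemma quad_density C (eps : rat) : fideal C -> 0 < eps -> exists X0 : nat, forall X : nat, (X0 <= X)%N ->
  `|(quad_count C X)%:R / (\sum_i quad_count (rep i) X)%N%:R - h%:R^-1| < eps.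
Proof.
move=> fC eps0; have [k k0 [X1 H1]] := quad_total_lower.
have kR : 0 < k%:R :> R by rewrite ltr0n.
have hR : 0 < h%:R :> R by rewrite ltr0n class_count_gt0.
have [ep [ep0 Eep]] : exists ep : R, 0 < ep /\ ep = ratr eps by exists (ratr eps); rewrite ltr0q.
have del0 : 0 < ep / (2 * k%:R) by rewrite divr_gt0 // mulr_gt0.
have [X2 H2] := quad_count_compare fC del0.
have [z z0 Hz] := natural_bound (Num.max X1 X2).
exists z => X zX; have {}Hz : Num.max X1 X2 <= X%:R.
  by apply: le_trans Hz _; rewrite ler_nat.
move: Hz; rewrite ge_max => /andP[/H1 {}H1 /H2 {}H2].
have X0 : 0 < X%:R :> R by rewrite ltr0n; apply: leq_trans zX.
set N := (\sum_i _)%N in H1 *; set M := quad_count C X in H2 *.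
have N0 : 0 < N%:R :> R.
  rewrite ltr0n lt0n; apply: contraTneq H1 => ->; by rewrite mulr0 -ltNge.
rewrite -(ltr_rat R) -Eep ratr_norm rmorphB fmorph_div fmorphV !rmorph_nat.
have E : M%:R / N%:R - h%:R^-1 = (h%:R * M%:R - N%:R) / (h%:R * N%:R) :> R.
  by field; rewrite !gt_eqF.
rewrite E normrM normfV (gtr0_norm (mulr_gt0 hR N0)) ltr_pdivrMr ?mulr_gt0 //.
have B : `|h%:R * M%:R - N%:R| <= h%:R * (ep / (2 * k%:R) * X%:R) :> R.
  have -> : h%:R * M%:R - N%:R = \sum_(i < h) (M%:R - (quad_count (rep i) X)%:R) :> R.
    by rewrite sumrB sumr_const card_ord mulr_natl /N natr_sum.
  apply: le_trans (ler_norm_sum _ _ _) _.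
  apply: (@le_trans _ _ (\sum_(i < h) ep / (2 * k%:R) * X%:R)); first by apply: ler_sum.
  by rewrite sumr_const card_ord [X in _ <= X]mulr_natl.
apply: le_lt_trans B _; rewrite [X in _ < X]mulrCA ltr_pM2l //.
apply: (@le_lt_trans _ _ (ep / (2 * k%:R) * (k%:R * N%:R))); first by rewrite ler_pM2l.
have -> : ep / (2 * k%:R) * (k%:R * N%:R) = ep * N%:R / 2 by field; rewrite gt_eqF.
have : 0 < ep * N%:R by rewrite mulr_gt0.
by move: (ep * N%:R) => q ?; lra.
Qed.

End Density.

Theorem theorem4p1 (K : cset) (hK : nat) (C : cset) :
  number_field K -> class_number K hK -> frac_ideal K C ->
  exists N M : nat -> nat,
    [/\ (forall X, count_is (fun L => quad_ext K L /\ disc_norm_le K L X) (N X)),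
        (forall X, count_is (fun L => [/\ quad_ext K L, disc_norm_le K L X &
                                          steinitz_is K L C]) (M X)) &
        (forall eps : rat, 0 < eps -> exists X0 : nat, forall X : nat, (X0 <= X)%N ->
           `| (M X)%:R / (N X)%:R - (hK%:R)^-1 | < eps)].
Proof.
move=> /number_field_image[F [iota [-> [n [s [e [d emb]]]]]]].
move=> /class_number_image[rep [rep_frac rep_cover rep_inj]] /frac_ideal_imageP[A fA ->].
exists (fun X => \sum_i quad_count iota (rep i) X)%N, (quad_count iota A); split.
- by move=> X; exact (quad_count_total emb rep_frac rep_cover rep_inj X).
- by move=> X; exact (quad_count_class emb rep_cover X fA).
- by move=> eps eps0; exact (quad_density emb rep_frac rep_cover fA eps0).
Qed.
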